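(* Assume that hypotheses (F1)–(F6) of the context hold, with $r>0$ as in (F6), and let $(\omega_0,x_0)\in\Omega\times\widehat D^{-1}B_r$ be such that its omega-limit set satisfies $K=\mathcal{O}(\omega_0,x_0)\subset\Omega\times\widehat D^{-1}B_r$. Then $K=\{(\omega,c(\omega)):\omega\in\Omega\}$ is a copy of the base and $$\lim_{t\to\infty}\mathsf{d}(u(t,\omega_0,x_0),c(\omega_0\cdot t))=0,$$ where $c\colon\Omega\to BU$ is a continuous equilibrium, i.e. $c(\omega\cdot t)=u(t,\omega,c(\omega))$ for all $\omega\in\Omega$, $t\ge0$, and $c$ is continuous for the compact-open topology on $BU$.
   Context: Notation. $\|\cdot\|$ is the maximum norm on $\mathbb{R}^m$, $\le$ the componentwise order. $X=C((-\infty,0],\mathbb{R}^m)$ carries the compact-open topology, given by the metric $\mathsf{d}(x,y)=\sum_{n\ge1}2^{-n}\frac{\|x-y\|_n}{1+\|x-y\|_n}$, $\|x\|_n=\sup_{s\in[-n,0]}\|x(s)\|$. $BU\subset X$ is the Banach space of bounded uniformly continuous functions with norm $\|x\|_\infty=\sup_{s\le0}\|x(s)\|$; $B_r=\{x\in BU:\|x\|_\infty\le r\}$. For continuous $x$ on $(-\infty,a]$ and $t\le a$, $x_t(s)=x(t+s)$, $s\le0$. $(\Omega,\sigma,\mathbb{R})$ is a minimal continuous flow on a compact metric space $(\Omega,d)$, $\sigma(t,\omega)=\omega\cdot t$. The product metric topology on $\Omega\times BU$ uses the compact-open topology on $BU$. Operator $D\colon BU\to\mathbb{R}^m$: linear,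 continuous for $\|\cdot\|_\infty$, continuous on each $B_r$ for the compact-open topology, atomic at $0$, of the form $Dx=x(0)-\int_{-\infty}^0[d\nu(s)]x(s)$, where $\nu=[\nu_{ij}]$ is an $m\times m$ matrix of real regular Borel measures on $(-\infty,0]$ of finite total variation with $|\nu_{ij}|(\{0\})=0$; and $D$ is stable: there is a continuous $c_D\colon[0,\infty)\to[0,\infty)$ with $c_D(t)\to0$ as $t\to\infty$ such that for each $\varphi\in BU$ with $D\varphi=0$ the solution of $Dx_t=0$ ($t\ge0$), $x_0=\varphi$, satisfies $\|x(t)\|\le c_D(t)\|\varphi\|_\infty$, $t\ge0$. $\widehat D\colon BU\to BU$, $(\widehat Dx)(s)=Dx_s$, is then an isomorphism of $BU$. $D_i$ denotes the $i$-th component of $D$. Order: $x\le_Dy$ iff $Dx_s\le Dy_s$ for all $s\le0$. Family of NFDEs: $\frac{d}{dt}Dz_t=F(\omega\cdot t,z_t)$, $t\ge0$, $\omega\in\Omega$, with $F\colon\Omega\times BU\to\mathbb{R}^m$. For $x\in BU$, $z(t,\omega,x)$ is the (unique, locally defined) solution with $z(s,\omega,x)=x(s)$ for $s\le0$; $z_t(\omega,x)=u(t,\omega,x)\in BU$ is given by $u(t,\omega,x)(s)=z(t+s,\omega,x)$, and $\tau(t,\omega,x)=(\omega\cdot t,u(t,\omega,x))$ is the local skew-product semiflow. Assertions about solutions are understood whenever these are defined. Hypotheses: (F1) $F$ is continuous on $\Omega\times BU$ and locally Lipschitz in $x$ for $\|\cdot\|_\infty$. (F2) For each $r>0$, $F(\Omega\times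 B_r)$ is bounded. (F3) For each $r>0$, $F\colon\Omega\times B_r\to\mathbb{R}^m$ is continuous for the restriction of the compact-open topology to $B_r$. (F4) If $x,y\in BU$, $x\le_Dy$ and $D_jx=D_jy$ for some $j\in\{1,\dots,m\}$, then $F_j(\omega,x)\le F_j(\omega,y)$ for each $\omega\in\Omega$. (F5) If $x,y\in BU$, $x\le_Dy$ and $D_ix<D_iy$ for some $i\in\{1,\dots,m\}$, then $D_iz_t(\omega,x)<D_iz_t(\omega,y)$ for all $t\ge0$ and $\omega\in\Omega$. (F6) There is an $r>0$ such that all trajectories with initial data in $\widehat D^{-1}B_r$ are uniformly stable in $\widehat D^{-1}B_{r'}$ for each $r'>r$, and relatively compact for the product metric topology. Here the trajectory of $(\omega,x)$ is uniformly stable in a set $B\subset BU$ if for every $\varepsilon>0$ there is $\delta>0$ such that, if $s\ge0$, $y\in B$ and $\mathsf{d}(u(s,\omega,x),y)\le\delta$, then $\mathsf{d}(u(t+s,\omega,x),u(t,\omega\cdot s,y))\le\varepsilon$ for each $t\ge0$. Omega-limit set: $\mathcal{O}(\omega_0,x_0)=\{(\omega,x)\in\Omega\times BU:\exists\,t_n\uparrow\infty$ with $\omega_0\cdot t_n\to\omega$ and $\mathsf{d}(u(t_n,\omega_0,x_0),x)\to0\}$. *)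

(* Defs.v *)
From HB Require Import structures.
From mathcomp Require Import all_boot all_order all_algebra.
From mathcomp Require Import all_classical all_reals all_analysis.
From mathcomp Require Import lra.

Set Implicit Arguments.
Unset Strict Implicit.
Unset Printing Implicit Defensive.

Import Order.TTheory GRing.Theory Num.Theory.
Import numFieldNormedType.Exports.

Local Open Scope classical_set_scope.
Local Open Scope ring_scope.

(* The half-line (-oo, 0], as a subspace of R. *)
Definition past (R : realType) : Type := [set s : R | s <= 0].
HB.instance Definition _ (R : realType) := PseudoMetric.on (past R).

Definition tval (R : realType) (s : past R) : R := set_val s.

Lemma tval_le0 (R : realType) (s : past R) : tval s <= 0.
Proof. exact: (set_valP s). Qed.

Lemma min0_past (R : realType) (t : R) : Num.min t 0 \in [set s : R | s <= 0].
Proof. by rewrite inE/= ge_min lexx orbT. Qed.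

(* The time t <= 0 as a point of (-oo, 0]; positive times are sent to 0. *)
Definition clip (R : realType) (t : R) : past R := SigSub (min0_past t).

Lemma clipK (R : realType) (t : R) : t <= 0 -> tval (clip t) = t.
Proof. by move=> t0; exact: min_l. Qed.

Lemma tvalK (R : realType) (s : past R) : clip (tval s) = s.
Proof. by apply: val_inj; apply: min_l; exact: tval_le0. Qed.

(* BU: bounded uniformly continuous functions (-oo, 0] -> R^m. On 'rV[R]_m the
   library norm `|_| is the maximum norm. *)
Section BU_space.
Variables (R : realType) (m : nat).

Definition BU_set : set (past R -> 'rV[R]_m) :=
  [set x | bounded_fun x /\ unif_continuous x].

Definition BU_pred : {pred past R -> 'rV[R]_m} := mem BU_set.

Record BU : Type := MkBU { BU_fun :> past R -> 'rV[R]_m; _ : BU_fun \in BU_pred }.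

HB.instance Definition _ := [isSub for BU_fun].
HB.instance Definition _ := [Choice of BU by <:].

Lemma BU_boundedP (x : past R -> 'rV[R]_m) :
  bounded_fun x <-> exists M, forall s, `|x s| <= M.
Proof.
split; last first.
  move=> [M xM]; exists M; split; first by rewrite num_real.
  by move=> N MN s _; apply: le_trans (xM s) (ltW MN).
move=> [M [_ xM]]; exists (M + 1) => s; apply: (xM (M + 1)) => //.
by rewrite ltrDl.
Qed.

Lemma BU_ucP (x : past R -> 'rV[R]_m) :
  unif_continuous x <->
  forall e : R, 0 < e -> exists2 d : R, 0 < d &
    forall s t, `|tval s - tval t| < d -> `|x s - x t| < e.
Proof.
rewrite unif_continuousP; split=> H e e0.
  have /= [d /= d0 dH] := H e e0; exists d => // s t st.
  by have /= := dH (s, t) st; rewrite -ball_normE.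
have [d d0 dH] := H e e0; exists d => //= -[s t] /= st.
by rewrite -ball_normE /=; exact: dH.
Qed.

Lemma BU_predP (x : past R -> 'rV[R]_m) : reflect
  ((exists M, forall s, `|x s| <= M) /\
   forall e : R, 0 < e -> exists2 d : R, 0 < d &
     forall s t, `|tval s - tval t| < d -> `|x s - x t| < e)
  (x \in BU_pred).
Proof.
apply: (iffP idP).
  by rewrite /BU_pred inE => /= -[/BU_boundedP bx /BU_ucP ux].
by move=> [bx ux]; rewrite inE; split; [exact/BU_boundedP|exact/BU_ucP].
Qed.

Lemma BU_submod_closed : submod_closed BU_pred.
Proof.
split.
  apply/BU_predP; split; first by exists 0 => s; rewrite normr0.
  by move=> e e0; exists 1 => // s t _; rewrite subrr normr0.
move=> a x y /BU_predP[[M xM] ux] /BU_predP[[N yN] uy]; apply/BU_predP; split.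
  exists (`|a| * M + N) => s; apply: le_trans (ler_normD _ _) _.
  by rewrite lerD//= normrZ ler_wpM2l.
move=> e e0; have e20 : 0 < e / 2 by rewrite divr_gt0.
have a0 : 0 < `|a| + 1 by rewrite ltr_wpDl.
have [d1 d10 H1] := ux (e / 2 / (`|a| + 1)) (divr_gt0 e20 a0).
have [d2 d20 H2] := uy (e / 2) e20.
exists (Num.min d1 d2); first by rewrite lt_min d10.
move=> s t; rewrite lt_min => /andP[/H1 st1 /H2 st2].
rewrite [X in `|X|](_ : _ = a *: (x s - x t) + (y s - y t)); last first.
  by rewrite scalerBr /= addrACA opprD.
rewrite (splitr e); apply: le_lt_trans (ler_normD _ _) _.
rewrite ler_ltD// normrZ.
apply: (@le_trans _ _ ((`|a| + 1) * (e / 2 / (`|a| + 1)))); last first.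
  by rewrite mulrC divfK// gt_eqF.
by apply: ler_pM => //; [rewrite lerDl|exact: ltW].
Qed.

HB.instance Definition _ :=
  GRing.isSubmodClosed.Build _ _ BU_pred BU_submod_closed.
HB.instance Definition _ := [SubChoice_isSubLmodule of BU by <:].

(* The element of BU with underlying function f (0 if f is not in BU). *)
Definition mkBU (f : past R -> 'rV[R]_m) : BU := insubd (0 : BU) f.

Lemma mkBUE f : f \in BU_pred -> mkBU f = f :> (past R -> _).
Proof. by move=> fBU; rewrite /mkBU -[LHS]/(val _) val_insubd fBU. Qed.

Definition BU_norm (x : BU) : R := sup [set `|x s| | s in [set: past R]].

Lemma BUP (x : BU) : (BU_fun x) \in BU_pred.
Proof. by case: x. Qed.

Lemma BU_norm_ub (x : BU) s : `|x s| <= BU_norm x.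
Proof.
have /BU_predP[[M xM] _] := BUP x.
by apply: ub_le_sup; [exists M => _ [t _ <-]|exists s].
Qed.

Lemma BU_norm_le (x : BU) M : (forall s, `|x s| <= M) -> BU_norm x <= M.
Proof.
move=> xM; apply: ge_sup; first by exists `|x (clip 0)|, (clip 0).
by move=> _ [t _ <-].
Qed.

Let BU_ler_normD x y : BU_norm (x + y) <= BU_norm x + BU_norm y.
Proof.
apply: BU_norm_le => s; apply: le_trans (ler_normD _ _) _.
by rewrite lerD// BU_norm_ub.
Qed.

Let BU_normrZ (l : R) x : BU_norm (l *: x) = `|l| * BU_norm x.
Proof.
apply/le_anti/andP; split.
  by apply: BU_norm_le => s; rewrite normrZ ler_wpM2l// BU_norm_ub.
have [->|l0] := eqVneq l 0.
  rewrite normr0 mul0r; apply: le_trans (BU_norm_ub _ (clip 0)).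
  exact: normr_ge0.
rewrite -ler_pdivlMl ?normr_gt0//; apply: BU_norm_le => s.
by rewrite ler_pdivlMl ?normr_gt0// -normrZ; exact: (BU_norm_ub (l *: x)).
Qed.

Let BU_normr0_eq0 x : BU_norm x = 0 -> x = 0.
Proof.
move=> x0; apply: val_inj; apply/funext => s /=; apply/normr0_eq0/le_anti.
by rewrite normr_ge0 andbT -x0 BU_norm_ub.
Qed.

HB.instance Definition _ :=
  Lmodule_isNormed.Build R BU BU_ler_normD BU_normrZ BU_normr0_eq0.

Lemma BU_normE (x : BU) : `|x| = BU_norm x.
Proof. by []. Qed.

(* \|x\|_n = sup of the norm of x over [-n, 0] *)
Definition seminorm (x : BU) (n : nat) : R :=
  sup [set `|x s| | s in [set s : past R | - n%:R <= tval s]].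

(* The metric of the compact-open topology. *)
Definition co_dist (x y : BU) : R :=
  limn (fun N => \sum_(1 <= n < N)
    (2 ^- n * (seminorm (x - y) n / (1 + seminorm (x - y) n)))).

Lemma seminorm_ub (x : BU) n s : - n%:R <= tval s -> `|x s| <= seminorm x n.
Proof.
move=> ns; have /BU_predP[[M xM] _] := BUP x.
by apply: ub_le_sup; [exists M => _ [t _ <-]|exists s].
Qed.

Lemma seminorm_le (x : BU) n M :
  (forall s, - n%:R <= tval s -> `|x s| <= M) -> seminorm x n <= M.
Proof.
move=> xM; apply: ge_sup; last by move=> _ [t /= nt <-]; exact: xM.
by exists `|x (clip 0)|, (clip 0) => //=; rewrite clipK// oppr_le0.
Qed.

Lemma seminorm_ge0 (x : BU) n : 0 <= seminorm x n.
Proof.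
apply: (@le_trans _ _ `|x (clip 0)|) => //.
by apply: seminorm_ub; rewrite clipK// oppr_le0.
Qed.

Lemma seminorm_triangle (x y z : BU) n :
  seminorm (x - z) n <= seminorm (x - y) n + seminorm (y - z) n.
Proof.
apply: seminorm_le => s ns.
have -> : (x - z) s = (x - y) s + (y - z) s by rewrite /= addrA subrK.
by apply: le_trans (ler_normD _ _) _; rewrite lerD// seminorm_ub.
Qed.

Let tm (x y : BU) n : R :=
  2 ^- n * (seminorm (x - y) n / (1 + seminorm (x - y) n)).

Let tm_ge0 x y n : 0 <= tm x y n.
Proof.
by rewrite mulr_ge0 ?invr_ge0 ?exprn_ge0// divr_ge0 ?addr_ge0// seminorm_ge0.
Qed.

Let tm_le x y n : tm x y n <= 2 ^- n.
Proof.
rewrite ler_piMr ?invr_ge0 ?exprn_ge0// ler_pdivrMr ?mul1r ?lerDr//.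
by rewrite ltr_pwDl// seminorm_ge0.
Qed.

Let tm_part_le x y N : \sum_(1 <= n < N) tm x y n <= 1.
Proof.
case: N => [|N]; first by rewrite big_geq.
suff: \sum_(1 <= n < N.+1) tm x y n <= 1 - 2 ^- N.
  by move=> /le_trans; apply; rewrite gerBl invr_ge0 exprn_ge0.
elim: N => [|N IH]; first by rewrite big_geq// expr0 invr1 subrr.
rewrite big_nat_recr//=; apply: le_trans (lerD IH (tm_le x y N.+1)) _.
have -> : 2 ^- N.+1 = 2 ^- N / 2 :> R by rewrite exprS invfM mulrC.
lra.
Qed.

Let tm_is_cvg x y : cvgn (fun N => \sum_(1 <= n < N) tm x y n).
Proof.
apply: nondecreasing_is_cvgn.
  apply/nondecreasing_seqP => -[|N]; first by rewrite !big_geq.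
  by rewrite [leRHS]big_nat_recr//= lerDl.
by exists 1 => _ [N _ <-].
Qed.

Let co_distE x y : co_dist x y = limn (fun N => \sum_(1 <= n < N) tm x y n).
Proof. by []. Qed.

Let co_distxx x : co_dist x x = 0.
Proof.
rewrite co_distE (_ : (fun _ => _) = cst 0) ?lim_cst//.
apply/funext => N; rewrite big1_seq// => n _; rewrite /tm subrr.
suff -> : seminorm 0 n = 0 by rewrite mul0r mulr0.
apply/le_anti; rewrite seminorm_ge0 andbT.
by apply: seminorm_le => s _; rewrite normr0.
Qed.

Let tm_le_co_dist x y n : (0 < n)%N -> tm x y n <= co_dist x y.
Proof.
move=> n0; rewrite co_distE.
apply: le_trans (nondecreasing_cvgn_le _ (@tm_is_cvg x y) n.+1).
  by rewrite big_nat_recr//= lerDr sumr_ge0.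
apply/nondecreasing_seqP => -[|N]; first by rewrite !big_geq.
by rewrite [leRHS]big_nat_recr//= lerDl.
Qed.

Let co_dist_positivity x y : co_dist x y = 0 -> x = y.
Proof.
move=> xy0; apply: val_inj; apply/funext => s; apply/eqP; rewrite -subr_eq0.
rewrite -normr_le0; have [n sn] : exists n, - (n.+1%:R) <= tval s.
  exists (Num.truncn (- tval s)); rewrite lerNl; apply: ltW.
  by rewrite truncnS_gt.
apply: (@le_trans _ _ (seminorm (x - y) n.+1)).
  exact: (@seminorm_ub (x - y) n.+1 s sn).
have := @tm_le_co_dist x y n.+1 isT; rewrite xy0.
rewrite /tm pmulr_rle0 ?invr_gt0 ?exprn_gt0// pmulr_lle0//.
by rewrite invr_gt0 ltr_pwDl// seminorm_ge0.
Qed.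

Let co_dist_sym x y : co_dist x y = co_dist y x.
Proof.
rewrite !co_distE; congr (limn _); apply/funext => N.
apply: eq_bigr => n _; rewrite /tm.
suff -> : seminorm (x - y) n = seminorm (y - x) n by [].
rewrite /seminorm; congr sup; apply/seteqP; split => _ [s ns <-];
by exists s => //=; rewrite distrC.
Qed.

Let tm_triangle x y z n : tm x z n <= tm x y n + tm y z n.
Proof.
rewrite /tm -mulrDr ler_wpM2l ?invr_ge0 ?exprn_ge0//.
have := seminorm_triangle x y z n.
move: (seminorm_ge0 (x - z) n) (seminorm_ge0 (x - y) n).
move: (seminorm_ge0 (y - z) n).
move: (seminorm _ n) (seminorm (x - y) n) (seminorm (y - z) n) => a b c.
move=> c0 a0 b0 abc.
have p t : 0 <= t -> 0 < 1 + t by move=> t0; rewrite ltr_pwDl.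
rewrite addf_div ?gt_eqF ?p// ler_pdivrMr ?p// mulrAC.
rewrite ler_pdivlMr ?mulr_gt0 ?p//.
have bc0 : 0 <= b * c by rewrite mulr_ge0.
have abc0 : 0 <= a * (b * c) by rewrite mulr_ge0.
nra.
Qed.

Let co_dist_triangle y x z : co_dist x z <= co_dist x y + co_dist y z.
Proof.
rewrite !co_distE -limD//; apply: ler_lim => //; first exact: is_cvgD.
by apply: nearW => N; rewrite addrfctE -big_split/=; apply: ler_sum.
Qed.

(* BU with the compact-open topology. *)
Definition BUco : Type := BU.

HB.instance Definition _ := Choice.on BUco.
HB.instance Definition _ := isMetric.Build R BUco
  co_distxx co_dist_positivity co_dist_sym co_dist_triangle.

End BU_space.

(* Real Borel measures are charges (finite-valued, hence of finite total
   variation, and regular on R). The Hahn decomposition below is a choice; the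
   Jordan decomposition does not depend on it. *)
Section signed_measure.
Variables (R : realType) (nu : {charge set (measurableTypeR R) -> \bar R}).

Lemma hahn_ex : exists PN : set (measurableTypeR R) * set (measurableTypeR R),
  hahn_decomposition nu PN.1 PN.2.
Proof. by have [P [N h]] := Hahn_decomposition nu; exists (P, N). Qed.

Let hahn := svalP (cid hahn_ex).

Definition charge_abs : set (measurableTypeR R) -> \bar R := charge_variation hahn.

Definition charge_Rint (A : set R) (f : R -> R) : R :=
  \int[jordan_pos hahn]_(s in A) f s - \int[jordan_neg hahn]_(s in A) f s.

End signed_measure.

Section operator_D.
Variables (R : realType) (m : nat).
Notation V := 'rV[R]_m.
Notation BU := (BU R m).

(* z_t = z(t + .) on (-oo, 0]. It depends only on z on (-oo, t] and is used when
   this restriction is bounded and uniformly continuous, which holds as soon as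
   z extends an element of BU continuously; otherwise it is the default 0. *)
Definition hist (z : R -> V) (t : R) : BU := mkBU (fun s => z (t + tval s)).

(* x_s for x in BU and s <= 0 *)
Definition seg (x : BU) (s : past R) : BU :=
  hist (fun t => x (clip t)) (tval s).

Lemma segE (x : BU) (s r : past R) : seg x s r = x (clip (tval s + tval r)).
Proof.
rewrite /seg /hist mkBUE//.
have /BU_predP[[M xM] ux] := BUP x.
apply/BU_predP; split; first by exists M.
move=> e /ux[d d0 H]; exists d => // p q pq; apply: H.
have le0 q' : tval s + tval q' <= 0 by rewrite -[0]addr0 lerD// tval_le0.
by rewrite !clipK// opprD addrACA subrr add0r.
Qed.

Definition cball (r : R) : set BU := [set x | `|x| <= r].

Variable D : BU -> V.

Definition Dhat (x : BU) : BU := mkBU (fun s => D (seg x s)).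

(* When D is a bounded linear operator, s |-> D x_s is indeed in BU. *)
Lemma DhatE (x : BU) (s : past R) :
  linear D -> continuous D -> Dhat x s = D (seg x s).
Proof.
move=> linD contD; rewrite /Dhat mkBUE//.
pose Dl : {linear BU -> V} := HB.pack D (GRing.isLinear.Build _ _ _ _ _ linD).
have : bounded_near (Dl : BU -> V) (nbhs (0 : BU)).
  by apply: continuous_linear_bounded; exact: contD.
move/linear_boundedP => -[C [_ /(_ (`|C| + 1)) DC]].
have C0 : C < `|C| + 1 by rewrite (le_lt_trans (ler_norm _))// ltrDl.
have CC0 : 0 < `|C| + 1 by rewrite ltr_wpDl.
have {C0}DC y : `|D y| <= (`|C| + 1) * `|y| by exact: DC.
have /BU_predP[[M xM] ux] := BUP x.
apply/BU_predP; split.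
  exists ((`|C| + 1) * M) => p; apply: le_trans (DC _) _.
  rewrite ler_wpM2l ?(ltW CC0)// BU_normE; apply: BU_norm_le => q.
  by rewrite segE.
move=> e e0; have e20 : 0 < e / 2 by rewrite divr_gt0.
have [d d0 H] := ux (e / 2 / (`|C| + 1)) (divr_gt0 e20 CC0).
exists d => // p q pq.
have -> : D (seg x p) - D (seg x q) = D (seg x p - seg x q).
  by rewrite -[RHS]/(Dl _) linearB.
apply: (le_lt_trans (DC _)).
apply: (@le_lt_trans _ _ ((`|C| + 1) * (e / 2 / (`|C| + 1)))).
  rewrite ler_wpM2l ?(ltW CC0)// BU_normE; apply: BU_norm_le => t.
  rewrite -[X in `|X|]/(seg x p t - seg x q t) !segE; apply/ltW/H.
  have le0 q' : tval q' + tval t <= 0 by rewrite -[0]addr0 lerD// tval_le0.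
  by rewrite !clipK// opprD addrACA subrr addr0.
by rewrite mulrC divfK ?gt_eqF// ltr_pdivrMr// ltr_pMr// ltr1n.
Qed.

(* D x = x(0) - \int_{(-oo, 0]} [d nu(s)] x(s), where nu is an m x m matrix of
   real measures with |nu_ij|({0}) = 0; in particular D is atomic at 0. *)
Definition D_kernel : Prop :=
  exists nu : 'I_m -> 'I_m -> {charge set (measurableTypeR R) -> \bar R},
    (forall i j, charge_abs (nu i j) [set 0] = 0%E) /\
    (forall (x : BU) i, D x 0 i = x (clip 0) 0 i -
       \sum_(j < m) charge_Rint (nu i j) `]-oo, 0] (fun s => x (clip s) 0 j)).

Definition D_stable : Prop :=
  exists c : R -> R,
    [/\ {within `[0, +oo[, continuous c},
        (forall t, 0 <= t -> 0 <= c t),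
        c t @[t --> +oo] --> 0 &
        forall (phi : BU) (z : R -> V), D phi = 0 ->
          (forall s : past R, z (tval s) = phi s) -> continuous z ->
          (forall t, 0 <= t -> D (hist z t) = 0) ->
          forall t, 0 <= t -> `|z t| <= c t * `|phi|].

Definition admissible_D : Prop :=
  [/\ linear D,
      continuous D,
      (forall r : R, {within (cball r : set (BUco R m)),
         continuous (D : BUco R m -> V)}),
      D_kernel & D_stable].

(* x <=_D y *)
Definition leD (x y : BU) : Prop :=
  forall (s : past R) (j : 'I_m), D (seg x s) 0 j <= D (seg y s) 0 j.

End operator_D.

Section flow.
Variables (R : realType) (Omega : metricType R) (sigma : R -> Omega -> Omega).

Definition continuous_flow : Prop :=
  [/\ continuous (fun p : R * Omega => sigma p.1 p.2),
      (forall w, sigma 0 w = w) &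
      forall s t w, sigma (t + s) w = sigma t (sigma s w)].

Definition minimal_flow : Prop :=
  forall A : set Omega, A !=set0 -> compact A ->
    (forall t, sigma t @` A = A) -> A = [set: Omega].

End flow.

Section neutral_equation.
Variables (R : realType) (m : nat) (Omega : metricType R).
Variables (sigma : R -> Omega -> Omega).
Notation V := 'rV[R]_m.
Notation BU := (BU R m).
Notation BUco := (BUco R m).
Variables (D : BU -> V) (F : Omega -> BU -> V).

(* z is a solution on [0, a] of d/dt D z_t = F (w.t, z_t) with z_0 = x; the
   derivatives at 0 and a are one-sided. *)
Definition is_solution (w : Omega) (x : BU) (a : R) (z : R -> V) : Prop :=
  [/\ (forall s : past R, z (tval s) = x s),
      {within `]-oo, a], continuous z} &
      forall t, 0 <= t <= a ->
        h^-1 *: (D (hist z (t + h)) - D (hist z t))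
          @[h --> within [set h | 0 <= t + h <= a] 0^']
          --> F (sigma t w) (hist z t)].

Definition u_defined (t : R) (w : Omega) (x : BU) : Prop :=
  exists z, is_solution w x t z.

(* u(t, w, x) = z_t(w, x), meaningful when u_defined t w x. Under (F1) solutions
   are unique, so the choice of z made by xget is immaterial. *)
Definition u (t : R) (w : Omega) (x : BU) : BU :=
  hist (xget (fun s => x (clip s)) [set z | is_solution w x t z]) t.

(* BU carries here the topology of the supremum norm. *)
Definition hypF1 : Prop :=
  continuous (fun p : Omega * BU => F p.1 p.2) /\
  forall (w0 : Omega) (x0 : BU), exists L : R,
    exists2 d : R, 0 < d & forall w x y, mdist w0 w < d ->
      `|x - x0| < d -> `|y - x0| < d -> `|F w x - F w y| <= L * `|x - y|.

Definition hypF2 : Prop :=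
  forall r : R, 0 < r -> exists M : R,
    forall w x, cball r x -> `|F w x| <= M.

Definition hypF3 : Prop :=
  forall r : R, 0 < r ->
    {within [set p : Omega * BUco | cball r (p.2 : BU)],
      continuous (fun p : Omega * BUco => F p.1 (p.2 : BU))}.

Definition hypF4 : Prop :=
  forall (x y : BU) (j : 'I_m), leD D x y -> D x 0 j = D y 0 j ->
    forall w, F w x 0 j <= F w y 0 j.

Definition hypF5 : Prop :=
  forall (x y : BU) (i : 'I_m), leD D x y -> D x 0 i < D y 0 i ->
    forall t w, 0 <= t -> u_defined t w x -> u_defined t w y ->
      D (u t w x) 0 i < D (u t w y) 0 i.

Definition trajectory (w : Omega) (x : BU) : set (Omega * BUco) :=
  [set (sigma t w, u t w x : BUco) | t in [set t | 0 <= t]].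

Definition uniformly_stable_in (B : set BU) (w : Omega) (x : BU) : Prop :=
  forall e : R, 0 < e -> exists2 d : R, 0 < d &
    forall (s : R) (y : BU), 0 <= s -> B y -> co_dist (u s w x) y <= d ->
      forall t, 0 <= t -> u_defined t (sigma s w) y ->
        co_dist (u (t + s) w x) (u t (sigma s w) y) <= e.

(* Condition (F6) for a given r; these trajectories are required to be
   global, as relative compactness presupposes. *)
Definition hypF6 (r : R) : Prop :=
  0 < r /\
  forall (w : Omega) (x : BU), cball r (Dhat D x) ->
    [/\ (forall t, 0 <= t -> u_defined t w x),
        (forall r', r < r' ->
           uniformly_stable_in (Dhat D @^-1` cball r') w x) &
        precompact (trajectory w x)].

Definition omega_limit (w0 : Omega) (x0 : BU) : set (Omega * BUco) :=
  [set p | exists t_ : nat -> R,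
     [/\ nondecreasing_seq t_, t_ @ \oo --> +oo,
         sigma (t_ n) w0 @[n --> \oo] --> p.1 &
         co_dist (u (t_ n) w0 x0) p.2 @[n --> \oo] --> 0]].

End neutral_equation.

(* Main.v *)
Require Import Defs.
From HB Require Import structures.
From mathcomp Require Import all_boot all_order all_algebra.
From mathcomp Require Import all_classical all_reals all_analysis.
From mathcomp Require Import lra ring measurable_realfun.

Set Implicit Arguments.
Unset Strict Implicit.
Unset Printing Implicit Defensive.

Import Order.TTheory GRing.Theory Num.Theory.
Import numFieldNormedType.Exports.

Local Open Scope classical_set_scope.
Local Open Scope ring_scope.

Local Notation tval := Defs.tval.

(* Histories stand for solutions: an entire orbit in the omega-limit set K is encoded by
   the points of K themselves. The infimum b of the fibre K(w0), computed after applying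
   the inverse-positive transformation Dhat, satisfies Dhat b in B_r, and its omega-limit
   set lies below K. As b dominates its own limit points over w0, this limit set has one
   point per fibre, i.e. it is a continuous copy c of the base. By (F5) and minimality
   each component of D either agrees on K and c or is separated by a uniform gap, so an
   omega-limit set close to c that starts above b and below K stays below K, hence below
   b over w0, and equals c. Moving along the segment from b to a point of K(w0), uniform
   stability makes the set of parameters with this limit both open and closed, so c is
   part of K, and stability again gives K = c. *)

(** * The compact-open metric on BU *)

(** Two limitations of the hypotheses shape the proof. (F5) gives strict inequalities one component
    at a time and never a strong order between two states, so the components in which [K] meets the
    copy must be treated apart from those with a gap. (F6) compares an orbit with states over the
    same base point, whereas two points of a limit set share a fibre that the orbit merely
    approaches. Passing stability to the limit set therefore requires that solutions through a given
    history exist and stay close over nearby base points; the Picard iteration supplies this.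
    Comparing limit points in turn requires approximations over common base points, that is, lower
    semicontinuity of the fibres, which follows from stability and minimality. The inverse of [Dhat]
    is derived from [admissible_D]: small mass of [nu] near 0 gives a Neumann series on short
    intervals, stability gives bounds uniform in time, and together they turn the order of [leD]
    into the componentwise order of functions, where infima and maxima are computed pointwise. *)

Section sequences_in_metric_spaces.
Variable R : realType.

(** Sequential convergence for a bare distance function, so that [mdist], [co_dist] and distances
    given by norms share the same lemmas. *)
Definition cvd (T : Type) (d : T -> T -> R) (u : nat -> T) (l : T) :=
  forall e : R, 0 < e -> exists N, forall n, (N <= n)%N -> d l (u n) < e.

(* Monotonicity is not needed: [n <= f n] already preserves limits. *)
Definition extraction (f : nat -> nat) := forall n, (n <= f n)%N.

Lemma extraction_comp f g : extraction f -> extraction g ->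
  extraction (f \o g).
Proof. by move=> hf hg n; apply: leq_trans (hg n) (hf _). Qed.

Lemma cvd_extract T (d : T -> T -> R) u l f : extraction f -> cvd d u l ->
  cvd d (u \o f) l.
Proof.
by move=> hf ul e /ul[N HN]; exists N => n Nn; apply: HN (leq_trans Nn (hf n)).
Qed.

Lemma invS_lt (e : R) : 0 < e -> exists N : nat, forall n, (N <= n)%N ->
  n.+1%:R^-1 < e.
Proof.
move=> e0; exists (Num.truncn e^-1) => n Nn.
rewrite invf_plt ?posrE//; apply: lt_le_trans (truncnS_gt _) _.
by rewrite ler_nat.
Qed.

Lemma cvd_inv T (d : T -> T -> R) u l :
  (forall n, d l (u n) < n.+1%:R^-1) -> cvd d u l.
Proof.
move=> H e /invS_lt[N HN]; exists N => n Nn.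
exact: lt_trans (H n) (HN _ Nn).
Qed.

Lemma compact_extract (T : pseudoMetricType R) (A : set T) (u : nat -> T) :
  compact A -> (forall n, A (u n)) ->
  exists2 f, extraction f &
  exists2 l, A l & forall e : R, 0 < e ->
    exists N, forall n, (N <= n)%N -> ball l e (u (f n)).
Proof.
move=> cA uA.
have FA : (u @ \oo) A by exists 0%N => // n _; exact: uA.
have [l [Al cl]] := cA (u @ \oo) _ FA.
have H n : exists k, (n <= k)%N /\ ball l n.+1%:R^-1 (u k).
  have nb : nbhs l (ball l (n.+1%:R^-1 : R)).
    by apply: nbhsx_ballx; rewrite invr_gt0 ltr0Sn.
  have un : (u @ \oo) [set u k | k in [set k | (n <= k)%N]].
    by exists n => // k nk; exists k.
  by have [_ [[k nk <-] bk]] := cl _ _ un nb; exists k.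
have [f Hf] := choice H.
exists f; first by move=> n; case: (Hf n).
exists l => // e /invS_lt[N HN]; exists N => n Nn.
have [_] := Hf n; apply: le_ball; exact: ltW (HN _ Nn).
Qed.

Lemma compact_extract_metric (T : metricType R) (A : set T) (u : nat -> T) :
  compact A -> (forall n, A (u n)) ->
  exists2 f, extraction f & exists2 l, A l & cvd mdist (u \o f) l.
Proof.
move=> cA /(compact_extract cA)[f hf [l Al H]]; exists f => //; exists l => //.
by move=> e /H[N HN]; exists N => n /HN; rewrite ballEmdist.
Qed.

Lemma segment_extract (a b : R) (u : nat -> R) :
  (forall n, a <= u n <= b) ->
  exists2 f, extraction f & exists2 l, a <= l <= b &
    cvd (fun x y : R => `|x - y|) (u \o f) l.
Proof.
move=> uab; have uI n : `[a, b]%classic (u n) by rewrite /= in_itv /= uab.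
have [f hf [l]] := compact_extract (@segment_compact _ a b) uI.
rewrite /= in_itv /= => lab H; exists f => //; exists l => //.
Qed.

Lemma precompact_extract (T1 T2 : metricType R) (A : set (T1 * T2))
    (u : nat -> T1) (v : nat -> T2) :
  precompact A -> (forall n, A (u n, v n)) ->
  exists2 f, extraction f & exists l1 l2,
    [/\ cvd mdist (u \o f) l1, cvd mdist (v \o f) l2 & closure A (l1, l2)].
Proof.
rewrite precompactE => cA uA.
have uA' n : closure A (u n, v n) by apply: subset_closure; exact: uA.
have [f hf [[l1 l2] Al H]] := compact_extract cA uA'.
exists f => //; exists l1, l2; split => // e /H[N HN]; exists N => n /HN[/=];
by rewrite !ballEmdist.
Qed.

End sequences_in_metric_spaces.

Section half_line.
Variables (R : realType) (m : nat).
Notation V := 'rV[R]_m.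
Notation BU := (BU R m).
Implicit Types (x y : BU) (s t : R).

Lemma clip_min t : tval (clip t) = Num.min t 0.
Proof. by []. Qed.

Lemma clip_lip s t : `|tval (clip s) - tval (clip t)| <= `|s - t|.
Proof.
rewrite !clip_min /Num.min; case: ltP => s0; case: ltP => t0 //.
- by rewrite subr0 !ltr0_norm// ?ltr_wnDr//; lra.
- by rewrite sub0r normrN ltr0_norm// ger0_norm//; lra.
- by rewrite subrr normr0.
Qed.

Lemma BU_ext x y : (forall t, t <= 0 -> x (clip t) = y (clip t)) -> x = y.
Proof.
move=> H; apply: val_inj; apply/funext => s /=.
by rewrite -(Defs.tvalK s); apply: H; exact: tval_le0.
Qed.

Lemma BU_uc x e : 0 < e -> exists2 d : R, 0 < d &
  forall s t, `|s - t| < d -> `|x (clip s) - x (clip t)| < e.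
Proof.
move=> e0; have /BU_predP[_ /(_ e e0)[d d0 H]] := BUP x.
by exists d => // s t st; apply: H; apply: le_lt_trans st; exact: clip_lip.
Qed.

Lemma BU_ub x (p : past R) : `|x p| <= `|x|.
Proof. exact: BU_norm_ub. Qed.

Lemma BU_le x (M : R) : (forall t, t <= 0 -> `|x (clip t)| <= M) -> `|x| <= M.
Proof.
move=> H; rewrite BU_normE; apply: BU_norm_le => s.
by rewrite -(Defs.tvalK s); apply: H; exact: tval_le0.
Qed.

Lemma BUDE x y (p : past R) : (x + y) p = x p + y p. Proof. by []. Qed.
Lemma BUBE x y (p : past R) : (x - y) p = x p - y p. Proof. by []. Qed.
Lemma BUZE a x (p : past R) : (a *: x) p = a *: x p. Proof. by []. Qed.
Lemma BU0E (p : past R) : (0 : BU) p = 0. Proof. by []. Qed.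

Definition ofR (f : R -> V) : BU := mkBU (fun p : past R => f (tval p)).

Lemma ofRE (f : R -> V) : (exists M, forall t, t <= 0 -> `|f t| <= M) ->
  (forall e, 0 < e -> exists2 d : R, 0 < d &
    forall s t, s <= 0 -> t <= 0 -> `|s - t| < d -> `|f s - f t| < e) ->
  forall t, t <= 0 -> ofR f (clip t) = f t.
Proof.
move=> [M fM] uf t t0; rewrite /ofR mkBUE ?clipK//.
apply/BU_predP; split; first by exists M => s; exact: fM (tval_le0 s).
move=> e /uf[d d0 H]; exists d => // p q; apply: H; exact: tval_le0.
Qed.

Definition reparam x (phi : R -> R) : BU := ofR (fun t => x (clip (phi t))).

Lemma reparamE x phi t :
  (forall s t, s <= 0 -> t <= 0 -> `|phi s - phi t| <= `|s - t|) -> t <= 0 ->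
  reparam x phi (clip t) = x (clip (phi t)).
Proof.
move=> hphi; apply: (@ofRE (fun t => x (clip (phi t)))).
  by exists `|x| => s _; exact: BU_ub.
move=> e /(BU_uc x)[d d0 H]; exists d => // p q p0 q0 pq; apply: H.
exact: le_lt_trans (hphi _ _ p0 q0) pq.
Qed.

(* [x_t] for a real time [t <= 0]; positive times are sent to 0. *)
Definition sh x t := seg x (clip t).

Lemma shE x s t : s <= 0 -> t <= 0 -> sh x s (clip t) = x (clip (s + t)).
Proof. by move=> s0 t0; rewrite /sh segE !clipK. Qed.

Lemma sh0 x : sh x 0 = x.
Proof. by apply: BU_ext => t t0; rewrite shE// add0r. Qed.

Lemma sh_sh x s t : s <= 0 -> t <= 0 -> sh (sh x s) t = sh x (s + t).
Proof.
move=> s0 t0; apply: BU_ext => r r0; have st0 : s + t <= 0 by lra.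
have tr0 : t + r <= 0 by lra.
by rewrite !shE// addrA.
Qed.

Lemma sh_eval x t : t <= 0 -> sh x t (clip 0) = x (clip t).
Proof. by move=> t0; rewrite shE// addr0. Qed.

Lemma shD x y t : t <= 0 -> sh (x + y) t = sh x t + sh y t.
Proof. by move=> t0; apply: BU_ext => r r0; rewrite BUDE !shE. Qed.

Lemma shB x y t : t <= 0 -> sh (x - y) t = sh x t - sh y t.
Proof. by move=> t0; apply: BU_ext => r r0; rewrite BUBE !shE. Qed.

Lemma shZ a x t : t <= 0 -> sh (a *: x) t = a *: sh x t.
Proof. by move=> t0; apply: BU_ext => r r0; rewrite BUZE !shE. Qed.

Lemma sh_norm x t : `|sh x t| <= `|x|.
Proof. by apply: BU_le => r r0; rewrite /sh segE; exact: BU_ub. Qed.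

Lemma sh_uc x e : 0 < e -> exists2 d : R, 0 < d &
  forall s t, s <= 0 -> t <= 0 -> `|s - t| < d -> `|sh x s - sh x t| <= e.
Proof.
move=> /(BU_uc x)[d d0 H]; exists d => // s t s0 t0 st.
apply: BU_le => r r0; rewrite BUBE !shE//; apply/ltW/H.
by rewrite opprD addrACA subrr addr0.
Qed.

Lemma BU_dist_lt y x z (a b : R) : `|x - y| < a -> `|y - z| <= b ->
  `|x - z| < a + b.
Proof.
move=> xy yz; rewrite -(subrKA y) (le_lt_trans (ler_normD _ _))//.
exact: ltr_leD.
Qed.

End half_line.

Section compact_open_metric.
Variables (R : realType) (m : nat).
Notation BU := (BU R m).
Implicit Types (x y z : BU) (u v : nat -> BU).

Let tm x y (n : nat) : R :=
  2 ^- n * (seminorm (x - y) n / (1 + seminorm (x - y) n)).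

(* Found by [done] in the section context. *)
Let tm_ge0 x y n : 0 <= tm x y n.
Proof.
by rewrite mulr_ge0 ?invr_ge0 ?exprn_ge0// divr_ge0 ?addr_ge0// seminorm_ge0.
Qed.

Let co_distE x y : co_dist x y = limn (fun N => \sum_(1 <= n < N) tm x y n).
Proof. by []. Qed.

(** The series is cut at [k]: the terms up to [k] contribute at most [d] times a partial sum of the
    [2 ^- n], the later ones at most the geometric tail. The auxiliary bound [B] is the sharper
    closed form that passes through the induction. *)
Let partial_le x y (k : nat) (d : R) : 0 <= d ->
  (forall n, (0 < n <= k)%N -> seminorm (x - y) n <= d) ->
  forall N, \sum_(1 <= n < N) tm x y n <= d + 2 ^- k.
Proof.
move=> d0 H; have p2 (n : nat) : 0 < 2 ^- n :> R by rewrite invr_gt0 exprn_gt0.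
have S (n : nat) : 2 ^- n = 2 ^- n.+1 + 2 ^- n.+1 :> R.
  by rewrite exprS invfM; lra.
case=> [|N]; first by rewrite big_geq// addr_ge0// ltW.
pose B (N : nat) := d * (1 - 2 ^- N) +
  (if (N <= k)%N then 0 else 2 ^- k - 2 ^- N : R).
suff HB : \sum_(1 <= n < N.+1) tm x y n <= B N.
  apply: le_trans HB _; rewrite /B.
  have := p2 N; have := p2 k; move: (2 ^- N) (2 ^- k) => a b a0 b0.
  have := mulr_ge0 d0 (ltW b0); case: ifP => _; nra.
elim: N => [|N IH].
  by rewrite big_geq// /B expr0 invr1 subrr mulr0 leq0n addr0.
rewrite big_nat_recr//=; apply: le_trans (lerD IH (lexx _)) _.
have s0 := seminorm_ge0 (x - y) N.+1.
have s1 : 0 < 1 + seminorm (x - y) N.+1 by lra.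
rewrite /B (S N) /tm; case: (ltngtP N k) => Nk.
- have sd : seminorm (x - y) N.+1 / (1 + seminorm (x - y) N.+1) <= d.
    rewrite ler_pdivrMr//; have := H N.+1 Nk.
    have := mulr_ge0 d0 s0; nra.
  have := p2 N.+1; move: (2 ^- N.+1) sd => a; set q := _ / _ => sd a0; nra.
- have sd : seminorm (x - y) N.+1 / (1 + seminorm (x - y) N.+1) <= 1.
    rewrite ler_pdivrMr//; lra.
  have := p2 N.+1; move: (2 ^- N.+1) sd => a; set q := _ / _ => sd a0; nra.
- have sd : seminorm (x - y) N.+1 / (1 + seminorm (x - y) N.+1) <= 1.
    rewrite ler_pdivrMr//; lra.
  rewrite -Nk (S N).
  have := p2 N.+1; move: (2 ^- N.+1) sd => a; set q := _ / _ => sd a0; nra.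
Qed.

Let partial_cvg x y : cvgn (fun N => \sum_(1 <= n < N) tm x y n).
Proof.
apply: nondecreasing_is_cvgn.
  apply/nondecreasing_seqP => -[|N]; first by rewrite !big_geq.
  by rewrite [leRHS]big_nat_recr//= lerDl.
exists (0 + 2 ^- 0) => _ [N _ <-]; apply: partial_le => // n.
by rewrite andbC leqn0; case: eqP => // ->.
Qed.

Let tm_le_co_dist x y n : (0 < n)%N -> tm x y n <= co_dist x y.
Proof.
move=> n0; rewrite co_distE.
apply: le_trans (nondecreasing_cvgn_le _ (@partial_cvg x y) n.+1).
  by rewrite big_nat_recr//= lerDr sumr_ge0.
apply/nondecreasing_seqP => -[|N]; first by rewrite !big_geq.
by rewrite [leRHS]big_nat_recr//= lerDl.
Qed.

Lemma co_distC x y : co_dist x y = co_dist y x.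
Proof. exact: (metric_sym (x : BUco R m) y). Qed.

Lemma co_dist_ge0 x y : 0 <= co_dist x y.
Proof. exact: (mdist_ge0 (x : BUco R m) y). Qed.

Lemma co_distxx x : co_dist x x = 0.
Proof. exact: (mdistxx (x : BUco R m)). Qed.

Lemma co_dist_eq0 x y : co_dist x y = 0 -> x = y.
Proof. exact: (@mdist_positivity _ (BUco R m)). Qed.

Lemma co_dist_triangle y x z : co_dist x z <= co_dist x y + co_dist y z.
Proof. exact: (metric_triangle (x : BUco R m) y z). Qed.

Lemma co_dist_near (T e : R) : 0 < e -> exists2 d : R, 0 < d &
  forall x y, co_dist x y <= d ->
    forall t, - T <= t <= 0 -> `|x (clip t) - y (clip t)| <= e.
Proof.
move=> e0; pose n := (Num.truncn T).+1.
have Tn : T <= n%:R by apply: ltW; exact: truncnS_gt.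
have p2 : 0 < 2 ^- n :> R by rewrite invr_gt0 exprn_gt0.
(* This is the [n]-th term of the series for a seminorm equal to [e]; since [s / (1 + s)] increases
   with [s], a smaller distance forces a smaller seminorm. *)
exists (2 ^- n * (e / (1 + e))) => [|x y xy t /andP[Tt t0]].
  by rewrite mulr_gt0// divr_gt0//; lra.
have s0 := seminorm_ge0 (x - y) n.
have ts : `|x (clip t) - y (clip t)| <= seminorm (x - y) n.
  by apply: (@seminorm_ub _ _ (x - y)); rewrite clipK//; lra.
apply: le_trans ts _.
have := le_trans (@tm_le_co_dist x y n isT) xy.
rewrite /tm ler_pM2l// ler_pdivrMr; last lra.
rewrite mulrAC ler_pdivlMr; last lra.
move: (seminorm _ _) s0 => q q0; lra.
Qed.

Lemma near_co_dist (e : R) : 0 < e -> exists T : R, exists2 d : R, 0 < d &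
  forall x y, (forall t, - T <= t <= 0 -> `|x (clip t) - y (clip t)| <= d) ->
    co_dist x y < e.
Proof.
move=> e0; have e30 : 0 < e / 3 by lra.
have [k Hk] : exists k : nat, 2 ^- k < e / 3.
  have [k /(_ k (leqnn k)) Hk] := invS_lt e30; exists k.
  apply: le_lt_trans Hk; rewrite lef_pV2 ?posrE ?exprn_gt0//.
  by rewrite -natrX ler_nat ltn_expl.
exists k%:R, (e / 3) => // x y H.
rewrite co_distE; apply: (@le_lt_trans _ _ (e / 3 + 2 ^- k)); last lra.
apply: limr_le; first exact: partial_cvg.
apply: nearW => N; apply: partial_le; first lra.
move=> n /andP[_ nk]; apply: seminorm_le => p np; rewrite BUBE.
rewrite -(Defs.tvalK p); apply: H; rewrite tval_le0 andbT.
by apply: le_trans np; rewrite lerN2 ler_nat.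
Qed.

Lemma co_dist_lt y x z a b : co_dist x y < a -> co_dist y z < b ->
  co_dist x z < a + b.
Proof.
by move=> xy yz; apply: le_lt_trans (co_dist_triangle y x z) _; rewrite ltrD.
Qed.

Lemma co_dist_le y x z a b : co_dist x y <= a -> co_dist y z <= b ->
  co_dist x z <= a + b.
Proof.
by move=> xy yz; apply: le_trans (co_dist_triangle y x z) _; rewrite lerD.
Qed.

Definition cvc := cvd (@co_dist R m).

Lemma cvcP (u_ : nat -> BU) x : cvc u_ x <->
  forall T e : R, 0 < e -> exists N, forall n, (N <= n)%N ->
    forall t, - T <= t <= 0 -> `|x (clip t) - u_ n (clip t)| <= e.
Proof.
split=> H.
  move=> T e /(co_dist_near T)[d d0 dH]; have [N HN] := H d d0.
  by exists N => n /HN /ltW; exact: dH.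
move=> e /near_co_dist[T [d d0 dH]]; have [N HN] := H T d d0.
by exists N => n /HN; exact: dH.
Qed.

Lemma cvc_ev u_ x t : t <= 0 -> cvc u_ x ->
  forall e : R, 0 < e -> exists N, forall n, (N <= n)%N ->
    `|x (clip t) - u_ n (clip t)| <= e.
Proof.
move=> t0 /cvcP H e e0; have [N HN] := H (- t) e e0.
by exists N => n /HN; apply; rewrite opprK lexx.
Qed.

Lemma cvc_unique u x y : cvc u x -> cvc u y -> x = y.
Proof.
move=> xx xy; apply: co_dist_eq0; apply/le_anti; rewrite co_dist_ge0 andbT.
apply/ler_addgt0Pl => e e0; rewrite addr0.
have e20 : 0 < e / 2 by lra.
have [N1 H1] := xx _ e20; have [N2 H2] := xy _ e20.
have := H1 (maxn N1 N2) (leq_maxl _ _); have := H2 (maxn N1 N2) (leq_maxr _ _).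
rewrite (co_distC y) => yz xz.
by rewrite (splitr e); apply/ltW/(co_dist_lt xz yz).
Qed.

Lemma cvc_cst x : cvc (fun=> x) x.
Proof. by move=> e e0; exists 0%N => n _; rewrite co_distxx. Qed.

Lemma cvc_norm_le u_ x (M : R) : cvc u_ x -> (forall n, `|u_ n| <= M) ->
  `|x| <= M.
Proof.
move=> xx xM; apply: BU_le => t t0; apply/ler_addgt0Pl => e e0.
have [N /(_ _ (leqnn N)) H] := cvc_ev t0 xx e0.
rewrite -(subrK (u_ N (clip t)) (x (clip t))).
apply: le_trans (ler_normD _ _) _; rewrite lerD//.
by apply: le_trans (BU_ub _ _) (xM N).
Qed.

Lemma cvc_sh u_ x t : t <= 0 -> cvc u_ x -> cvc (fun n => sh (u_ n) t) (sh x t).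
Proof.
move=> t0 /cvcP H; apply/cvcP => T e e0; have [N HN] := H (T - t) e e0.
exists N => n /HN xn s /andP[Ts s0]; rewrite !shE//; apply: xn; lra.
Qed.

Lemma cvc_le_dist u v x y (e : R) : cvc u x -> cvc v y ->
  (forall k, exists n, (k <= n)%N /\ co_dist (u n) (v n) <= e) ->
  co_dist x y <= e.
Proof.
move=> xx yy H; apply/ler_addgt0Pl => d d0; have d20 : 0 < d / 2 by lra.
have [N1 H1] := xx _ d20; have [N2 H2] := yy _ d20.
have [n [Nn xy]] := H (maxn N1 N2).
have := H1 n (leq_trans (leq_maxl _ _) Nn).
have := H2 n (leq_trans (leq_maxr _ _) Nn); rewrite (co_distC y) => yn xn.
have -> : d + e = d / 2 + e + d / 2 by rewrite addrAC -splitr.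
exact: co_dist_le (co_dist_le (ltW xn) xy) (ltW yn).
Qed.

Lemma norm_cvc u_ x : cvd (fun x y : BU => `|x - y|) u_ x -> cvc u_ x.
Proof.
move=> H; apply/cvcP => T e /H[N HN]; exists N => n /HN xn t _.
by rewrite -BUBE; apply: le_trans (BU_ub _ _) (ltW xn).
Qed.

End compact_open_metric.

(** * The operator D and its inverse *)

Section atomic_at_zero.
Variables (R : realType).

(** The intervals [F n] decrease to the null set {0}, so continuity from above gives one of them
    measure below [e], and [f] vanishes on the rest of the half-line. *)
Lemma finite_measure_small (mu : {finite_measure set (measurableTypeR R) -> \bar R})
    (e : R) : 0 < e -> mu [set 0] = 0%E ->
  exists2 d : R, 0 < d & forall (d' : R), 0 < d' <= d -> forall (f : R -> R) (M : R),
    continuous f -> (forall s, s <= 0 -> `|f s| <= M) ->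
    (forall s, s <= - d' -> f s = 0) ->
    `|\int[mu]_(s in `]-oo, 0]) f s| <= e * M.
Proof.
move=> e0 mu0.
pose F (n : nat) : set (measurableTypeR R) := `[- n.+1%:R^-1, 0]%classic.
have mF n : measurable (F n) by exact: measurable_itv.
have capF : \bigcap_n F n = [set 0].
  apply/seteqP; split => [s /= Fs|_ -> n _]; last first.
    by rewrite /F /= in_itv /= lexx andbT oppr_le0 invr_ge0.
  have := Fs 0%N I; rewrite /F /= in_itv /= => /andP[_ s0].
  apply/eqP; move: s0; rewrite le_eqVlt => /orP[//|s0]; exfalso.
  have [|N /(_ N (leqnn N)) HN] := @invS_lt R (- s); first by rewrite oppr_gt0.
  have := Fs N I; rewrite /F /= in_itv /= => /andP[h _].
  by move: HN; rewrite ltrNr ltNge h.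
have Fcvg : mu \o F @ \oo --> 0%E.
  rewrite -mu0 -capF; apply: nonincreasing_cvg_mu => //.
  - by rewrite -ge0_fin_numE// fin_num_measure.
  - by rewrite capF; exact: measurable_set1.
  - apply/nonincreasing_seqP => n; apply/subsetPset => s.
    rewrite /F /= !in_itv /= => /andP[sn ->]; rewrite andbT.
    by apply: le_trans sn; rewrite lerN2 lef_pV2 ?posrE ?ltr0Sn// ler_nat.
have [n Hn] : exists n, (mu (F n) < e%:E)%E.
  have [|n _ /(_ n (leqnn n)) Hn] := Fcvg [set x | (x < e%:E)%E].
    exact: (@nbhs_open_ereal_lt _ 0 (fun=> e)).
  by exists n.
exists n.+1%:R^-1 => [|d' /andP[d'0 d'n] f M cf fM f0]; first by rewrite invr_gt0 ltr0Sn.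
have M0 : 0 <= M by apply: le_trans (fM 0 (lexx 0)); rewrite normr_ge0.
have mf : measurable_fun [set: R] f by apply: continuous_measurable_fun.
have fF s : s <= 0 -> (f \_ (F n)) s = f s.
  move=> s0; rewrite patchE; case: ifPn => // /negP; rewrite inE /F /= in_itv /= s0 andbT => sn.
  by rewrite f0//; apply/ltW; rewrite ltNge; apply/negP => h; apply: sn; apply: le_trans h; rewrite lerN2.
have -> : \int[mu]_(s in `]-oo, 0]) f s = \int[mu]_(s in F n) f s.
  rewrite -(@setIidl _ (F n) `]-oo, 0]%classic); last first.
    by move=> s; rewrite /F /= !in_itv /= => /andP[].
  rewrite Rintegral_mkcondl; apply: eq_Rintegral => s; rewrite inE /= in_itv /= => s0.
  by rewrite fF.
have Ffin : (mu (F n) < +oo)%E by rewrite -ge0_fin_numE// fin_num_measure.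
have intf (g : R -> R) : measurable_fun [set: R] g ->
    (forall s, s <= 0 -> `|g s| <= M) -> mu.-integrable (F n) (EFin \o g).
  move=> mg gM; apply: measurable_bounded_integrable => //.
    exact: measurable_funTS.
  exists M; split; first by rewrite num_real.
  move=> N MN s; rewrite /F /= in_itv /= => /andP[_ s0].
  by apply: le_trans (gM _ s0) (ltW MN).
apply: (le_trans (le_normr_Rintegral _ _)) => //; first exact: intf.
apply: (@le_trans _ _ (\int[mu]_(s in F n) M)).
  apply: le_Rintegral => //.
  - apply: intf; first exact: measurableT_comp.
    by move=> s s0; rewrite normr_id fM.
  - by apply: intf => // s _; rewrite ger0_norm.
  - by move=> s; rewrite /F /= in_itv /= => /andP[_ /fM].
rewrite Rintegral_cst// mulrC ler_wpM2r//.
by rewrite -lee_fin fineK ?fin_num_measure// ltW.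
Qed.

End atomic_at_zero.

Section row_vectors.
Variables (R : realType) (m : nat).

Lemma row_norm_ub (v : 'rV[R]_m) i : `|v 0 i| <= `|v|.
Proof. by rewrite [leRHS]mx_normrE; apply: (le_bigmax _ (fun ij => `|v ij.1 ij.2|) (0, i)). Qed.

Lemma row_norm_le (v : 'rV[R]_m) (M : R) : 0 <= M ->
  (forall i, `|v 0 i| <= M) -> `|v| <= M.
Proof.
move=> M0 vM; rewrite [leLHS]mx_normrE; apply: bigmax_le => // -[i j] _ /=.
by rewrite ord1.
Qed.

(** Thresholds valid for all smaller values can be minimised over a finite index set. *)
Lemma fin_pos (I : finType) (P : I -> R -> Prop) :
  (forall i, exists2 d : R, 0 < d & forall d', 0 < d' <= d -> P i d') ->
  exists2 d : R, 0 < d & forall d', 0 < d' <= d -> forall i, P i d'.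
Proof.
move=> H.
have : exists2 d : R, 0 < d & forall d', 0 < d' <= d ->
    forall i, i \in enum I -> P i d'.
  elim: (enum I) => [|j s [d1 d10 H1]]; first by exists 1.
  have [d2 d20 H2] := H j; exists (Num.min d1 d2); first by rewrite lt_min d10.
  move=> d' /andP[d'0]; rewrite le_min => /andP[d'1 d'2] i.
  rewrite inE => /orP[/eqP ->|]; first by apply: H2; rewrite d'0.
  by apply: H1; rewrite d'0.
by move=> [d d0 Hd]; exists d => // d' /Hd H' i; apply: H'; rewrite mem_enum.
Qed.

End row_vectors.

Section operator.
Variables (R : realType) (m : nat).
Notation V := 'rV[R]_m.
Notation BU := (BU R m).
Variable D : BU -> V.
Hypothesis admD : admissible_D D.
Implicit Types (x y z : BU) (s t : R).

Let linD : linear D. Proof. by case: admD. Qed.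

Let contD : continuous D. Proof. by case: admD. Qed.

Let Dl : {linear BU -> V} := HB.pack D (GRing.isLinear.Build _ _ _ _ _ linD).

Lemma DB x y : D (x - y) = D x - D y. Proof. exact: (linearB Dl). Qed.
Lemma DD x y : D (x + y) = D x + D y. Proof. exact: (linearD Dl). Qed.
Lemma DZ a x : D (a *: x) = a *: D x. Proof. exact: (@linearZZ _ _ _ Dl). Qed.
Lemma D0 : D 0 = 0. Proof. exact: (linear0 Dl). Qed.

Lemma D_bounded : exists2 C : R, 0 < C & forall y, `|D y| <= C * `|y|.
Proof.
have : bounded_near (Dl : BU -> V) (nbhs (0 : BU)).
  by apply: continuous_linear_bounded; exact: contD.
move/linear_boundedP => -[C [_ /(_ (`|C| + 1)) DC]].
exists (`|C| + 1); first by rewrite ltr_wpDl.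
by apply: DC; rewrite (le_lt_trans (ler_norm _))// ltrDl.
Qed.

(** Since [nu] does not charge 0, its mass near 0 is small: on functions supported in a short
    interval before 0, [D] is evaluation at 0 up to half of the norm. This is the only use of the
    integral form of [D]. *)
Lemma D_atomic : exists2 delta : R, 0 < delta & forall y,
  (forall t, t <= - delta -> y (clip t) = 0) ->
  `|D y - y (clip 0)| <= 2^-1 * `|y|.
Proof.
have [_ _ _ [nu [nu0 Dnu]] _] := admD.
(* Two Jordan parts and [m] columns: [(e + e) * m] must not exceed one half. The successor covers
   [m = 0]. *)
pose e : R := (2 * (2 * m.+1%:R))^-1.
have m0 : 0 < m.+1%:R :> R by rewrite ltr0Sn.
have e0 : 0 < e by rewrite invr_gt0 !mulr_gt0.
pose P (ij : 'I_m * 'I_m) (d : R) := forall (f : R -> R) (M : R),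
  continuous f -> (forall s, s <= 0 -> `|f s| <= M) ->
  (forall s, s <= - d -> f s = 0) ->
  `|charge_Rint (nu ij.1 ij.2) `]-oo, 0] f| <= (e + e) * M.
have [|d d0 Hd] := @fin_pos R _ P.
  move=> [i j]; rewrite /P /= /charge_Rint.
  have := nu0 i j; rewrite /charge_abs /charge_variation /=.
  set h := svalP _ => /eqP; rewrite padde_eq0// => /andP[/eqP p0 /eqP n0].
  have [d1 d10 H1] := finite_measure_small e0 p0.
  have [d2 d20 H2] := finite_measure_small e0 n0.
  exists (Num.min d1 d2); first by rewrite lt_min d10.
  move=> d' /andP[d'0]; rewrite le_min => /andP[d'1 d'2] f M cf fM f0.
  apply: le_trans (ler_normB _ _) _; rewrite mulrDl lerD//.
    by apply: (H1 d') => //; rewrite d'0.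
  by apply: (H2 d') => //; rewrite d'0.
exists d => // y y0.
apply: row_norm_le => [|i]; first by rewrite mulr_ge0// invr_ge0.
rewrite !mxE Dnu addrAC subrr add0r normrN.
apply: le_trans (ler_norm_sum _ _ _) _.
apply: (@le_trans _ _ (\sum_(j < m) (e + e) * `|y|)).
  apply: ler_sum => j _; apply: (Hd d _ (i, j)).
  - by rewrite d0 lexx.
  - move=> s; apply/cvgrPdist_lt => g g0.
    have [g' g'0 H] := BU_uc y g0.
    exists g' => //= t /= st; apply: le_lt_trans (H s t st).
    have -> : y (clip s) 0 j - y (clip t) 0 j = (y (clip s) - y (clip t)) 0 j.
      by rewrite !mxE.
    exact: row_norm_ub.
  - by move=> s _; apply: le_trans (row_norm_ub _ _) (BU_ub _ _).
  - by move=> s sd; rewrite y0// mxE.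
rewrite sumr_const card_ord -[leLHS]mulr_natl mulrA ler_wpM2r//.
have mle : m%:R <= m.+1%:R :> R by rewrite ler_nat.
have em : e * m.+1%:R = 4^-1.
  by rewrite /e !invfM mulrA mulfVK ?gt_eqF//; lra.
have : e * m%:R <= e * m.+1%:R by rewrite ler_wpM2l// ltW.
rewrite em; lra.
Qed.

End operator.

Section complete.
Variables (R : realType) (m : nat).
Notation V := 'rV[R]_m.
Notation BU := (BU R m).

Lemma mkBU_eq (f : past R -> V) (x : BU) : (forall p, f p = x p) -> mkBU f = x.
Proof.
move=> fx; have -> : f = x :> (past R -> V) by apply/funext.
by apply: val_inj; rewrite /= mkBUE// BUP.
Qed.

Lemma rV_cauchy (u : nat -> V) (e : nat -> R) :
  (forall a, 0 < a -> exists N, forall n, (N <= n)%N -> e n < a) ->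
  (forall n k, (n <= k)%N -> `|u k - u n| <= e n) ->
  exists l, forall n, `|l - u n| <= e n.
Proof.
move=> e0 uc; have /cauchy_cvg/cvg_ex[l ul] : cauchy (u @ \oo).
  apply/cauchy_exP => a /e0[N HN]; exists (u N); exists N => // n /= Nn.
  rewrite -ball_normE /= distrC.
  by apply: le_lt_trans (uc _ _ Nn) (HN _ (leqnn N)).
exists l => n; apply/ler_addgt0Pl => a a0.
have /cvgrPdist_lt/(_ a a0)[N _ HN] := ul.
have lk := HN (maxn N n) (leq_maxl _ _).
have -> : l - u n = (l - u (maxn N n)) + (u (maxn N n) - u n).
  by rewrite addrA subrK.
by apply: le_trans (ler_normD _ _) _; rewrite lerD// ?uc ?leq_maxr// ltW.
Qed.

Lemma BU_complete (u : nat -> BU) (e : nat -> R) :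
  (forall a, 0 < a -> exists N, forall n, (N <= n)%N -> e n < a) ->
  (forall n k, (n <= k)%N -> `|u k - u n| <= e n) ->
  exists l, forall n, `|l - u n| <= e n.
Proof.
move=> e0 uc; have pl t : exists l, forall n, `|l - u n (clip t)| <= e n.
  apply: rV_cauchy => // n k nk; rewrite -BUBE.
  exact: le_trans (BU_ub _ _) (uc _ _ nk).
have [l Hl] := choice pl.
exists (ofR l) => n; apply: BU_le => t t0; rewrite BUBE ofRE//.
  exists (e 0%N + `|u 0%N|) => s _; rewrite -(subrK (u 0%N (clip s)) (l s)).
  by apply: le_trans (ler_normD _ _) _; rewrite lerD// BU_ub.
move=> a a0; have a3 : 0 < a / 3 by lra.
have [N /(_ _ (leqnn N)) HN] := e0 _ a3; have [d d0 Hd] := BU_uc (u N) a3.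
exists d => // p q _ _ pq.
have -> : l p - l q = (l p - u N (clip p)) + (u N (clip p) - u N (clip q)) -
  (l q - u N (clip q)) by rewrite addrA subrK opprB addrA subrK.
apply: le_lt_trans (ler_normB _ _) _.
apply: le_lt_trans (lerD (ler_normD _ _) (lexx _)) _.
have := Hd _ _ pq; have := Hl p N; have := Hl q N.
move: `|_| `|_| `|_| => A B C; lra.
Qed.

Lemma geometric_lt (A a : R) : 0 < a ->
  exists N, forall n, (N <= n)%N -> A * 2 ^- n < a.
Proof.
move=> a0; have B0 : 0 < `|A| + 1 by rewrite ltr_wpDl.
have [|N HN] := @invS_lt R (a / (`|A| + 1)); first by rewrite divr_gt0.
exists N => n /HN Hn; apply: (@le_lt_trans _ _ ((`|A| + 1) * n.+1%:R^-1)).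
  apply: (@le_trans _ _ ((`|A| + 1) * 2 ^- n)).
    rewrite ler_wpM2r ?invr_ge0 ?exprn_ge0//.
    by apply: le_trans (ler_norm A) _; rewrite lerDl.
  rewrite ler_pM2l// lef_pV2 ?posrE ?exprn_gt0//.
  by rewrite -natrX ler_nat ltn_expl.
by rewrite mulrC -ltr_pdivlMr.
Qed.

Lemma BU_geometric (u : nat -> BU) (A : R) :
  (forall n, `|u n.+1 - u n| <= A * 2 ^- n) ->
  exists l, forall n, `|l - u n| <= 2 * A * 2 ^- n.
Proof.
move=> uA; apply: BU_complete => [a|n k nk]; first exact: geometric_lt.
have A0 : 0 <= A.
  by have := uA 0%N; rewrite expr0 invr1 mulr1; apply: le_trans.
suff : `|u k - u n| <= 2 * A * (2 ^- n - 2 ^- k).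
  move=> /le_trans; apply; rewrite ler_wpM2l ?mulr_ge0// gerBl.
  by rewrite invr_ge0 exprn_ge0.
elim: k nk => [|k IH]; first by rewrite leqn0 => /eqP ->; rewrite !subrr normr0 mulr0.
rewrite leq_eqVlt => /orP[/eqP <-|]; first by rewrite !subrr normr0 mulr0.
rewrite ltnS => /IH {}IH.
have -> : u k.+1 - u n = (u k.+1 - u k) + (u k - u n) by rewrite addrA subrK.
apply: le_trans (ler_normD _ _) _; apply: le_trans (lerD (uA k) IH) _.
have -> : 2 ^- k.+1 = 2 ^- k / 2 :> R by rewrite exprS invfM mulrC.
move: (2 ^- n) (2 ^- k) => a b; lra.
Qed.

End complete.

Section Dhat_basic.
Variables (R : realType) (m : nat).
Notation V := 'rV[R]_m.
Notation BU := (BU R m).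
Variable D : BU -> V.
Hypothesis admD : admissible_D D.
Implicit Types (x y z : BU) (s t : R).
Notation Dh := (Dhat D).

Lemma DhE x t : Dh x (clip t) = D (sh x t).
Proof. by have [linD cD _ _ _] := admD; rewrite DhatE. Qed.

Lemma DhE0 x : Dh x (clip 0) = D x.
Proof. by rewrite DhE sh0. Qed.

Lemma DhB x y : Dh (x - y) = Dh x - Dh y.
Proof. by apply: BU_ext => s s0; rewrite BUBE !DhE shB// (DB admD). Qed.

Lemma DhD x y : Dh (x + y) = Dh x + Dh y.
Proof. by apply: BU_ext => s s0; rewrite BUDE !DhE shD// (DD admD). Qed.

Lemma DhZ a x : Dh (a *: x) = a *: Dh x.
Proof. by apply: BU_ext => s s0; rewrite BUZE !DhE shZ// (DZ admD). Qed.

Lemma Dh_bounded : exists2 C : R, 0 < C & forall y, `|Dh y| <= C * `|y|.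
Proof.
have [C C0 HC] := D_bounded admD; exists C => // y.
apply: BU_le => t t0; rewrite DhE; apply: le_trans (HC _) _.
by rewrite ler_wpM2l ?sh_norm// ltW.
Qed.

Lemma leDP x y : leD D x y <->
  forall t i, t <= 0 -> D (sh x t) 0 i <= D (sh y t) 0 i.
Proof.
split=> [H t i _|H p i]; first exact: H.
by have := H (tval p) i (tval_le0 p); rewrite /sh Defs.tvalK.
Qed.

End Dhat_basic.

(** * Forward continuation with prescribed values of [D] *)

Section extension.
Variables (R : realType) (m : nat).
Notation V := 'rV[R]_m.
Notation BU := (BU R m).
Variable D : BU -> V.
Hypothesis admD : admissible_D D.
Implicit Types (x y z h : BU) (s t : R).
Notation Dh := (Dhat D).

Variable delta : R.
Hypothesis delta0 : 0 < delta.
Hypothesis atomic : forall y, (forall t, t <= - delta -> y (clip t) = 0) ->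
  `|D y - y (clip 0)| <= 2^-1 * `|y|.

Let N y := y - Dh y.

Let N_zero y : (forall t, t <= - delta -> y (clip t) = 0) ->
  forall t, t <= - delta -> N y (clip t) = 0.
Proof.
move=> y0 t td; have t0 : t <= 0 by move: delta0; lra.
rewrite /N BUBE y0// DhE// (_ : sh y t = 0) ?D0 ?subrr//.
by apply: BU_ext => s s0; rewrite shE// BU0E y0//; lra.
Qed.

(** At time [t], [N y] is the difference between the value at 0 of the translate [sh y t] and its
    image under [D]; the translate still vanishes before [- delta], so [atomic] applies to it. *)
Let N_half y : (forall t, t <= - delta -> y (clip t) = 0) ->
  `|N y| <= 2^-1 * `|y|.
Proof.
move=> y0; apply: BU_le => t t0; rewrite /N BUBE DhE// distrC -(sh_eval y t0).
apply: (@le_trans _ _ (2^-1 * `|sh y t|)); last first.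
  by rewrite ler_wpM2l ?sh_norm// invr_ge0.
by apply: atomic => s sd; rewrite shE//; [apply: y0; lra|move: delta0; lra].
Qed.

Let NB a b : N (a - b) = N a - N b.
Proof.
by rewrite /N (DhB admD) !opprB addrACA [RHS]addrACA [X in _ + X]addrC.
Qed.

(** On functions vanishing before [- delta], [Dhat] is the identity minus the half-contraction [N];
    the [u n] are the partial sums of its Neumann series applied to [h]. *)
Lemma neumann h : (forall t, t <= - delta -> h (clip t) = 0) ->
  exists y, [/\ forall t, t <= - delta -> y (clip t) = 0, Dh y = h &
    `|y| <= 2 * `|h|].
Proof.
move=> h0; pose u := fix u n := if n is n'.+1 then h + N (u n') else 0.
have uz n t : t <= - delta -> u n (clip t) = 0.
  elim: n t => [|n IH] t td; first by [].
  by rewrite [u _]/= BUDE h0// add0r; apply: N_zero.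
have uu n : `|u n.+1 - u n| <= `|h| * 2 ^- n.
  elim: n => [|n IH].
    rewrite /= /N expr0 invr1 mulr1 subr0 sub0r.
    suff -> : Dh 0 = 0 by rewrite oppr0 addr0.
    by have := DhB admD 0 0; rewrite !subrr.
  have -> : u n.+2 - u n.+1 = N (u n.+1 - u n).
    by rewrite NB [LHS](_ : _ = h + N (u n.+1) - (h + N (u n)))// opprD addrACA
      subrr add0r.
  apply: (le_trans (N_half _)).
    by move=> t td; rewrite BUBE !uz// subrr.
  by rewrite exprS invfM [leRHS]mulrCA ler_wpM2l ?invr_ge0.
have [y Hy] := BU_geometric uu.
have yz t : t <= - delta -> y (clip t) = 0.
  move=> td; apply/normr0_eq0/le_anti; rewrite normr_ge0 andbT.
  apply/ler_addgt0Pl => e /(geometric_lt (2 * `|h|))[n /(_ n (leqnn n)) Hn].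
  rewrite addr0 -(subr0 (y (clip t))) -(uz n t td) -BUBE.
  by apply: le_trans (BU_ub _ _) (le_trans (Hy n) (ltW Hn)).
have [C C0 HC] := Dh_bounded admD.
have Dy : Dh y = h.
  apply/eqP; rewrite -subr_eq0 -normr_le0; apply/ler_addgt0Pl => e e0.
  have [n /(_ n (leqnn n)) Hn] := geometric_lt (C * (2 * `|h|) + `|h|) e0.
  rewrite addr0.
  have -> : Dh y - h = Dh (y - u n) - (u n.+1 - u n).
    rewrite (DhB admD) [u n.+1]/= /N.
    by rewrite [X in _ = _ - X]addrAC addrA subrK opprB addrA subrK.
  apply: le_trans (ler_normB _ _) _.
  apply: le_trans (lerD (HC _) (uu n)) _; apply: le_trans (ltW Hn).
  rewrite mulrDl lerD2r -mulrA ler_wpM2l// ltW//.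
have yN : y = h + N y by rewrite /N Dy addrCA subrr addr0.
exists y; split=> //; have := ler_normD h (N y); rewrite -yN.
have := N_half yz; move: `|N y| => q; lra.
Qed.

(** A ramp from 0 at [- delta] up to [a] at 0 is a right-hand side to which [neumann] applies, and
    the value of [Dhat phi] at 0 is [D phi]. *)
Lemma D_section (a : V) : exists2 phi, D phi = a & `|phi| <= 2 * `|a|.
Proof.
have dl0 : - delta <= 0 by rewrite oppr_le0 ltW.
pose f t := Num.max 0 (1 + t / delta) : R.
have f01 t : t <= 0 -> 0 <= f t <= 1.
  move=> t0; rewrite /f le_max lexx ge_max ler01 /=.
  by rewrite gerDl pmulr_lle0// invr_gt0.
have flip s t : s <= 0 -> t <= 0 -> `|f s - f t| <= `|s - t| / delta.
  move=> s0 t0; rewrite /f; have -> : s / delta = t / delta + (s - t) / delta by lra.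
  have -> : `|s - t| / delta = `|(s - t) / delta|.
    by rewrite normrM [`|delta^-1|]ger0_norm// invr_ge0 ltW.
  move: (t / delta) ((s - t) / delta) => p q.
  have := ler_norm q; have := ler_norm (- q); rewrite normrN ler_norml.
  move: `|q| => Q q1 q2; rewrite /Num.max.
  by have [h1|h1] := ltP 0 (1 + (p + q)); have [h2|h2] := ltP 0 (1 + p);
    apply/andP; split; lra.
pose ka := ofR (fun t => f t *: a).
have kaE t : t <= 0 -> ka (clip t) = f t *: a.
  apply: (@ofRE _ _ (fun t => f t *: a)).
    exists `|a| => s s0; rewrite normrZ ler_piMl//.
    by have /andP[p q] := f01 s s0; rewrite ger0_norm.
  move=> g g0; exists (g * delta / (`|a| + 1)).
    by rewrite divr_gt0 ?mulr_gt0// ltr_wpDl.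
  move=> p q p0 q0 pq; rewrite -scalerBl normrZ.
  apply: (@le_lt_trans _ _ (`|p - q| / delta * (`|a| + 1))).
    by apply: ler_pM; rewrite ?normr_ge0 ?flip// lerDl.
  by rewrite mulrAC ltr_pdivrMr// -ltr_pdivlMr// ltr_wpDl.
have kaz t : t <= - delta -> ka (clip t) = 0.
  move=> td; have t0 : t <= 0 by apply: le_trans td dl0.
  rewrite kaE// /f max_l ?scale0r//.
  have : t / delta <= - 1 by rewrite ler_pdivrMr// mulN1r.
  lra.
have [phi [_ phiD phin]] := neumann kaz.
have phia : D phi = a.
  by rewrite -(DhE0 admD) phiD kaE// /f mul0r addr0 max_r// scale1r.
exists phi => //; apply: le_trans phin _; rewrite ler_wpM2l//.
apply: BU_le => t t0; rewrite kaE// normrZ ler_piMl//.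
by have /andP[p q] := f01 t t0; rewrite ger0_norm.
Qed.

(** The history [x] is moved back by [delta] and continued by its constant last value; a solution
    [y] given by [neumann] then repairs the defect [h - Dhat x1]. The assumption on [D x] makes this
    defect vanish at [- delta], so that cutting it off there keeps it continuous. *)
Lemma extend_step : exists2 C : R, 0 < C & forall x h,
  D x = h (clip (- delta)) ->
  exists x', [/\ sh x' (- delta) = x,
    forall s, - delta <= s <= 0 -> D (sh x' s) = h (clip s) &
    `|x'| <= C * (`|x| + `|h|)].
Proof.
have [C C0 HC] := Dh_bounded admD.
exists (3 + 2 * C) => [|x h xh]; first by rewrite addr_gt0// mulr_gt0.
have dl0 : - delta <= 0 by rewrite oppr_le0 ltW.
pose x1 := reparam x (fun t => t + delta).
have x1E t : t <= 0 -> x1 (clip t) = x (clip (t + delta)).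
  move=> t0; rewrite reparamE// => p q _ _ /=.
  by rewrite opprD addrACA subrr addr0.
have x1d : sh x1 (- delta) = x.
  apply: BU_ext => t t0; rewrite shE// x1E; last by move: dl0; lra.
  by congr (x (clip _)); lra.
have x1n : `|x1| <= `|x| by apply: BU_le => t t0; rewrite x1E// BU_ub.
pose g := h - Dh x1; pose k := reparam g (fun t => Num.max t (- delta)).
have kE t : t <= 0 -> k (clip t) = g (clip (Num.max t (- delta))).
  move=> t0; rewrite reparamE// => p q _ _ /=; rewrite /Num.max.
  have := ler_norm (p - q); have := ler_norm (q - p); rewrite distrC ler_norml.
  by move: `|_| => M; case: ltP => pd; case: ltP => qd pq qp; apply/andP; split; lra.
have gd : g (clip (- delta)) = 0 by rewrite /g BUBE DhE// x1d xh subrr.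
have kz t : t <= - delta -> k (clip t) = 0.
  move=> td; rewrite kE; last by apply: le_trans td dl0.
  by rewrite max_r.
have kn : `|k| <= `|h| + C * `|x|.
  apply: (@le_trans _ _ `|g|).
    by apply: BU_le => t t0; rewrite kE// BU_ub.
  apply: le_trans (ler_normB _ _) _; rewrite lerD2l.
  by apply: le_trans (HC _) _; rewrite ler_wpM2l// ltW.
have [y [yz Dy yk]] := neumann kz.
exists (x1 + y); split.
- rewrite shD// x1d; apply: BU_ext => t t0; rewrite BUDE [X in _ + X]shE//.
  by rewrite yz ?addr0//; lra.
- move=> s /andP[ds s0]; rewrite shD// (DD admD) -(DhE admD y) Dy kE//.
  by rewrite max_l// /g BUBE DhE// addrC subrK.
- apply: le_trans (ler_normD _ _) _.
  have := mulr_ge0 (ltW C0) (normr_ge0 h).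
  move: kn yk x1n (normr_ge0 h) (normr_ge0 x).
  move: `|k| `|y| `|h| `|x| `|x1| => a b c d e; nra.
Qed.

Lemma extend_steps (k : nat) : exists2 C : R, 0 < C & forall x h,
  D x = h (clip (- (k%:R * delta))) ->
  exists x', [/\ sh x' (- (k%:R * delta)) = x,
    forall s, - (k%:R * delta) <= s <= 0 -> D (sh x' s) = h (clip s) &
    `|x'| <= C * (`|x| + `|h|)].
Proof.
have [C C0 HC] := extend_step.
have dl0 : - delta <= 0 by rewrite oppr_le0 ltW.
elim: k => [|k [Ck Ck0 IH]].
  exists 1 => // x h; rewrite mul0r oppr0 => xh; exists x; split.
  - by rewrite sh0.
  - move=> s /le_anti <-; by rewrite sh0.
  - by rewrite mul1r lerDl.
exists (C * (Ck + Ck + 1)) => [|x h xh]; first by rewrite mulr_gt0//; lra.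
have kd0 : - (k%:R * delta) <= 0 by rewrite oppr_le0 mulr_ge0// ltW.
have kE : - (k.+1%:R * delta) = - delta + - (k%:R * delta).
  by rewrite -natr1; lra.
have [|x1 [x1s x1D x1n]] := IH x (sh h (- delta)).
  by rewrite xh shE// kE.
have [|x2 [x2s x2D x2n]] := HC x1 h.
  have := x1D 0; rewrite sh0 => ->; first by rewrite shE// addr0.
  by rewrite kd0 lexx.
exists x2; split.
- by rewrite kE -sh_sh// x2s.
- move=> s /andP[]; rewrite kE => ks s0.
  have [ds|sd] := leP (- delta) s; first by apply: x2D; rewrite ds.
  have sd' : s + delta <= 0 by lra.
  have -> : sh x2 s = sh x1 (s + delta).
    by rewrite -x2s sh_sh//; congr (sh _ _); lra.
  rewrite x1D ?shE//; last by rewrite sd' andbT; lra.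
  by congr (h (clip _)); lra.
- apply: le_trans x2n _; rewrite -mulrA ler_wpM2l ?(ltW C0)//.
  have := ler_wpM2l (ltW Ck0) (sh_norm h (- delta)).
  have := mulr_ge0 (ltW Ck0) (normr_ge0 x).
  have := mulr_ge0 (ltW Ck0) (normr_ge0 h).
  move: x1n (normr_ge0 x) (normr_ge0 h).
  move: `|x1| `|x| `|h| `|sh h _| => a b c d; nra.
Qed.

End extension.

(** * Decay of homogeneous solutions and the lower bound for [Dhat] *)

Section inverse.
Variables (R : realType) (m : nat).
Notation V := 'rV[R]_m.
Notation BU := (BU R m).
Variable D : BU -> V.
Hypothesis admD : admissible_D D.
Implicit Types (x y z h w : BU) (s t : R).
Notation Dh := (Dhat D).

(* Stability concerns solutions on the whole half-line, so [w] is first continued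
   beyond time 0 by solving [D x_t = 0]. *)
Lemma homogeneous_decay : exists c : R -> R,
  [/\ forall t, 0 <= t -> 0 <= c t, c t @[t --> +oo] --> 0 &
    forall w (T : R), 0 <= T -> (forall s, - T <= s <= 0 -> D (sh w s) = 0) ->
      `|w (clip 0)| <= c T * `|sh w (- T)|].
Proof.
have [_ _ _ _ [c [_ c0 cinf Hc]]] := admD; exists c; split=> // w T T0 wD.
have [delta d0 atomic] := D_atomic admD.
have [C _ HC] := extend_step admD d0 atomic.
have dl0 : - delta <= 0 by rewrite oppr_le0 ltW.
have step x : exists x', D x = 0 -> sh x' (- delta) = x /\
    forall s, - delta <= s <= 0 -> D (sh x' s) = 0.
  have [xz|] := pselect (D x = 0); last by exists x.
  have [|x' [x's x'D _]] := HC x 0; first by rewrite xz BU0E.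
  by exists x' => _; split => // s /x'D ->; rewrite BU0E.
have [ext Hext] := choice step.
pose X j := iter j ext w.
have XD j : forall s, - (T + j%:R * delta) <= s <= 0 -> D (sh (X j) s) = 0.
  elim: j => [|j IH] s; first by rewrite mul0r addr0; exact: wD.
  have Xj0 : D (X j) = 0.
    by rewrite -(sh0 (X j)) IH// lexx andbT oppr_le0 addr_ge0// mulr_ge0// ltW.
  have [Xs XD] := Hext _ Xj0; rewrite -natr1 => /andP[ts s0].
  have [ds|sd] := leP (- delta) s; first by apply: XD; rewrite ds.
  have -> : sh (X j.+1) s = sh (X j) (s + delta).
    by rewrite -Xs sh_sh//; [congr (sh _ _); lra|lra].
  by apply: IH; lra.
have Xsh j : sh (X j.+1) (- delta) = X j.
  have Xj0 : D (X j) = 0.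
    by rewrite -(sh0 (X j)) XD// lexx andbT oppr_le0 addr_ge0// mulr_ge0// ltW.
  by have [] := Hext _ Xj0.
have Xadd i j : sh (X (i + j)%N) (- (i%:R * delta)) = X j.
  elim: i => [|i IH]; first by rewrite mul0r oppr0 sh0.
  have id0 : - (i%:R * delta) <= 0 by rewrite oppr_le0 mulr_ge0// ltW.
  rewrite -[in RHS]IH -[in RHS](Xsh (i + j)%N) sh_sh//.
  by rewrite -natr1 addSn; congr sh; lra.
pose J t := (Num.truncn (`|t| / delta)).+1.
have tJ t : t <= T + (J t)%:R * delta.
  apply: le_trans (ler_norm t) _; apply: ler_wpDl => //.
  by rewrite -ler_pdivrMr//; apply/ltW; exact: truncnS_gt.
(* [X j] is the continuation as seen from time [T + j * delta], with [w] itself seen from time [T].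
   The glued function [z] reads time [t] off an [X j] that reaches it, and [zE] shows that any such
   [j] gives the same value. *)
pose z t := X (J t) (clip (t - (T + (J t)%:R * delta))).
have zE j t : t <= T + j%:R * delta -> z t = X j (clip (t - (T + j%:R * delta))).
  have K i k : t <= T + k%:R * delta ->
      X (i + k)%N (clip (t - (T + (i + k)%:R * delta))) =
      X k (clip (t - (T + k%:R * delta))).
    move=> tk; rewrite -[in RHS](Xadd i k) shE; first last.
    - by rewrite subr_le0.
    - by rewrite oppr_le0 mulr_ge0// ltW.
    by rewrite natrD; congr (X _ (clip _)); lra.
  move=> tj; rewrite /z; have [Jj|jJ] := leqP (J t) j.
    by rewrite -[in RHS](subnK Jj) K.
  by rewrite -(subnK (ltnW jJ)) K.
have zh j t : t <= T + j%:R * delta ->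
    hist z t = sh (X j) (t - (T + j%:R * delta)).
  move=> tj; apply: mkBU_eq => p; have p0 := tval_le0 p.
  rewrite -{2}(Defs.tvalK p) shE//; last by rewrite subr_le0.
  have tpj : t + tval p <= T + j%:R * delta by rewrite -[leRHS]addr0 lerD.
  by rewrite (zE j)// addrAC.
have <- : z T = w (clip 0) by rewrite (zE 0%N) mul0r addr0// subrr.
apply: Hc => //.
- by apply: wD; rewrite lexx oppr_le0 T0.
- move=> p; have p0 := tval_le0 p.
  rewrite (zE 0%N); last by rewrite mul0r addr0 (le_trans p0).
  rewrite -{2}(Defs.tvalK p) shE//; last by rewrite oppr_le0.
  by rewrite mul0r addr0 addrC.
- move=> t; apply/cvgrPdist_lt => e e0.
  pose j := J (`|t| + 1).
  have [d d1 Hd] := BU_uc (X j) e0.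
  exists (Num.min d 1); first by rewrite /= lt_min d1 /=.
  move=> s /=; rewrite lt_min => /andP[st st1].
  have jb : `|t| + 1 <= T + j%:R * delta by exact: tJ.
  have tj : t <= T + j%:R * delta.
    by apply: le_trans jb; apply: le_trans (ler_norm t) _; rewrite lerDl.
  have sj : s <= T + j%:R * delta.
    apply: le_trans jb; rewrite -[leLHS](subrK t) addrC lerD ?ler_norm//.
    by apply/ltW; apply: le_lt_trans st1; rewrite distrC ler_norm.
  rewrite (zE j t)// (zE j s)//; apply: Hd.
  by rewrite opprB addrA subrK.
- move=> t t0; have tJt := tJ t.
  rewrite (zh (J t))// XD// subr_le0 tJt andbT; lra.
Qed.

(** On a window of length [T], [w] differs from some [z] of size proportional to [A] by a
    homogeneous solution, which decays by the factor [e] when [T] is large. The estimate is local in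
    time up to a small multiple of the norm, and both the injectivity and the surjectivity of [Dhat]
    rest on it. *)
Lemma decay_estimate (e : R) : 0 < e -> exists T C : R, [/\ 0 <= T, 0 <= C &
  forall w A, (forall s, - T <= s <= 0 -> `|D (sh w s)| <= A) ->
    `|w (clip 0)| <= e * `|w| + C * A].
Proof.
move=> e0; have [c [c0 cinf Hc]] := homogeneous_decay.
have [delta d0 atomic] := D_atomic admD.
have dl0 : - delta <= 0 by rewrite oppr_le0 ltW.
have [k ck] : exists k : nat, c (k%:R * delta) <= e.
  have /cvgrPdist_lt/(_ _ e0)[M [_ HM]] := cinf.
  exists (Num.truncn (`|M| / delta)).+1.
  set k := _.+1; have : M < k%:R * delta.
    apply: le_lt_trans (ler_norm M) _; rewrite -ltr_pdivrMr//.
    exact: truncnS_gt.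
  move=> /HM; rewrite sub0r normrN => /ltW; apply: le_trans; exact: ler_norm.
have [C C0 HC] := extend_steps admD d0 atomic k.
pose T := k%:R * delta; have T0 : 0 <= T by rewrite mulr_ge0// ltW.
have NT0 : - T <= 0 by rewrite oppr_le0.
(* The homogeneous part contributes [e * (|w| + 2 * A)] because the starting history [phi] has norm
   at most [2 * A]; the part [z] contributes [C * (2 * A + A)]. The window is a multiple of [delta]
   because [extend_steps] proceeds by such steps. *)
exists T, (2 * e + 3 * C); split=> // [|w A wA].
  by rewrite addr_ge0// mulr_ge0// ltW.
have A0 : 0 <= A by apply: le_trans (wA 0 _); rewrite ?normr_ge0// lexx andbT.
(* [phi] carries the value of [D] at the initial time, which makes [w - z] homogeneous. *)
pose a := D (sh w (- T)).
have aA : `|a| <= A by apply: wA; rewrite lexx.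
have [phi phia phin] := D_section admD d0 atomic a.
have phiA : `|phi| <= 2 * A by apply: le_trans phin _; rewrite ler_wpM2l.
pose h := reparam (Dh w) (fun t => Num.max t (- T)).
have hE t : t <= 0 -> h (clip t) = D (sh w (Num.max t (- T))).
  move=> t0; rewrite -DhE// reparamE// => p q _ _ /=.
  have := ler_norm (p - q); have := ler_norm (q - p); rewrite distrC ler_norml.
  by move: `|_| => M; rewrite /Num.max; case: ltP => pd; case: ltP => qd pq qp;
    apply/andP; split; lra.
have hA : `|h| <= A.
  apply: BU_le => t t0; rewrite hE//; apply: wA.
  by rewrite le_max lexx orbT ge_max t0.
have [|z [zs zD zn]] := HC phi h.
  by rewrite phia hE// max_r.
have wz : `|w (clip 0) - z (clip 0)| <= c T * `|sh w (- T) - phi|.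
  rewrite -BUBE -zs -shB//; apply: Hc => // s sT.
  have /andP[sT1 s0] := sT.
  by rewrite shB// (DB admD) zD// hE// max_l// subrr.
rewrite -(subrK (z (clip 0)) (w (clip 0))).
apply: le_trans (ler_normD _ _) _.
have H1 : c T * `|sh w (- T) - phi| <= e * (`|w| + 2 * A).
  apply: ler_pM => //; first exact: c0.
  apply: le_trans (ler_normB _ _) _; rewrite lerD// sh_norm//.
have H2 : `|z (clip 0)| <= C * (3 * A).
  apply: le_trans (BU_ub _ _) (le_trans zn _).
  rewrite ler_wpM2l ?(ltW C0)//; move: phiA hA; move: `|phi| `|h| => a1 a2; lra.
have := le_trans wz H1; move: H2.
move: `|z _| `|_ - _| `|w| => p q r; nra.
Qed.

(** Applying [decay_estimate] with [e] one half to every translate bounds the norm of [w] by half of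
    itself plus a multiple of the norm of [Dhat w]; the half is absorbed. *)
Lemma Dhat_lower : exists2 C : R, 0 < C & forall w, `|w| <= C * `|Dh w|.
Proof.
have [|T [C [T0 C0 HC]]] := @decay_estimate 2^-1; first by rewrite invr_gt0.
exists (2 * C + 1) => [|w]; first by rewrite ltr_wpDl// mulr_ge0.
have : `|w| <= 2^-1 * `|w| + C * `|Dh w|.
  apply: BU_le => t t0; rewrite -sh_eval//.
  apply: le_trans (HC (sh w t) `|Dh w| _) _; last first.
    by rewrite lerD2r ler_wpM2l ?sh_norm// invr_ge0.
  by move=> s /andP[_ s0]; rewrite sh_sh// -DhE// BU_ub.
have := normr_ge0 (Dh w); move: `|w| `|Dh w| => a b; nra.
Qed.

Lemma Dhat_inj x y : Dh x = Dh y -> x = y.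
Proof.
have [C _ HC] := Dhat_lower => xy; apply/eqP; rewrite -subr_eq0 -normr_le0.
by apply: le_trans (HC _) _; rewrite (DhB admD) xy subrr normr0 mulr0.
Qed.

Lemma Dhat_ext x y : (forall t, t <= 0 -> D (sh x t) = D (sh y t)) -> x = y.
Proof.
move=> xy; apply: Dhat_inj; apply: BU_ext => t t0.
exact: etrans (DhE admD x t) (etrans (xy t t0) (esym (DhE admD y t))).
Qed.

Lemma Dhat_lower_dist : exists2 C : R, 0 < C & forall x y (M : R),
  (forall t, t <= 0 -> `|D (sh x t) - D (sh y t)| <= M) -> `|x - y| <= C * M.
Proof.
have [C C0 HC] := Dhat_lower; exists C => // x y M xy.
apply: (le_trans (HC _)); apply: (ler_wpM2l (ltW C0)); apply: BU_le => t t0.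
by rewrite DhE// (shB _ _ t0) (DB admD); exact: xy.
Qed.

End inverse.

Section within_sequences.
Variable R : realType.

Lemma within_seq (T : pseudoMetricType R) (W : normedModType R) (A : set T)
    (f : T -> W) (u : nat -> T) (x : T) :
  {within A, continuous f} -> A x -> (forall n, A (u n)) ->
  (forall e : R, 0 < e -> exists N, forall n, (N <= n)%N -> ball x e (u n)) ->
  cvd (fun x y : W => `|x - y|) (f \o u) (f x).
Proof.
move=> /subspace_continuousP cf Ax Au ux e e0.
have /cvgrPdist_lt/(_ e e0) H := cf x Ax.
have /nbhs_ballP[d /= d0 Hd] : nbhs x (fun t => A t -> `|f x - f t| < e) := H.
by have [N HN] := ux d d0; exists N => n /HN /Hd; apply; exact: Au.
Qed.

End within_sequences.

(** * Surjectivity of [Dhat] *)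

Section surjectivity.
Variables (R : realType) (m : nat).
Notation V := 'rV[R]_m.
Notation BU := (BU R m).

(** Locally uniform limits may leave BU, so the limit is returned as a plain function; boundedness
    and uniform continuity are left to the caller. *)
Lemma BU_locally_complete (u : nat -> BU) :
  (forall K a : R, 0 < a -> exists N, forall n k, (N <= n)%N -> (N <= k)%N ->
     forall t : R, - K <= t <= 0 -> `|u k (clip t) - u n (clip t)| <= a) ->
  exists l : R -> V, forall K a : R, 0 < a -> exists N, forall n, (N <= n)%N ->
     forall t : R, - K <= t <= 0 -> `|l t - u n (clip t)| <= a.
Proof.
move=> uc.
have pl (t : R) : exists l : V, t <= 0 -> (fun n => u n (clip t)) @ \oo --> l.
  have [t0|_] := leP t 0; last by exists 0.
  suff /cauchy_cvg/cvg_ex[l ul] : cauchy ((fun n => u n (clip t)) @ \oo).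
    by exists l.
  apply/cauchy_exP => a a0; have a20 : 0 < a / 2 by lra.
  have [N HN] := uc (- t) _ a20; exists (u N (clip t)); exists N => // n /= Nn.
  rewrite -ball_normE /= distrC; apply: (@le_lt_trans _ _ (a / 2)); last lra.
  by apply: HN; rewrite ?leqnn// opprK lexx.
have [l Hl] := choice pl; exists l => K a a0; have [N HN] := uc K a a0.
exists N => n Nn t Kt; have /andP[_ t0] := Kt.
apply/ler_addgt0Pl => e e0.
have /cvgrPdist_lt/(_ e e0)[N' _ HN'] := Hl t t0.
pose k := maxn N N'; have lk := HN' k (leq_maxr _ _).
have -> : l t - u n (clip t) = (l t - u k (clip t)) + (u k (clip t) - u n (clip t)).
  by rewrite addrA subrK.
apply: le_trans (ler_normD _ _) _; rewrite lerD ?(ltW lk)//.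
by apply: HN => //; exact: leq_maxl.
Qed.

Variable D : BU -> V.
Hypothesis admD : admissible_D D.
Implicit Types (x y z h w : BU) (s t : R).
Notation Dh := (Dhat D).

Lemma D_co_continuous (u : nat -> BU) x (M : R) : cvc u x ->
  (forall n, `|u n| <= M) ->
  cvd (fun x y : V => `|x - y|) (D \o u) (D x).
Proof.
move=> ux uM; have [_ _ /(_ M) cD _ _] := admD.
apply: (@within_seq _ (BUco R m) _ _ _ u x cD).
- exact: cvc_norm_le ux uM.
- exact: uM.
- by move=> e /ux[N HN]; exists N => n /HN; rewrite ballEmdist.
Qed.

(** The equation is solved on the windows from [- Tn n] to 0, and the window is sent to infinity.
    Differences of two approximations have zero [D] on long windows, so [decay_estimate] makes the
    sequence locally uniformly Cauchy; the same estimate for a difference of translates gives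
    uniform continuity of the limit. Continuity of [D] on balls for the compact-open topology passes
    the equation to the limit. *)
Lemma Dhat_onto h : exists x, Dh x = h.
Proof.
have [delta d0 atomic] := D_atomic admD.
have [C1 C10 HC1] := Dhat_lower admD.
have [C2 C20 HC2] := D_bounded admD.
pose Tn (n : nat) : R := n%:R * delta.
have Tn0 n : - Tn n <= 0 by rewrite oppr_le0 mulr_ge0// ltW.
pose B := C1 * ((1 + C2 * 2) * `|h|).
have B0 : 0 <= B by rewrite !mulr_ge0 ?addr_ge0// ?ltW// mulr_gt0.
have H n : exists x, (forall s, - Tn n <= s <= 0 -> D (sh x s) = h (clip s)) /\
    `|x| <= B.
  have [phi phih phin] := D_section admD d0 atomic (h (clip (- Tn n))).
  (* The bound coming with the extension depends on [n] and is dropped. The uniform bound [B] comes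
     from [Dhat_lower]: along [x], [D] takes the values of [h] on the window and its values on
     translates of [phi] before it. *)
  have [C _ /(_ phi h phih)[x [xs xD _]]] := extend_steps admD d0 atomic n.
  exists x; split=> //; apply: le_trans (HC1 _) _; rewrite ler_wpM2l ?(ltW C10)//.
  apply: BU_le => t t0; rewrite DhE//.
  have [Tt|tT] := leP (- Tn n) t.
    rewrite xD ?Tt//; apply: le_trans (BU_ub _ _) _.
    by rewrite mulrDl mul1r lerDl !mulr_ge0// ltW.
  have tT0 : t + Tn n <= 0 by lra.
  have Tn0n := Tn0 n.
  have -> : sh x t = sh phi (t + Tn n).
    by rewrite -xs sh_sh//; congr sh; rewrite /Tn; lra.
  apply: le_trans (HC2 _) _; rewrite mulrDl mul1r ler_wpDl// -mulrA.
  rewrite ler_wpM2l ?(ltW C20)//; apply: le_trans (sh_norm _ _) (le_trans phin _).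
  by rewrite ler_wpM2l// BU_ub.
have [u Hu] := choice H.
have uD n s : - Tn n <= s <= 0 -> D (sh (u n) s) = h (clip s).
  by case: (Hu n) => + _; apply.
have uB n : `|u n| <= B by case: (Hu n).
have est (e : R) : 0 < e -> exists T C : R, [/\ 0 <= T, 0 <= C &
    forall w t A, t <= 0 ->
      (forall s, t - T <= s <= t -> `|D (sh w s)| <= A) ->
      `|w (clip t)| <= e * `|w| + C * A].
  move=> e0; have [T [C [T0 C0 HC]]] := decay_estimate admD e0; exists T, C; split => // w t A t0 wA.
  rewrite -sh_eval//; apply: le_trans (HC (sh w t) A _) _; last first.
    by rewrite lerD2r ler_wpM2l ?(ltW e0)// sh_norm.
  by move=> s /andP[Ts s0]; rewrite sh_sh//; apply: wA; apply/andP; split; lra.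
have TnK (K : R) : exists N, forall n, (N <= n)%N -> K <= Tn n.
  exists (Num.truncn (`|K| / delta)).+1 => n Nn.
  apply: le_trans (ler_norm K) _; rewrite -ler_pdivrMr//.
  by apply: le_trans (ltW (truncnS_gt _)) _; rewrite ler_nat.
have dB w w' : `|w| <= B -> `|w'| <= B -> `|w - w'| <= 2 * B.
  move=> wB w'B; apply: le_trans (ler_normB _ _) _.
  by rewrite mulr2n mulrDl mul1r lerD.
have B1 : 0 < 4 * B + 1 by rewrite ltr_wpDl// mulr_ge0.
(* Two functions of norm at most [B] differ by at most [2 * B]; with this weight the non-local term
   of the estimate stays below [a / 2]. *)
have small (a : R) : 0 < a -> a / (4 * B + 1) * (2 * B) <= a / 2.
  move=> a0; rewrite mulrAC ler_pdivrMr//; have := mulr_ge0 (ltW a0) B0; nra.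
have [l Hl] : exists l : R -> V, forall K a : R, 0 < a -> exists N,
    forall n, (N <= n)%N -> forall t : R, - K <= t <= 0 -> `|l t - u n (clip t)| <= a.
  apply: BU_locally_complete => K a a0.
  have a10 : 0 < a / (4 * B + 1) by rewrite divr_gt0.
  have [T [C [T0 C0 HC]]] := est _ a10; have [N HN] := TnK (K + T).
  exists N => n k Nn Nk t /andP[Kt t0].
  rewrite -BUBE; apply: le_trans (HC (u k - u n) t 0 t0 _) _.
    move=> s /andP[ts st]; have s0 : s <= 0 by lra.
    have := HN n Nn; have := HN k Nk => h1 h2.
    rewrite shB// (DB admD) !uD ?subrr ?normr0//; apply/andP; split => //; lra.
  rewrite mulr0 addr0; apply: (@le_trans _ _ (a / (4 * B + 1) * (2 * B))).
    by rewrite ler_wpM2l ?(ltW a10)// dB.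
  by apply: le_trans (small a a0) _; lra.
have luc (a : R) : 0 < a -> exists2 d : R, 0 < d &
    forall s t, s <= t -> t <= 0 -> t - s < d -> `|l s - l t| < a.
  move=> a0; have a10 : 0 < a / (4 * B + 1) by rewrite divr_gt0.
  have [T [C [T0 C0 HC]]] := est _ a10.
  have C1' : 0 < C + 1 by rewrite ltr_wpDl.
  have aA0 : 0 < a / 4 / (C + 1) by rewrite !divr_gt0.
  have [d dd0 Hd] := BU_uc h aA0; exists d => // s t st t0 std.
  have a80 : 0 < a / 16 by lra.
  have [N1 HN1] := Hl (- s) _ a80; have [N2 HN2] := TnK (- s + T).
  pose n := maxn N1 N2.
  have h1 := HN1 n (leq_maxl _ _) s; have h2 := HN1 n (leq_maxl _ _) t.
  have Tnn := HN2 n (leq_maxr _ _).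
  have st0 : s - t <= 0 by lra.
  have h3 : `|u n (clip s) - u n (clip t)| <= a / 2 + a / 4.
    have -> : u n (clip s) - u n (clip t) = (sh (u n) (s - t) - u n) (clip t).
      by rewrite BUBE shE//; congr (u n (clip _) - _); lra.
    apply: le_trans (HC _ t (a / 4 / (C + 1)) t0 _) _.
      move=> r /andP[tr rt]; have r0 : r <= 0 by lra.
      rewrite shB// sh_sh// (DB admD) !uD; first last.
      - by apply/andP; split; lra.
      - by apply/andP; split; lra.
      apply/ltW/Hd; have -> : s - t + r - r = s - t by lra.
      by rewrite ler0_norm// opprB.
    apply: lerD.
      apply: le_trans (small a a0); rewrite ler_wpM2l ?(ltW a10)// dB//.
      exact: le_trans (sh_norm _ _) (uB n).
    rewrite mulrCA -[leRHS]mulr1 ler_wpM2l//; first by rewrite ltW// divr_gt0.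
    by rewrite ler_pdivrMr// mul1r lerDl.
  have -> : l s - l t = (l s - u n (clip s)) + (u n (clip s) - u n (clip t)) -
      (l t - u n (clip t)) by rewrite addrA subrK opprB addrA subrK.
  apply: le_lt_trans (ler_normB _ _) _.
  apply: le_lt_trans (lerD (ler_normD _ _) (lexx _)) _.
  have {h1}h1 : `|l s - u n (clip s)| <= a / 16 by apply: h1; apply/andP; split; lra.
  have {h2}h2 : `|l t - u n (clip t)| <= a / 16 by apply: h2; apply/andP; split; lra.
  move: h1 h2 h3; move: `|_ - _| `|_ - _| `|_ - _| => p q r'; lra.
have lE t : t <= 0 -> ofR l (clip t) = l t.
  apply: ofRE.
    exists (B + 1) => t' t'0; have [N /(_ N (leqnn N) t') HN] := Hl (- t') 1 ltr01.
    rewrite -(subrK (u N (clip t')) (l t')) addrC; apply: le_trans (ler_normD _ _) _.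
    apply: lerD; first exact: le_trans (BU_ub _ _) (uB N).
    by apply: HN; rewrite opprK lexx.
  move=> e /luc[d dd0 Hd]; exists d => // p q p0 q0 pq.
  have [pq'|qp'] := leP p q.
    by apply: Hd => //; move: pq; rewrite distrC ger0_norm// subr_ge0.
  rewrite distrC; apply: Hd => //; first exact: ltW.
  by move: pq; rewrite ger0_norm// subr_ge0 ltW.
have ux : cvc u (ofR l).
  apply/cvcP => K e e0; have [N HN] := Hl K e e0; exists N => n Nn t Kt.
  by rewrite lE; [exact: HN|case/andP: Kt].
exists (ofR l); apply: BU_ext => t t0; rewrite DhE//.
apply/eqP; rewrite -subr_eq0 -normr_le0; apply/ler_addgt0Pl => e e0.
have [|N1 HN1] := @D_co_continuous (fun n => sh (u n) t) _ B (cvc_sh t0 ux) _ e e0.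
  by move=> n; apply: le_trans (sh_norm _ _) (uB n).
have [N2 HN2] := TnK (- t).
have := HN1 (maxn N1 N2) (leq_maxl _ _); rewrite /= uD; last first.
  by have := HN2 (maxn N1 N2) (leq_maxr _ _); rewrite t0 andbT; lra.
by rewrite addr0 => /ltW.
Qed.

End surjectivity.

(** * Derivatives on compact intervals *)

Section one_sided_derivatives.
Variable R : realType.

(** Derivative relative to the interval, one-sided at its ends, written through increments; there is
    no division, so [s' = s] needs no exception. *)
Definition sder (f f' : R -> R) (a b : R) := forall s, a <= s <= b ->
  forall e, 0 < e -> exists2 d : R, 0 < d & forall s', a <= s' <= b ->
    `|s' - s| < d -> `|f s' - f s - (s' - s) * f' s| <= e * `|s' - s|.

(** The slope bound is assumed only where [f] is nonpositive. With a slack [e] added to [K], the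
    supremum of the points above the barrier can be passed: by continuity if [f] is positive there,
    by the slope bound otherwise. *)
Lemma sder_barrier f f' (K a b : R) : 0 <= K -> sder f f' a b -> 0 <= f a ->
  (forall s, a <= s <= b -> f s <= 0 -> - K <= f' s) ->
  forall s, a <= s <= b -> - (K * (s - a)) <= f s.
Proof.
move=> K0 df fa f'K b' ab'.
apply/ler_addgt0Pl => e' e'0; have /andP[ab b'b] := ab'.
have [e e0 ee'] : exists2 e, 0 < e & e * (b' - a) <= e'.
  exists (e' / (b' - a + 1)); first by rewrite divr_gt0//; lra.
  rewrite mulrAC ler_pdivrMr; last lra.
  by rewrite ler_wpM2l ?(ltW e'0)//; lra.
suff : - ((K + e) * (b' - a)) <= f b' by lra.
pose E : set R := [set s | a <= s <= b' /\ - ((K + e) * (s - a)) <= f s].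
have Ea : E a by rewrite /E /= lexx ab subrr mulr0 oppr0.
have supE : has_sup E by split; [exists a|exists b' => s [/andP[]]].
have /andP[at_ tb'] : a <= sup E <= b'.
  apply/andP; split; first by apply: ub_le_sup => //; case: supE.
  by apply: ge_sup; [exists a|move=> s [/andP[]]].
have tE : a <= sup E <= b by rewrite at_ (le_trans tb').
have near_t : forall g, 0 < g -> exists2 d : R, 0 < d &
    forall s, a <= s <= b -> `|s - sup E| < d -> `|f s - f (sup E)| <= g.
  move=> g g0; have [d d0 Hd] := df (sup E) tE 1 ltr01.
  have N0 : 0 < `|f' (sup E)| + 1 by rewrite ltr_wpDl.
  exists (Num.min d (g / (`|f' (sup E)| + 1))); first by rewrite lt_min d0 divr_gt0.
  move=> s sab; rewrite lt_min => /andP[/(Hd s sab)].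
  rewrite ltr_pdivlMr// => H1; rewrite mulrDr mulr1 => /ltW H2.
  rewrite -(subrK ((s - sup E) * f' (sup E)) (f s - f (sup E))).
  apply: le_trans (ler_normD _ _) _; apply: le_trans H2.
  by rewrite normrM addrC lerD2l -[leRHS]mul1r.
have Et : - ((K + e) * (sup E - a)) <= f (sup E).
  apply/ler_addgt0Pl => g g0.
  have [d d0 Hd] := near_t _ g0; have [s Es st] := sup_adherent d0 supE.
  have [/andP[as_ sb'] fs] := Es.
  have sle : s <= sup E by apply: ub_le_sup => //; case: supE.
  have /Hd : a <= s <= b by rewrite as_ (le_trans sb').
  rewrite ler0_norm; last lra.
  case/(_ _)/ler_normlP => [|_]; first lra.
  have Ke : (K + e) * (s - a) <= (K + e) * (sup E - a) by rewrite ler_wpM2l//; lra.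
  lra.
have [tb|bt] := ltP (sup E) b'; last first.
  by have <- : sup E = b' by apply/le_anti; rewrite bt tb'.
exfalso.
have step d : 0 < d -> (forall s, a <= s <= b -> `|s - sup E| < d ->
    sup E <= s -> - ((K + e) * (s - a)) <= f s) -> False.
  move=> d0 Hd; pose s := Num.min b' (sup E + d / 2).
  have ts : sup E < s by rewrite /s lt_min tb /=; lra.
  have sb : s <= b' by rewrite /s ge_min lexx.
  have sd : s <= sup E + d / 2 by rewrite /s ge_min lexx orbT.
  suff : E s by move=> /(ub_le_sup (proj2 supE)); lra.
  split; first by rewrite sb andbT; lra.
  apply: Hd; [by rewrite (le_trans sb)// andbT; lra| |exact: ltW].
  by rewrite ger0_norm; lra.
have [f0|f0] := leP (f (sup E)) 0; last first.
  have [d d0 Hd] := near_t _ f0; apply: (step d d0) => s sab sd ts.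
  have /andP[as_ _] := sab.
  have : 0 <= (K + e) * (s - a) by rewrite mulr_ge0//; lra.
  by have := Hd s sab sd; rewrite ler_norml => /andP[]; lra.
have [d d0 Hd] := df (sup E) tE e e0; apply: (step d d0) => s sab sd ts.
have := Hd s sab sd; rewrite ler_norml [`|s - _|]ger0_norm; last lra.
move=> /andP[fs _]; have := f'K _ tE f0; rewrite -subr_ge0 opprK => h1.
have := mulr_ge0 h1 (_ : 0 <= s - sup E); rewrite subr_ge0 => /(_ ts).
move: fs Et; move: (sup E) (f' _) => t g; lra.
Qed.

Lemma sder_nondecreasing f f' (a b : R) : a <= b -> sder f f' a b ->
  (forall s, a <= s <= b -> 0 <= f' s) -> f a <= f b.
Proof.
move=> ab df f'0; rewrite -subr_ge0.
have -> : 0 = - (0 * (b - a)) :> R by rewrite mul0r oppr0.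
apply: (@sder_barrier (fun s => f s - f a) f' 0 a b); rewrite ?subrr ?lexx ?ab//.
- move=> s sab e /(df s sab)[d d0 H]; exists d => // s' s'ab sd.
  by rewrite opprB addrA subrK; exact: H.
- by move=> s sab _; rewrite oppr0; exact: f'0.
Qed.

Lemma sderD f f' g g' a b : sder f f' a b -> sder g g' a b ->
  sder (fun s => f s + g s) (fun s => f' s + g' s) a b.
Proof.
move=> df dg s sab e e0; have e20 : 0 < e / 2 by lra.
have [d1 d10 H1] := df s sab _ e20; have [d2 d20 H2] := dg s sab _ e20.
exists (Num.min d1 d2); first by rewrite lt_min d10.
move=> s' s'ab; rewrite lt_min => /andP[sd1 sd2].
have -> : f s' + g s' - (f s + g s) - (s' - s) * (f' s + g' s) =
  (f s' - f s - (s' - s) * f' s) + (g s' - g s - (s' - s) * g' s) by lra.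
apply: le_trans (ler_normD _ _) _.
by rewrite (splitr e) [leRHS]mulrDl lerD// ?H1 ?H2.
Qed.

Lemma sderN f f' a b : sder f f' a b ->
  sder (fun s => - f s) (fun s => - f' s) a b.
Proof.
move=> df s sab e e0; have [d d0 H] := df s sab e e0; exists d => // s' s'ab sd.
have -> : - f s' - - f s - (s' - s) * - f' s =
  - (f s' - f s - (s' - s) * f' s) by lra.
by rewrite normrN; exact: H.
Qed.

Lemma sder_linear c k a b : sder (fun s => c * (s - k)) (fun=> c) a b.
Proof.
move=> s _ e e0; exists 1 => // s' _ _.
have -> : c * (s' - k) - c * (s - k) - (s' - s) * c = 0 by lra.
by rewrite normr0 mulr_ge0// ltW.
Qed.

Lemma is_derive_sder (f f' : R -> R) (a b : R) :
  (forall s : R, a <= s <= b -> is_derive s 1 f (f' s)) -> sder f f' a b.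
Proof.
move=> df s sab e e0; have [dv fE] := df s sab.
have cvf : h^-1 *: (f (h + s) - f s) @[h --> 0^'] --> f' s.
  rewrite -fE /derive.
  have := dv; rewrite /derivable => /cvg_ex[l Hl].
  have Hl' : h^-1 *: (f (h + s) - f s) @[h --> 0^'] --> l.
    by move: Hl; under eq_fun do rewrite /= [_ *: 1]mulr1.
  have -> : lim (h^-1 *: ((f \o shift s) (h *: 1) - f s) @[h --> 0^']) = l.
    exact: cvg_lim Hl.
  by [].
move/cvgrPdist_le/(_ e e0) : cvf; rewrite near_withinE => /nbhs_ballP[d /= d0 Hd].
exists d => // s' _ sd.
have [->|ss'] := eqVneq s' s; first by rewrite !subrr mul0r subr0 normr0 mulr0.
have h0 : s' - s != 0 by rewrite subr_eq0.
have bd : ball (0 : R) d (s' - s) by rewrite -ball_normE /= sub0r normrN.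
have := Hd _ bd h0; rewrite subrK /= => H.
have -> : f s' - f s - (s' - s) * f' s =
    - ((s' - s) * (f' s - (s' - s)^-1 * (f s' - f s))).
  by rewrite mulrBr mulrA mulfV// mul1r opprB.
by rewrite normrN normrM mulrC ler_wpM2r.
Qed.

Variable m : nat.
Notation V := 'rV[R]_m.

Definition der_on (g g' : R -> V) (a b : R) := forall s, a <= s <= b ->
  forall e, 0 < e -> exists2 d : R, 0 < d & forall s', a <= s' <= b ->
    `|s' - s| < d -> `|g s' - g s - (s' - s) *: g' s| <= e * `|s' - s|.

Lemma der_on_coord g g' a b j : der_on g g' a b ->
  sder (fun s => g s 0 j) (fun s => g' s 0 j) a b.
Proof.
move=> dg s sab e e0; have [d d0 H] := dg s sab e e0; exists d => // s' s'ab sd.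
apply: le_trans (H s' s'ab sd); apply: le_trans (row_norm_ub _ j).
by rewrite !mxE.
Qed.

Lemma der_on_sub g g' a b a' b' : a <= a' -> b' <= b -> der_on g g' a b ->
  der_on g g' a' b'.
Proof.
move=> aa bb dg s /andP[as' sb'] e e0.
have [|d d0 H] := dg s _ e e0; first by rewrite (le_trans aa)// (le_trans sb').
exists d => // s' /andP[as1 sb1]; apply: H.
by rewrite (le_trans aa)// (le_trans sb1).
Qed.

Lemma der_onB g g' h h' a b : der_on g g' a b -> der_on h h' a b ->
  der_on (fun s => g s - h s) (fun s => g' s - h' s) a b.
Proof.
move=> dg dh s sab e e0; have e20 : 0 < e / 2 by lra.
have [d1 d10 H1] := dg s sab _ e20; have [d2 d20 H2] := dh s sab _ e20.
exists (Num.min d1 d2); first by rewrite lt_min d10.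
move=> s' s'ab; rewrite lt_min => /andP[sd1 sd2].
have -> : g s' - h s' - (g s - h s) - (s' - s) *: (g' s - h' s) =
  (g s' - g s - (s' - s) *: g' s) - (h s' - h s - (s' - s) *: h' s).
  by apply/rowP => j; rewrite !mxE; lra.
apply: le_trans (ler_normB _ _) _.
by rewrite (splitr e) [leRHS]mulrDl lerD// ?H1 ?H2.
Qed.

Lemma der_on_linear c a b : der_on (fun s => s *: c) (fun=> c) a b.
Proof.
move=> s _ e e0; exists 1 => // s' _ _.
by rewrite -scalerBl subrr normr0 mulr_ge0// ltW.
Qed.

(** Each coordinate of [g], with either sign, added to [psi] has a nonnegative derivative; the
    maximum norm then returns the bound without loss. *)
Lemma mean_value_le g g' psi psi' a b : a <= b -> der_on g g' a b ->
  sder psi psi' a b -> (forall s, a <= s <= b -> `|g' s| <= psi' s) ->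
  `|g b - g a| <= psi b - psi a.
Proof.
move=> ab dg dpsi gpsi.
have C j : `|g b 0 j - g a 0 j| <= psi b - psi a.
  have gj s : a <= s <= b -> - psi' s <= g' s 0 j <= psi' s.
    by move=> sab; rewrite -ler_norml; apply: le_trans (gpsi s sab); exact: row_norm_ub.
  have dj := der_on_coord j dg; rewrite ler_norml; apply/andP; split.
    suff : psi a + g a 0 j <= psi b + g b 0 j by lra.
    apply: (sder_nondecreasing ab (sderD dpsi dj)) => s /gj/andP[]; lra.
  suff : psi a + - g a 0 j <= psi b + - g b 0 j by lra.
  apply: (sder_nondecreasing ab (sderD dpsi (sderN dj))) => s /gj/andP[]; lra.
apply: row_norm_le => [|j]; last by rewrite !mxE.
rewrite subr_ge0; apply: (sder_nondecreasing ab dpsi) => s /gpsi.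
exact: le_trans.
Qed.

Lemma mean_value_cst g g' (c : V) (K : R) a b : a <= b -> der_on g g' a b ->
  (forall s, a <= s <= b -> `|g' s - c| <= K) ->
  `|g b - g a - (b - a) *: c| <= K * (b - a).
Proof.
move=> ab dg gK.
have := mean_value_le ab (der_onB dg (@der_on_linear c a b)) (@sder_linear K a a b) gK.
rewrite subrr mulr0 subr0 /= => H; apply: le_trans H; rewrite le_eqVlt; apply/orP; left.
by apply/eqP; congr `|_|; apply/rowP => j; rewrite !mxE; lra.
Qed.

Lemma der_on_row (g g' : R -> V) a b :
  (forall j, sder (fun s => g s 0 j) (fun s => g' s 0 j) a b) -> der_on g g' a b.
Proof.
move=> dg s sab e e0.
have [j|d d0 Hd] := @fin_pos R 'I_m (fun j d => forall s', a <= s' <= b ->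
    `|s' - s| < d -> `|g s' 0 j - g s 0 j - (s' - s) * g' s 0 j| <= e * `|s' - s|).
  have [d d0 Hd] := dg j s sab e e0; exists d => // d' /andP[_ d'd] s' s'ab sd.
  by apply: Hd => //; exact: lt_le_trans sd d'd.
exists d => // s' s'ab sd; apply: row_norm_le => [|j].
  by rewrite mulr_ge0// ltW.
by rewrite !mxE; apply: (Hd d) => //; rewrite d0 lexx.
Qed.

Lemma mean_value_near g g' s s' (c : V) (K a b : R) :
  a <= s <= b -> a <= s' <= b -> der_on g g' a b ->
  (forall t, a <= t <= b -> `|t - s| <= `|s' - s| -> `|g' t - c| <= K) ->
  `|g s' - g s - (s' - s) *: c| <= K * `|s' - s|.
Proof.
move=> /andP[as_ sb] /andP[as' s'b] dg gK.
have [ss'|/ltW s's] := leP s s'.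
  rewrite [`|s' - s|]ger0_norm ?subr_ge0//.
  apply: (mean_value_cst ss' (der_on_sub as_ s'b dg)) => r /andP[sr rs'].
  apply: gK; first by rewrite (le_trans as_ sr) (le_trans rs' s'b).
  by rewrite !ger0_norm ?subr_ge0// lerD2r.
rewrite [`|s' - s|]ler0_norm ?subr_le0//.
have -> : g s' - g s - (s' - s) *: c = - (g s - g s' - (s - s') *: c).
  by rewrite -(opprB s s') scaleNr opprK !opprB addrC.
rewrite normrN opprB.
apply: (mean_value_cst s's (der_on_sub as' sb dg)) => r /andP[sr rs].
apply: gK; first by rewrite (le_trans as' sr) (le_trans rs sb).
by rewrite !ler0_norm ?subr_le0// lerN2 lerD2r.
Qed.

(** The mean value inequality bounds the increments of the [g_ n] near [s] uniformly in [n], and the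
    bound survives the pointwise limit. *)
Lemma der_on_limit (g_ g'_ : nat -> R -> V) (g g' : R -> V) a b :
  (forall n, der_on (g_ n) (g'_ n) a b) ->
  (forall s, a <= s <= b -> cvd (fun x y : V => `|x - y|) (g_ ^~ s) (g s)) ->
  (forall s, a <= s <= b -> forall e, 0 < e -> exists2 d : R, 0 < d &
    exists N, forall n t, (N <= n)%N -> a <= t <= b -> `|t - s| < d ->
      `|g'_ n t - g' s| <= e) ->
  der_on g g' a b.
Proof.
move=> dg gg gg' s sab e e0; have [d d0 [N0 Hd]] := gg' s sab e e0.
exists d => // s' s'ab sd; apply/ler_addgt0Pl => h h0.
have h20 : 0 < h / 2 by lra.
have [N1 H1] := gg s sab _ h20; have [N2 H2] := gg s' s'ab _ h20.
pose n := maxn N0 (maxn N1 N2).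
have n0 : (N0 <= n)%N by exact: leq_maxl.
have n1 := H1 n (leq_trans (leq_maxl _ _) (leq_maxr _ _)).
have n2 := H2 n (leq_trans (leq_maxr _ _) (leq_maxr _ _)).
have mv := mean_value_near sab s'ab (dg n) (fun t tab ts => Hd n t n0 tab (le_lt_trans ts sd)).
have -> : g s' - g s - (s' - s) *: g' s =
  (g s' - g_ n s') + (g_ n s' - g_ n s - (s' - s) *: g' s) - (g s - g_ n s).
  by apply/rowP => j; rewrite !mxE; lra.
apply: le_trans (ler_normB _ _) _.
apply: le_trans (lerD (le_trans (ler_normD _ _) (lerD (ltW n2) mv)) (ltW n1)) _.
by rewrite [leLHS]addrAC -splitr.
Qed.

End one_sided_derivatives.

Opaque co_dist Dhat sh seg hist.

(** * Solutions and their comparison *)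

Section solutions.
Variables (R : realType) (m : nat) (Omega : metricType R).
Variables (sigma : R -> Omega -> Omega).
Notation V := 'rV[R]_m.
Notation BU := (BU R m).
Notation BUco := (BUco R m).
Variables (D : BU -> V) (F : Omega -> BU -> V).
Hypotheses (flow : continuous_flow sigma) (admD : admissible_D D).
Hypotheses (F1 : hypF1 F) (F2 : hypF2 F) (F3 : hypF3 F) (F4 : hypF4 D F).
Implicit Types (w : Omega) (x y v : BU) (s t a : R).
Notation Dh := (Dhat D).
Notation dR := (fun x y : R => `|x - y|).
Notation dV := (fun x y : V => `|x - y|).

(* [v] is a history ending at [w], and it solves the equation on [-a, 0]. *)
Definition sol w v a :=
  der_on (fun s => D (sh v s)) (fun s => F (sigma s w) (sh v s)) (- a) 0.

Lemma sigma0 w : sigma 0 w = w. Proof. by case: flow. Qed.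

Lemma sigmaD s t w : sigma s (sigma t w) = sigma (s + t) w.
Proof. by case: flow => _ _ ->. Qed.

Lemma sigmaNK t w : sigma t (sigma (- t) w) = w.
Proof. by rewrite sigmaD subrr sigma0. Qed.

Lemma sigmaKN t w : sigma (- t) (sigma t w) = w.
Proof. by rewrite sigmaD addNr sigma0. Qed.

Lemma sigma_seq (s_ : nat -> R) (w_ : nat -> Omega) s w :
  cvd dR s_ s -> cvd mdist w_ w ->
  cvd mdist (fun n => sigma (s_ n) (w_ n)) (sigma s w).
Proof.
move=> ss ww e e0; have [cf _ _] := flow.
have nb : nbhs (sigma s w) (ball (sigma s w) e) by exact: nbhsx_ballx.
have /nbhs_ballP[d /= d0 Hd] := cf (s, w) _ nb.
have [N1 H1] := ss d d0; have [N2 H2] := ww d d0.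
exists (maxn N1 N2) => n; rewrite geq_max => /andP[/H1 sn /H2 wn].
have := Hd (s_ n, w_ n); rewrite /= ballEmdist; apply; split => //=.
by rewrite ballEmdist.
Qed.

Lemma cvd_cst T (d : T -> T -> R) l : d l l = 0 -> cvd d (fun=> l) l.
Proof. by move=> dl e e0; exists 0%N => n _; rewrite dl. Qed.

Lemma sigma_seq_w (w_ : nat -> Omega) t w : cvd mdist w_ w ->
  cvd mdist (fun n => sigma t (w_ n)) (sigma t w).
Proof. by apply: sigma_seq; apply: cvd_cst; rewrite subrr normr0. Qed.

Lemma sh_seq (v_ : nat -> BU) (s_ : nat -> R) v s : (forall n, s_ n <= 0) ->
  s <= 0 -> cvc v_ v -> cvd dR s_ s -> cvc (fun n => sh (v_ n) (s_ n)) (sh v s).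
Proof.
move=> s_0 s0 /cvcP vv ss; apply/cvcP => T e e0.
have e20 : 0 < e / 2 by lra.
have [d d0 Hd] := BU_uc v e20.
have [N1 H1] := ss _ d0; have [N2 H2] := ss 1 ltr01.
have [N3 H3] := vv (T - s + 1) (e / 2) e20.
exists (maxn N1 (maxn N2 N3)) => n; rewrite !geq_max => /and3P[/H1 n1 /H2 n2 /H3 n3].
move=> t /andP[Tt t0]; rewrite !shE//.
have -> : v (clip (s + t)) - v_ n (clip (s_ n + t)) =
  (v (clip (s + t)) - v (clip (s_ n + t))) +
  (v (clip (s_ n + t)) - v_ n (clip (s_ n + t))) by rewrite addrA subrK.
apply: le_trans (ler_normD _ _) _; rewrite (splitr e) lerD//.
  by apply/ltW/Hd; have -> : s + t - (s_ n + t) = s - s_ n by lra.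
apply: n3; have := s_0 n; have := ler_norm (s - s_ n).
by move=> h1 h2; apply/andP; split; lra.
Qed.

Lemma F_seq (w_ : nat -> Omega) (x_ : nat -> BU) w x (M : R) :
  cvd mdist w_ w -> cvc x_ x -> (forall n, `|x_ n| <= M) ->
  cvd dV (fun n => F (w_ n) (x_ n)) (F w x).
Proof.
move=> ww xx xM; have r0 : 0 < Num.max M 1 by rewrite lt_max ltr01 orbT.
have := @within_seq _ (Omega * BUco)%type _ _ _ (fun n => (w_ n, x_ n : BUco)) (w, x : BUco)
  (F3 r0).
apply.
- by rewrite /= /cball /= le_max (cvc_norm_le xx xM).
- by move=> n; rewrite /= /cball /= le_max xM.
- move=> e e0; have [N1 H1] := ww e e0; have [N2 H2] := xx e e0.
  exists (maxn N1 N2) => n; rewrite geq_max => /andP[/H1 n1 /H2 n2].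
  by split => /=; rewrite ballEmdist.
Qed.

Lemma sol_sub w v a b : b <= a -> sol w v a -> sol w v b.
Proof. by move=> ba; apply: der_on_sub => //; rewrite lerN2. Qed.

Lemma der_on_shift (g g' h h' : R -> V) t a b c d :
  (forall s, c <= s <= d -> h s = g (s + t)) ->
  (forall s, c <= s <= d -> h' s = g' (s + t)) ->
  (forall s, c <= s <= d -> a <= s + t <= b) ->
  der_on g g' a b -> der_on h h' c d.
Proof.
move=> hg hg' cd dg s scd e e0; have [dd dd0 H] := dg (s + t) (cd s scd) e e0.
exists dd => // s' s'cd sd; rewrite !hg// hg'//.
have st : s' + t - (s + t) = s' - s by lra.
by have := H (s' + t) (cd s' s'cd); rewrite st; apply.
Qed.

Lemma sol_sh w v a t : - a <= t <= 0 -> sol w v a ->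
  sol (sigma t w) (sh v t) (a + t).
Proof.
move=> /andP[at_ t0]; apply: (@der_on_shift _ _ _ _ t).
- by move=> s /andP[_ s0]; rewrite sh_sh// addrC.
- by move=> s /andP[_ s0]; rewrite sh_sh// sigmaD [t + s]addrC.
- by move=> s /andP[h1 h2]; apply/andP; split; lra.
Qed.

Lemma sol_lipschitz (M : R) : 0 <= M -> exists2 K : R, 0 < K & forall w v a, `|v| <= M ->
  sol w v a -> forall s t, - a <= s <= t -> t <= 0 ->
    `|D (sh v t) - D (sh v s)| <= K * (t - s).
Proof.
move=> M0; have M1 : 0 < M + 1 by lra.
have [K HK] := F2 M1; exists (`|K| + 1); first by rewrite ltr_wpDl.
move=> w v a vM sv s t /andP[as_ st] t0.
have := mean_value_cst (c := 0) (K := `|K| + 1) st (der_on_sub as_ t0 sv).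
rewrite scaler0 subr0; apply => r _; rewrite subr0.
apply: le_trans (HK _ _ _) _; last by apply: le_trans (ler_norm _) _; rewrite lerDl.
by rewrite /cball /=; apply: le_trans (sh_norm _ _) _; lra.
Qed.

(** The derivatives must be close to the limiting one for all large [n] and all [t] near [s] at
    once. If they were not, indices and times tending to [s] would contradict the joint sequential
    continuity in [F_seq]. *)
Lemma sol_limit (w_ : nat -> Omega) (v_ : nat -> BU) w v (M a : R) :
  cvd mdist w_ w -> cvc v_ v -> (forall n, `|v_ n| <= M) ->
  (forall n, sol (w_ n) (v_ n) a) -> sol w v a.
Proof.
move=> ww vv vM sv; apply: (der_on_limit sv).
  move=> s /andP[_ s0]; apply: (D_co_continuous admD (cvc_sh s0 vv) (M := M)).
  by move=> k; apply: le_trans (sh_norm _ _) (vM _).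
move=> s /andP[as_ s0] e e0; pose c := F (sigma s w) (sh v s).
have [d d0 [N0 Hd]] : exists2 d : R, 0 < d & exists N, forall n t, (N <= n)%N ->
    - a <= t <= 0 -> `|t - s| < d -> `|F (sigma t (w_ n)) (sh (v_ n) t) - c| <= e.
  apply: contrapT => /forall2NP H.
  have H' k : exists nt : nat * R, [/\ (k <= nt.1)%N, - a <= nt.2 <= 0,
      `|s - nt.2| < k.+1%:R^-1 &
      e < `|F (sigma nt.2 (w_ nt.1)) (sh (v_ nt.1) nt.2) - c|].
    have [/negP|/forallNP/(_ k)] := H k.+1%:R^-1; first by rewrite invr_gt0 ltr0Sn.
    move/existsNP => [n /existsNP[t /not_implyP[kn /not_implyP[ta /not_implyP[ts /negP]]]]].
    by rewrite -ltNge => ce; exists (n, t); split => //; rewrite distrC.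
  have [nt Hnt] := choice H'.
  pose f k := (nt k).1; pose t_ k := (nt k).2.
  have hf : extraction f by move=> k; case: (Hnt k).
  have tt : cvd dR t_ s by apply: cvd_inv => k; case: (Hnt k).
  have tle k : t_ k <= 0 by case: (Hnt k) => _ /andP[].
  have shs : cvc (fun k => sh (v_ (f k)) (t_ k)) (sh v s).
    exact: (sh_seq tle s0 (cvd_extract hf vv) tt).
  have ws : cvd mdist (fun k => sigma (t_ k) (w_ (f k))) (sigma s w).
    by apply: sigma_seq => //; exact: (cvd_extract hf ww).
  have [|N /(_ N (leqnn N))] := F_seq (M := M) ws shs _ e0.
    by move=> k; apply: le_trans (sh_norm _ _) (vM _).
  rewrite distrC => /ltW; case: (Hnt N) => _ _ _ ce.
  by rewrite leNgt ce.
by exists d => //; exists N0.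
Qed.

End solutions.

(** * Comparison and uniqueness *)

Section comparison.
Variables (R : realType) (m : nat) (Omega : metricType R).
Variables (sigma : R -> Omega -> Omega).
Notation V := 'rV[R]_m.
Notation BU := (BU R m).
Variables (D : BU -> V) (F : Omega -> BU -> V).
Hypotheses (flow : continuous_flow sigma) (admD : admissible_D D).
Hypotheses (F1 : hypF1 F) (F2 : hypF2 F) (F4 : hypF4 D F).
Implicit Types (w : Omega) (x y v : BU) (s t a : R).
Notation Dh := (Dhat D).
Notation sol := (sol sigma D F).

Let not_le_lt (p q : R) : ~ (p <= q) -> q < p.
Proof. by move/negP; rewrite -ltNge. Qed.

Let max_sub (p q B : R) : 0 <= B -> - B <= q - p -> `|Num.max p q - q| <= B.
Proof.
move=> B0 pq; rewrite ler_norml /Num.max.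
by have [h|h] := ltP p q; apply/andP; split; lra.
Qed.

(** The path of [sigma s w] and [sh v s] over [[-a, 0]] is compact, for the sup norm in the second
    factor since [v] is uniformly continuous; the local constants of (F1) thus become uniform in a
    tube around it. *)
Lemma lipschitz_tube w v a : exists2 r : R, 0 < r & exists2 L : R, 0 < L &
  forall s w' x y, - a <= s <= 0 -> mdist (sigma s w) w' < r ->
    `|x - sh v s| < r -> `|y - sh v s| < r -> `|F w' x - F w' y| <= L * `|x - y|.
Proof.
apply: contrapT => /forall2NP H.
have H' k : exists p : (R * Omega) * (BU * BU),
    [/\ - a <= p.1.1 <= 0, mdist (sigma p.1.1 w) p.1.2 < k.+1%:R^-1,
        `|p.2.1 - sh v p.1.1| < k.+1%:R^-1, `|p.2.2 - sh v p.1.1| < k.+1%:R^-1 &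
        k.+1%:R * `|p.2.1 - p.2.2| < `|F p.1.2 p.2.1 - F p.1.2 p.2.2| ].
  have [/negP|/forall2NP/(_ k.+1%:R)] := H k.+1%:R^-1.
    by rewrite invr_gt0 ltr0Sn.
  case=> [/negP|]; first by rewrite ltr0Sn.
  move/existsNP => [s /existsNP[w' /existsNP[x /existsNP[y]]]].
  move=> /not_implyP[sa /not_implyP[h1 /not_implyP[h2 /not_implyP[h3 /not_le_lt h4]]]].
  by exists ((s, w'), (x, y)); split; [exact: sa|exact: h1|exact: h2|exact: h3|exact: h4].
have [p Hp] := choice H'.
have [n|f hf [s /andP[as_ s0] fs]] := @segment_extract R (- a) 0 (fun k => (p k).1.1).
  by case: (Hp n).
have [_ /(_ (sigma s w) (sh v s))[L [d d0 HL]]] := F1.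
have d20 : 0 < d / 2 by lra.
have [N1 H1] := sigma_seq flow fs (cvd_cst (mdistxx w)) d20.
have [d' d'0 Hd'] := sh_uc v d20.
have [N2 H2] := fs d' d'0.
have [N3 H3] := invS_lt d20.
pose n := maxn N1 (maxn N2 (maxn N3 (Num.truncn L))).
have n1 : (N1 <= n)%N by exact: leq_maxl.
have n2 : (N2 <= n)%N by rewrite /n (leq_trans _ (leq_maxr _ _))// leq_maxl.
have n3 : (N3 <= f n)%N.
  by apply: leq_trans (hf n); rewrite /n !leq_max leqnn !orbT.
have n4 : (Num.truncn L <= f n)%N.
  by apply: leq_trans (hf n); rewrite /n !leq_max leqnn !orbT.
have [/andP[_ t0] h1 h2 h3 h4] := Hp (f n).
have hs : `|sh v (p (f n)).1.1 - sh v s| <= d / 2.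
  by apply: Hd' => //; rewrite distrC; exact: H2.
have near_ x : `|x - sh v (p (f n)).1.1| < (f n).+1%:R^-1 -> `|x - sh v s| < d.
  move=> hx; rewrite (splitr d).
  exact: BU_dist_lt (lt_trans hx (H3 _ n3)) hs.
have := HL _ _ _ _ (near_ _ h2) (near_ _ h3) => /(_ (p (f n)).1.2) H4.
have {}H4 := H4 (le_lt_trans (metric_triangle _ _ _)
  (lt_le_trans (ltrD (H1 n n1) (lt_trans h1 (H3 _ n3))) _)).
have dd : d / 2 + d / 2 <= d by rewrite -splitr.
have := lt_le_trans h4 (H4 dd); rewrite ltNge => /negP; apply.
rewrite ler_wpM2r//; apply: le_trans (ltW (truncnS_gt L)) _.
by rewrite ler_nat.
Qed.

Lemma BU_max x y : exists z : BU, forall t i, t <= 0 ->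
  z (clip t) 0 i = Num.max (x (clip t) 0 i) (y (clip t) 0 i).
Proof.
pose f t : V := \row_i Num.max (x (clip t) 0 i) (y (clip t) 0 i).
exists (ofR f) => t i t0; rewrite ofRE ?mxE// {t i t0}.
  exists (`|x| + `|y|) => t t0; apply: row_norm_le => [|i]; first by rewrite addr_ge0.
  rewrite mxE; have h1 := le_trans (row_norm_ub (x (clip t)) i) (BU_ub _ _).
  have h2 := le_trans (row_norm_ub (y (clip t)) i) (BU_ub _ _).
  rewrite /Num.max; case: ifP => _; first by rewrite (le_trans h2)// lerDr.
  by rewrite (le_trans h1)// lerDl.
move=> e e0; have e20 : 0 < e / 2 by lra.
have [d1 d10 H1] := BU_uc x e20; have [d2 d20 H2] := BU_uc y e20.
exists (Num.min d1 d2); first by rewrite lt_min d10.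
move=> s t _ _; rewrite lt_min => /andP[/H1 h1 /H2 h2].
apply: (@le_lt_trans _ _ (e / 2)); last lra.
apply: row_norm_le => [|i]; first lra.
have {h1} := le_lt_trans (row_norm_ub (x (clip s) - x (clip t)) i) h1.
have {h2} := le_lt_trans (row_norm_ub (y (clip s) - y (clip t)) i) h2.
rewrite !mxE; move: (x _ _ _) (x _ _ _) (y _ _ _) (y _ _ _) => p q p' q'.
rewrite !ltr_norml ler_norml => /andP[h1 h2] /andP[h3 h4]; rewrite /Num.max.
by have [h5|h5] := ltP p p'; have [h6|h6] := ltP q q'; apply/andP; split; lra.
Qed.

(** A lower bound [- B] on the difference [g] improves itself. The least upper bound [z] of
    [sh v1 t] and [sh v2 t] for [leD] agrees with [sh v1 t] under [D] in each component where [g] is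
    nonpositive, so (F4) gives [F_j(v1) <= F_j(z)] there; as [z] is within [C * B] of [sh v2 t], the
    Lipschitz bound gives [g' >= - L * C * B], and [sder_barrier] applies. *)
Lemma comparison w v1 v2 a : 0 <= a -> sol w v1 a -> sol w v2 a ->
  leD D (sh v1 (- a)) (sh v2 (- a)) -> leD D v1 v2.
Proof.
move=> a0 sv1 sv2 /leDP v12.
have [C C0 HC] := Dhat_lower admD.
have [r r0 [L L0 HL]] := lipschitz_tube w v2 a.
have [M [v1M v2M M0]] : exists M : R, [/\ `|v1| <= M, `|v2| <= M & 0 <= M].
  by exists (Num.max `|v1| `|v2|); rewrite !le_max !lexx orbT normr_ge0.
have [K K0 HK] := @sol_lipschitz _ _ _ sigma D F F2 M M0.
pose g s j := D (sh v2 s) 0 j - D (sh v1 s) 0 j.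
pose g' s j := F (sigma s w) (sh v2 s) 0 j - F (sigma s w) (sh v1 s) 0 j.
have dg j : sder (g ^~ j) (g' ^~ j) (- a) 0.
  exact: sderD (der_on_coord j sv2) (sderN (der_on_coord j sv1)).
have past s j : s <= - a -> 0 <= g s j.
  move=> sa; have := v12 (s + a) j; rewrite !sh_sh; try lra.
  have -> : - a + (s + a) = s by lra.
  by rewrite /g subr_ge0; apply; lra.
have glip s t j : - a <= s <= t -> t <= 0 -> g s j - (K + K) * (t - s) <= g t j.
  move=> ast t0.
  have := le_trans (row_norm_ub _ j) (HK w v1 a v1M sv1 s t ast t0).
  have := le_trans (row_norm_ub _ j) (HK w v2 a v2M sv2 s t ast t0).
  rewrite /g !mxE !ler_norml.
  move: (K * (t - s)) (mulrDl K K (t - s)) (D _ _ _) (D _ _ _) (D _ _ _) (D _ _ _).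
  by move=> k -> p q p' q' /andP[h1 h2] /andP[h3 h4]; lra.
have KK0 : 0 < K + K by rewrite addr_gt0.
(* During one step [g] falls by at most [(K + K) * eta]. The second condition keeps [z] inside the
   Lipschitz tube, the third makes [B] shrink to [B / 2]. *)
have [eta [eta0 eta1 eta2]] : exists eta : R, [/\ 0 < eta,
    C * ((K + K) * eta) < r & L * C * eta <= 2^-1].
  have key (X q : R) : 0 < X -> X * (q / (2 * X)) = q / 2.
    by move=> X0; rewrite invfM mulrCA [X * _]mulrCA mulfV ?mulr1// gt_eqF.
  exists (Num.min (r / (2 * (C * (K + K)))) (1 / (2 * (L * C)))); split.
  - by rewrite lt_min !divr_gt0// !mulr_gt0.
  - rewrite mulrA; apply: (@le_lt_trans _ _ (C * (K + K) * (r / (2 * (C * (K + K)))))).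
      by rewrite ler_wpM2l ?mulr_ge0 ?(ltW C0) ?(ltW KK0)// ge_min lexx.
    by rewrite key ?mulr_gt0// ltr_pdivrMr// ltr_pMr// ltr1n.
  - apply: (@le_trans _ _ (L * C * (1 / (2 * (L * C))))).
      by rewrite ler_wpM2l ?mulr_ge0 ?(ltW C0) ?(ltW L0)// ge_min lexx orbT.
    by rewrite key ?mulr_gt0// mul1r.
(* One step of length eta; the bound on the negative part is halved repeatedly. *)
have step s0 : - a <= s0 <= 0 -> (forall s j, s <= s0 -> 0 <= g s j) ->
    forall s j, s <= Num.min 0 (s0 + eta) -> 0 <= g s j.
  move=> /andP[as0 s00] g0.
  have [s1 [s10 s1e s01 s1E]] : exists s1 : R, [/\ s1 <= 0, s1 <= s0 + eta,
      s0 <= s1 & s1 = Num.min 0 (s0 + eta)].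
    exists (Num.min 0 (s0 + eta)); split=> //.
    - by rewrite ge_min lexx.
    - by rewrite ge_min lexx orbT.
    - by rewrite le_min s00 lerDl ltW.
  rewrite -s1E {s1E}.
  have halve B : 0 <= B <= (K + K) * eta -> (forall s j, s <= s1 -> - B <= g s j) ->
      forall s j, s <= s1 -> - (B / 2) <= g s j.
    move=> /andP[B0 BK] gB s j ss1.
    have [ss0|s0s] := leP s s0.
      by apply: le_trans (g0 s j ss0); rewrite oppr_le0 divr_ge0.
    have LCB : 0 <= L * (C * B) by rewrite mulr_ge0 ?mulr_ge0 ?(ltW L0) ?(ltW C0).
    have subder : sder (g ^~ j) (g' ^~ j) s0 s1.
      move=> t /andP[t1 t2] e e0; have [|d d0 Hd] := dg j t _ e e0.
        by rewrite (le_trans as0 t1) (le_trans t2 s10).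
      exists d => // s' /andP[h1 h2]; apply: Hd.
      by rewrite (le_trans as0 h1) (le_trans h2 s10).
    have bar : forall t, s0 <= t <= s1 -> g t j <= 0 -> - (L * (C * B)) <= g' t j.
      move=> t /andP[t1 t2] gt0; have t0 : t <= 0 by exact: le_trans t2 s10.
      have tat : - a <= t <= 0 by rewrite (le_trans as0 t1).
      (* The maximum is taken after [Dhat] and pulled back by surjectivity, which realises the
         supremum for [leD]. *)
      have [h Hh] := BU_max (Dh (sh v1 t)) (Dh (sh v2 t)).
      have [z Dz] := Dhat_onto admD h.
      have Dsh v q : q <= 0 -> Dh (sh v t) (clip q) = D (sh v (t + q)).
        by move=> q0; rewrite (DhE admD) (sh_sh _ t0 q0).
      have hE q i : q <= 0 ->
          h (clip q) 0 i = Num.max (D (sh v1 (t + q)) 0 i) (D (sh v2 (t + q)) 0 i).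
        move=> q0; apply: (etrans (Hh _ i q0)).
        exact: (f_equal2 (fun A B : V => Num.max (A 0 i) (B 0 i))
          (Dsh v1 q q0) (Dsh v2 q q0)).
      have zE q i : q <= 0 -> D (sh z q) 0 i = Num.max (D (sh v1 (t + q)) 0 i) (D (sh v2 (t + q)) 0 i).
        by move=> q0; rewrite -(hE _ _ q0) -Dz (DhE admD).
      have zv2 : `|z - sh v2 t| <= C * B.
        apply: (le_trans (HC _)); apply: (ler_wpM2l (ltW C0)).
        apply: BU_le => q q0; rewrite (DhB admD) BUBE Dz.
        apply: (row_norm_le B0) => i.
        rewrite !mxE (hE _ _ q0) (Dsh _ _ q0).
        have tq : t + q <= s1 by apply: le_trans t2; rewrite gerDl.
        exact: max_sub B0 (gB (t + q) i tq).
      have CB : C * B < r.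
        by apply: le_lt_trans eta1; rewrite (ler_wpM2l (ltW C0)).
      have Fz : F (sigma t w) (sh v1 t) 0 j <= F (sigma t w) z 0 j.
        apply: F4.
          by apply/leDP => q i q0; rewrite (zE _ _ q0) le_max (sh_sh _ t0 q0) lexx.
        rewrite -[in RHS](sh0 z) (zE _ _ (lexx 0)) addr0 max_l//.
        by move: gt0; rewrite /g subr_le0.
      have := HL t (sigma t w) z (sh v2 t) tat; rewrite mdistxx subrr normr0.
      move=> /(_ r0 (le_lt_trans zv2 CB) r0) FL.
      have := le_trans (row_norm_ub _ j) (le_trans FL (ler_wpM2l (ltW L0) zv2)).
      rewrite !mxE ler_norml => /andP[h1 h2]; rewrite /g'; move: h1 h2 Fz.
      move: (F _ z _ _) (F _ (sh v1 t) _ _) (F _ (sh v2 t) _ _) (L * (C * B)).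
      by move=> p q q' b h1 h2 h3; lra.
    have sI : s0 <= s <= s1 by rewrite ss1 (ltW s0s).
    apply: le_trans (sder_barrier LCB subder (g0 s0 j (lexx _)) bar sI).
    rewrite lerN2; apply: (@le_trans _ _ (L * C * eta * B)); last first.
      by rewrite [leRHS]mulrC (ler_wpM2r B0).
    have ss : s - s0 <= eta by rewrite lerBlDl (le_trans ss1).
    rewrite -!mulrA [B * _]mulrC; apply: (ler_wpM2l (ltW L0)).
    by apply: (ler_wpM2l (ltW C0)); apply: (ler_wpM2r B0).
  have all_n n : forall s j, s <= s1 -> - ((K + K) * eta * 2 ^- n) <= g s j.
    elim: n => [|n IH] s j ss1.
      rewrite expr0 invr1 mulr1; have [ss0|s0s] := leP s s0.
        by apply: le_trans (g0 s j ss0); rewrite oppr_le0 mulr_ge0 ?(ltW eta0) ?(ltW KK0).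
      have sI : - a <= s0 <= s by rewrite as0 (ltW s0s).
      apply: le_trans (glip s0 s j sI (le_trans ss1 s10)).
      rewrite -[leLHS]add0r.
      apply: lerD; first exact: g0.
      rewrite lerN2; apply: (ler_wpM2l (ltW KK0)).
      by rewrite lerBlDl (le_trans ss1).
    have -> : (K + K) * eta * 2 ^- n.+1 = (K + K) * eta * 2 ^- n / 2.
      by rewrite exprS invfM mulrA mulrAC.
    apply: halve => //; apply/andP; split.
      by rewrite mulr_ge0 ?mulr_ge0 ?invr_ge0 ?exprn_ge0 ?(ltW eta0) ?(ltW KK0).
    rewrite ler_piMr//; first by rewrite mulr_ge0 ?(ltW eta0) ?(ltW KK0).
    by rewrite invf_le1 ?exprn_gt0// exprn_ege1// ler1n.
  move=> s j ss1; apply/ler_addgt0Pl => e /(geometric_lt ((K + K) * eta))[n].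
  by move=> /(_ n (leqnn n)) ne; have := all_n n s j ss1; lra.
have steps k : forall s j, s <= Num.min 0 (- a + k%:R * eta) -> 0 <= g s j.
  elim: k => [|k IH] s j.
    by rewrite mul0r addr0 le_min => /andP[_ /past].
  rewrite -natr1 => ss; have := step (Num.min 0 (- a + k%:R * eta)).
  have ke : 0 <= k%:R * eta by rewrite mulr_ge0// ltW.
  apply => //.
    by rewrite le_min ge_min lexx /= andbT oppr_le0 a0 lerDl.
  move: ss; rewrite !le_min => /andP[s00 sk]; rewrite s00 /= addr_minl le_min add0r.
  by apply/andP; split; lra.
apply/leDP => t i t0; rewrite -subr_ge0; apply: (steps (Num.truncn (a / eta)).+1).
rewrite le_min t0 /=; apply: le_trans t0 _; rewrite addrC subr_ge0.
by rewrite -ler_pdivrMr//; apply/ltW; exact: truncnS_gt.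
Qed.

Lemma leD_anti x y : leD D x y -> leD D y x -> x = y.
Proof.
move=> /leDP xy /leDP yx; apply: (Dhat_inj admD); apply: BU_ext => t t0.
rewrite !DhE//; apply/rowP => j; apply/le_anti.
by rewrite xy// yx.
Qed.

Lemma sol_unique w v1 v2 a : 0 <= a -> sol w v1 a -> sol w v2 a ->
  sh v1 (- a) = sh v2 (- a) -> v1 = v2.
Proof.
move=> a0 s1 s2 v12; apply: leD_anti.
  by apply: (comparison a0 s1 s2); rewrite v12.
by apply: (comparison a0 s2 s1); rewrite v12.
Qed.

Lemma leD_limit (u v : nat -> BU) x y (M : R) : cvc u x -> cvc v y ->
  (forall n, `|u n| <= M) -> (forall n, `|v n| <= M) ->
  (forall n, leD D (u n) (v n)) -> leD D x y.
Proof.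
move=> ux vy uM vM uv; apply/leDP => t i t0; apply/ler_addgt0Pl => e e0.
have e20 : 0 < e / 2 by lra.
have [|N1 H1] := D_co_continuous admD (cvc_sh t0 ux) (M := M) _ e20.
  by move=> k; apply: le_trans (sh_norm _ _) (uM _).
have [|N2 H2] := D_co_continuous admD (cvc_sh t0 vy) (M := M) _ e20.
  by move=> k; apply: le_trans (sh_norm _ _) (vM _).
pose n := maxn N1 N2.
have := le_lt_trans (row_norm_ub _ i) (H1 n (leq_maxl _ _)).
have := le_lt_trans (row_norm_ub _ i) (H2 n (leq_maxr _ _)).
have /leDP/(_ t i t0) := uv n.
rewrite !mxE /= !ltr_norml.
by move: (D _ _ _) (D _ _ _) (D _ _ _) (D _ _ _) => p q p' q' h /andP[h1 h2] /andP[h3 h4]; lra.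
Qed.

End comparison.

(** * Existence and continuation of solutions *)

Section solution_operator.
Variables (R : realType) (m : nat) (Omega : metricType R).
Variables (sigma : R -> Omega -> Omega).
Notation V := 'rV[R]_m.
Notation BU := (BU R m).
Variables (D : BU -> V) (F : Omega -> BU -> V).
Hypotheses (flow : continuous_flow sigma) (admD : admissible_D D).
Hypotheses (F1 : hypF1 F) (F2 : hypF2 F) (F4 : hypF4 D F).
Implicit Types (w : Omega) (x y v : BU) (s t a : R).
Notation sol := (sol sigma D F).

Lemma hist_sh (z : R -> V) v a t : (forall s, s <= a -> z s = v (clip (s - a))) ->
  t <= a -> hist z t = sh v (t - a).
Proof.
move=> zv ta; apply: mkBU_eq => p; have p0 := tval_le0 p.
have ta0 : t - a <= 0 by rewrite subr_le0.
rewrite -{2}(Defs.tvalK p) (shE _ ta0 p0) zv; first by rewrite addrAC.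
by rewrite -[leRHS]addr0 lerD.
Qed.

(** [hist] falls back to 0 outside BU, so a solution has to be shown bounded and uniformly
    continuous on its half-line before its histories mean anything. On the past this comes from [x],
    on the rest from compactness. *)
Lemma hist_eval (z : R -> V) x a : 0 <= a -> (forall t, t <= 0 -> z t = x (clip t)) ->
  {within `]-oo, a], continuous z} ->
  forall s, s <= 0 -> hist z a (clip s) = z (a + s).
Proof.
move=> a0 zx cz; pose f s := z (a + s).
have zseq (s_ : nat -> R) s : cvd (fun p q : R => `|p - q|) s_ s ->
    (forall n, s_ n <= a) -> s <= a ->
    cvd (fun p q : V => `|p - q|) (z \o s_) (z s).
  move=> ss s_a sa; apply: (within_seq cz); first by rewrite /= in_itv.
    by move=> n; rewrite /= in_itv /= s_a.
  by move=> e /ss[N HN]; exists N => n /HN; rewrite -ball_normE.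
have [M zM] : exists M, forall t, t <= a -> `|z t| <= M.
  apply: contrapT => /forallNP H.
  have H' n : exists t, [/\ 0 <= t, t <= a & n%:R < `|z t|].
    have /existsNP[t /not_implyP[ta /negP]] := H (Num.max `|x| n%:R).
    rewrite -ltNge gt_max => /andP[xt nt]; exists t; split=> //.
    rewrite leNgt; apply/negP => /ltW t0; move: xt; rewrite zx// ltNge BU_ub//.
  have [t_ Ht] := choice H'.
  have [n|k hk [t /andP[t0 ta] tt]] := @segment_extract R 0 a t_.
    by have [-> ->] := Ht n.
  have [n|N /(_ _ (leq_maxl N _)) HN] := zseq _ t tt _ ta 1 ltr01.
    by have [] := Ht (k n).
  pose n := maxn N (Num.truncn (`|z t| + 1)).+1.
  have [_ _] := Ht (k n); apply/negP; rewrite -leNgt.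
  have nk : `|z t| + 1 <= (k n)%:R.
    apply: le_trans (ltW (truncnS_gt _)) _; rewrite ler_nat.
    by apply: leq_trans (hk n); exact: leq_maxr.
  apply: le_trans nk; rewrite -lerBlDl.
  apply: le_trans (lerB_dist _ _) _; rewrite distrC; apply/ltW; exact: HN.
apply: ofRE.
  by exists M => s s0; apply: zM; rewrite gerDl.
move=> e e0; apply: contrapT => /forall2NP H.
have H' n : exists p : R * R, [/\ p.1 <= a, p.2 <= a, `|p.1 - p.2| < n.+1%:R^-1 &
    e <= `|z p.1 - z p.2|].
  have [/negP|/existsNP[s /existsNP[t]]] := H n.+1%:R^-1.
    by rewrite invr_gt0 ltr0Sn.
  move=> /not_implyP[s0 /not_implyP[t0 /not_implyP[st /negP]]].
  rewrite -leNgt => est; exists (a + s, a + t); split=> //=.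
  - by rewrite gerDl.
  - by rewrite gerDl.
  - by rewrite opprD addrACA subrr add0r.
have [p Hp] := choice H'.
have [d d0 Hd] := BU_uc x e0; have [N HN] := invS_lt d0.
(* The two points are less than 1 apart; if the first were below -1, both would lie in the past,
   where the uniform continuity of [x] excludes the pair. *)
have near0 n : - 1 <= (p (n + N)%N).1 <= a.
  have [pa qa pq pe] := Hp (n + N)%N; rewrite pa andbT.
  rewrite leNgt; apply/negP => p1.
  have n1 : (n + N).+1%:R^-1 <= 1 :> R by rewrite invf_le1 ?ltr0Sn// ler1n.
  have q0 : (p (n + N)%N).2 <= 0.
    have := lt_le_trans pq n1; rewrite ltr_norml => /andP[h _].
    by move: p1 h; move: (p _) => [q1 q2] /=; lra.
  have p0 : (p (n + N)%N).1 <= 0 by apply: le_trans (ltW p1) _; rewrite oppr_le0.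
  move: pe; rewrite leNgt => /negP; apply; rewrite !zx//; apply: Hd.
  by apply: lt_trans pq (HN _ _); exact: leq_addl.
have [k hk [s /andP[s1 sa] ss]] := segment_extract near0.
have qq : cvd (fun p q : R => `|p - q|) (fun n => (p (k n + N)%N).2) s.
  move=> g g0; have g20 : 0 < g / 2 by lra.
  have [N1 H1] := ss _ g20; have [N2 H2] := invS_lt g20.
  exists (maxn N1 N2) => n; rewrite geq_max => /andP[n1 n2].
  have [_ _ pq _] := Hp (k n + N)%N.
  have := H1 n n1; have := lt_trans pq (H2 _ (leq_trans n2 (leq_trans (hk n) (leq_addr _ _)))).
  rewrite /= => h1 h2; have := ler_distD (p (k n + N)%N).1 s (p (k n + N)%N).2; lra.
have e20 : 0 < e / 2 by lra.
have [n|N1 H1] := zseq _ _ ss _ sa _ e20; first by have [] := Hp (k n + N)%N.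
have [n|N2 H2] := zseq _ _ qq _ sa _ e20; first by have [] := Hp (k n + N)%N.
have := H1 _ (leq_maxl N1 N2); have := H2 _ (leq_maxr N1 N2) => /= h2 h1.
have [_ _ _] := Hp (k (maxn N1 N2) + N)%N; apply/negP; rewrite -ltNge.
rewrite (splitr e); apply: le_lt_trans (ler_distD (z s) _ _) _.
by rewrite ltrD// distrC.
Qed.

Lemma cvg_quotient (g : R -> V) (A : set R) (c : V) t :
  (h^-1 *: (g (t + h) - g t) @[h --> within [set h | A (t + h)] 0^'] --> c) <->
  (forall e, 0 < e -> exists2 d : R, 0 < d & forall t', A t' -> `|t' - t| < d ->
    `|g t' - g t - (t' - t) *: c| <= e * `|t' - t|).
Proof.
split.
  move=> /cvgrPdist_le H e e0.
  have H' : nbhs (0 : R) (fun h => h != 0 -> A (t + h) ->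
    `|c - h^-1 *: (g (t + h) - g t)| <= e) := H e e0.
  have /nbhs_ballP[d /= d0 Hd] := H'; exists d => // t' At td.
  have [->|tt'] := eqVneq t' t; first by rewrite !subrr scale0r subr0 !normr0 mulr0.
  have h0 : t' - t != 0 by rewrite subr_eq0.
  have bd : ball (0 : R) d (t' - t) by rewrite -ball_normE /= sub0r normrN.
  have := Hd _ bd h0; rewrite [t + _]addrC subrK => /(_ At) He.
  have -> : g t' - g t - (t' - t) *: c =
      - ((t' - t) *: (c - (t' - t)^-1 *: (g t' - g t))).
    by rewrite scalerBr scalerA mulfV// scale1r opprB.
  by rewrite normrN normrZ mulrC ler_wpM2r.
move=> H; apply/cvgrPdist_le => e e0; have [d d0 Hd] := H e e0.
suff : nbhs (0 : R) (fun h => h != 0 -> A (t + h) ->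
    `|c - h^-1 *: (g (t + h) - g t)| <= e) by [].
apply/nbhs_ballP; exists d => // h; rewrite -ball_normE /= sub0r normrN => hd h0 At.
have th : t + h - t = h by rewrite addrAC subrr add0r.
have := Hd _ At; rewrite th => /(_ hd) He.
have -> : c - h^-1 *: (g (t + h) - g t) = - (h^-1 *: (g (t + h) - g t - h *: c)).
  by rewrite [in RHS]scalerBr scalerA mulVf// scale1r opprB.
rewrite normrN normrZ normfV ler_pdivrMl ?normr_gt0//.
by rewrite mulrC.
Qed.

Lemma is_solution_sol w x a z : 0 <= a -> is_solution sigma D F w x a z ->
  sol (sigma a w) (hist z a) a /\ sh (hist z a) (- a) = x.
Proof.
move=> a0 [zx cz dz].
have zx' t : t <= 0 -> z t = x (clip t) by move=> t0; rewrite -zx clipK.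
have he := hist_eval a0 zx' cz.
have zv s : s <= a -> z s = hist z a (clip (s - a)).
  by move=> sa; rewrite he ?subr_le0// addrC subrK.
have hs t := @hist_sh z (hist z a) a t zv.
split; last first.
  apply: BU_ext => t t0; rewrite shE ?oppr_le0// he; last by rewrite addrC subr_le0 (le_trans t0 a0).
  by rewrite addrA subrr add0r zx'.
move=> s /andP[as_ s0] e e0.
have ta : 0 <= s + a <= a by rewrite -lerBlDr sub0r as_ gerDr s0.
have := dz _ ta; rewrite (@cvg_quotient (fun t => D (hist z t)) [set t | 0 <= t <= a]).
move=> /(_ e e0)[d d0 Hd]; exists d => // s' /andP[as' s'0] sd.
have ta' : 0 <= s' + a <= a by rewrite -lerBlDr sub0r as' gerDr s'0.
have ss : s' + a - (s + a) = s' - s by rewrite opprD addrACA subrr addr0.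
have := Hd _ ta'; rewrite ss => /(_ sd).
have E1 : hist z (s' + a) = sh (hist z a) s' by rewrite hs ?gerDr// addrK.
have E2 : hist z (s + a) = sh (hist z a) s by rewrite hs ?gerDr// addrK.
by rewrite E1 E2 (sigmaD flow).
Qed.

Lemma sol_is_solution w v a : 0 <= a -> sol (sigma a w) v a ->
  is_solution sigma D F w (sh v (- a)) a (fun t => v (clip (t - a))).
Proof.
move=> a0 sv; pose z t := v (clip (t - a)).
have Na0 : - a <= 0 by rewrite oppr_le0.
have hs t : t <= a -> hist z t = sh v (t - a) by apply: hist_sh.
split.
- move=> p; rewrite -{2}(Defs.tvalK p) (shE _ Na0 (tval_le0 p)).
  by rewrite [in RHS]addrC.
- apply: continuous_subspaceT => t; apply/cvgrPdist_lt => e e0.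
  have [d d0 Hd] := BU_uc v e0; exists d => // s /= st; apply: Hd.
  by rewrite opprB addrA subrK.
- move=> t ta; have /andP[t0 ta1] := ta.
  rewrite (@cvg_quotient (fun t => D (hist z t)) [set t | 0 <= t <= a]).
  move=> e e0; have sI : - a <= t - a <= 0.
    by rewrite subr_le0 ta1 andbT -[leLHS]add0r lerD.
  have [d d0 Hd] := sv _ sI e e0; exists d => // t' /andP[t'0 t'a] td.
  have sI' : - a <= t' - a <= 0.
    by rewrite subr_le0 t'a andbT -[leLHS]add0r lerD.
  have ss : t' - a - (t - a) = t' - t by rewrite opprB addrA subrK.
  have := Hd _ sI'; rewrite ss => /(_ td).
  by rewrite (hs _ ta1) (hs _ t'a) (sigmaD flow) subrK.
Qed.

Lemma u_spec w x t : 0 <= t -> u_defined sigma D F t w x ->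
  sol (sigma t w) (u sigma D F t w x) t /\ sh (u sigma D F t w x) (- t) = x.
Proof.
move=> t0 [z Hz]; apply: (is_solution_sol t0).
have ex : exists z, [set z | is_solution sigma D F w x t z] z by exists z.
exact: (xgetPex (fun s => x (clip s)) ex).
Qed.

(** Uniqueness makes the choice inside [u] harmless: a history that solves the equation on the
    window is the value of [u] at its own earlier state. *)
Lemma u_eq w v t : 0 <= t -> sol (sigma t w) v t ->
  u_defined sigma D F t w (sh v (- t)) /\ u sigma D F t w (sh v (- t)) = v.
Proof.
move=> t0 sv; have ud : u_defined sigma D F t w (sh v (- t)).
  by eexists; exact: sol_is_solution.
split=> //; have [su ue] := u_spec t0 ud.
exact: (sol_unique flow admD F1 F2 F4 t0 su sv ue).
Qed.

End solution_operator.

Section antiderivatives.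
Variable R : realType.

Lemma antiderivative (f : R -> R) (a b : R) : continuous f ->
  exists G : R -> R, sder G f a b.
Proof.
move=> cf; pose mu := @lebesgue_measure R.
(* Starting at [a - 1], and ending at [b + 1] below, makes every point of the interval interior,
   endpoints included. *)
pose G x := \int[mu]_(t in `[a - 1, x]) f t; exists G.
apply: is_derive_sder => s /andP[as_ sb].
have [dG GE] : derivable G s 1 /\ derive1 G s = f s.
  apply: (@continuous_FTC1_closed R f (a - 1) s (b + 1)); last exact: cf.
  - by rewrite (le_lt_trans sb)// ltrDl.
  - apply: continuous_compact_integrable; first exact: segment_compact.
    exact: continuous_subspaceT.
  - by apply: lt_le_trans as_; rewrite ltrBlDr ltrDl.
by apply: DeriveDef; [exact: dG|rewrite -derive1E; exact: GE].
Qed.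

Lemma sder_expR (l c k a b : R) : l != 0 ->
  sder (fun s => c / l * expR (l * (s - k))) (fun s => c * expR (l * (s - k))) a b.
Proof.
move=> l0; apply: is_derive_sder => s _.
have h : is_derive s 1 (fun s => l * (s - k)) l.
  have -> : (fun s => l * (s - k)) = l *: (@id R - cst k).
    by apply/funext => t.
  by apply: is_derive_eq; rewrite subr0 /GRing.scale /= mulr1.
have := is_deriveZ (c / l) (@is_derive1_comp R expR (fun s => l * (s - k)) s _ _
  (is_derive_expR (l * (s - k))) h).
move=> /is_derive_eq; apply; rewrite /GRing.scale /=.
by rewrite [expR _ * l]mulrC mulrA divfK.
Qed.

End antiderivatives.

(** * Picard iteration and dependence on the base point *)

Section continuation.
Variables (R : realType) (m : nat) (Omega : metricType R).
Variables (sigma : R -> Omega -> Omega).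
Notation V := 'rV[R]_m.
Notation BU := (BU R m).
Variables (D : BU -> V) (F : Omega -> BU -> V).
Hypotheses (flow : continuous_flow sigma) (admD : admissible_D D).
Hypotheses (F1 : hypF1 F) (F2 : hypF2 F) (F3 : hypF3 F).
Implicit Types (w : Omega) (x y v : BU) (s t a : R).
Notation Dh := (Dhat D).
Notation sol := (sol sigma D F).

Let F_path_continuous w x : continuous (fun s => F (sigma s w) (sh x (Num.min s 0))).
Proof.
move=> s; have [cF _] := F1.
have c1 : sigma t w @[t --> s] --> sigma s w.
  have [cs _ _] := flow; apply: continuous2_cvg (cs (s, w)) _ _; first exact: cvg_id.
  exact: cvg_cst.
have c2 : sh x (Num.min t 0) @[t --> s] --> sh x (Num.min s 0).
  apply/cvgrPdist_le => e e0; have [d d0 Hd] := sh_uc x e0.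
  exists d => // t /= st; apply: Hd; rewrite ?ge_min ?lexx ?orbT//.
  exact: le_lt_trans (clip_lip s t) st.
by apply: (@continuous2_cvg _ _ _ _ _ _ _ _ F) c1 c2; exact: (cF (sigma s w, sh x (Num.min s 0))).
Qed.

(** The neutral equation prescribes [D] of the histories, not the function itself. The iterate is
    obtained by inverting [Dhat] on the past values of [D], frozen after [- a], plus the primitive
    of [F] along [x], started at [- a]. *)
Lemma picard_step w x a : 0 <= a -> exists y, sh y (- a) = sh x (- a) /\
  der_on (fun s => D (sh y s)) (fun s => F (sigma s w) (sh x s)) (- a) 0.
Proof.
move=> a0; have Na0 : - a <= 0 by rewrite oppr_le0.
pose f s := F (sigma s w) (sh x (Num.min s 0)).
have fE s : s <= 0 -> f s = F (sigma s w) (sh x s) by move=> s0; rewrite /f min_l.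
have fj j : continuous (fun s => f s 0 j).
  move=> s; apply/cvgrPdist_lt => e e0.
  have /cvgrPdist_lt/(_ e e0) [d /= d0 Hd] := @F_path_continuous w x s.
  exists d => // t st; apply: le_lt_trans (Hd t st).
  by apply: le_trans (row_norm_ub _ j); rewrite !mxE.
have [G HG] := choice (fun j => antiderivative (- a) 0 (fj j)).
pose g s : V := \row_j G j s.
have dg : der_on g f (- a) 0.
  apply: der_on_row => j s sa e e0; have [d d0 Hd] := HG j s sa e e0.
  by exists d => // s' s'a sd; rewrite !mxE; exact: Hd.
have x1 : 0 < `|x| + 1 by rewrite ltr_wpDl.
have [K HK] := F2 x1.
have glip s t : - a <= s <= 0 -> - a <= t <= 0 -> `|g t - g s| <= `|K| * `|t - s|.
  move=> sa ta; have := mean_value_near sa ta dg (c := 0) (K := `|K|).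
  rewrite scaler0 subr0; apply => r /andP[_ r0] _; rewrite subr0 (fE _ r0).
  apply: le_trans (HK _ _ _) (ler_norm _); rewrite /cball /=.
  by apply: le_trans (sh_norm _ _) _; rewrite lerDl.
pose cl s := Num.max s (- a).
have clI s : s <= 0 -> - a <= cl s <= 0.
  by move=> s0; rewrite /cl le_max lexx orbT ge_max s0.
have cllip s t : `|cl s - cl t| <= `|s - t|.
  have := ler_norm (s - t); have := ler_norm (t - s); rewrite distrC ler_norml /cl /Num.max.
  move: `|_| => M h1 h2.
  by have [h3|h3] := ltP s (- a); have [h4|h4] := ltP t (- a); apply/andP; split; lra.
have [k kE] : exists k : BU, forall s, s <= 0 -> k (clip s) = g (cl s) - g (- a).
  exists (ofR (fun s => g (cl s) - g (- a))) => s s0.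
  apply: (@ofRE _ _ (fun s => g (cl s) - g (- a))) s0.
    exists (`|K| * a) => t t0.
    have aI : - a <= - a <= 0 by rewrite lexx.
    apply: le_trans (glip _ _ aI (clI t t0)) _; rewrite ler_wpM2l//.
    have /andP[c1 c2] := clI t t0; rewrite ger0_norm; lra.
  move=> e e0; exists (e / (`|K| + 1)); first by rewrite divr_gt0// ltr_wpDl.
  move=> p q p0 q0 pq; rewrite opprB addrA subrK.
  apply: le_lt_trans (glip _ _ (clI q q0) (clI p p0)) _.
  apply: (@le_lt_trans _ _ ((`|K| + 1) * `|p - q|)).
    by apply: ler_pM => //; rewrite lerDl.
  by rewrite mulrC -ltr_pdivlMr// ltr_wpDl.
pose past := reparam (Dh x) (fun s => Num.min s (- a)).
have pastE s : s <= 0 -> past (clip s) = D (sh x (Num.min s (- a))).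
  move=> s0; rewrite -(DhE admD) reparamE// => p q _ _ /=.
  have := ler_norm (p - q); have := ler_norm (q - p); rewrite distrC ler_norml /Num.min.
  move: `|_| => M h1 h2.
  by have [h3|h3] := ltP p (- a); have [h4|h4] := ltP q (- a); apply/andP; split; lra.
have [y Dy] := Dhat_onto admD (past + k).
have HD s : s <= 0 -> D (sh y s) = D (sh x (Num.min s (- a))) + (g (cl s) - g (- a)).
  by move=> s0; rewrite -(DhE admD) Dy BUDE (pastE _ s0) (kE _ s0).
exists y; split.
  apply: (Dhat_ext admD) => s s0.
  have sa : s - a <= - a by rewrite gerDr.
  have sa0 : s - a <= 0 by exact: le_trans sa Na0.
  rewrite !(sh_sh _ Na0 s0) [- a + s]addrC (HD _ sa0).
  by rewrite min_l// /cl max_r// subrr addr0.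
move=> s sa e e0; have [d d0 Hd] := dg s sa e e0.
exists d; first exact: d0.
move=> s' s'a sd; have /andP[as_ s0] := sa; have /andP[as' s'0] := s'a.
rewrite (HD _ s0) (HD _ s'0) /cl !max_l// !min_r// -(fE _ s0).
have -> : D (sh x (- a)) + (g s' - g (- a)) - (D (sh x (- a)) + (g s - g (- a))) = g s' - g s.
  by rewrite opprD addrACA subrr add0r opprB addrA subrK.
exact: Hd.
Qed.

(* [psi] is an antiderivative of a bound on [|f - f'|], so that no integral appears. *)
Lemma picard_estimate : exists2 C : R, 0 < C & forall y y' (f f' : R -> V) (psi psi' : R -> R) a,
  sh y (- a) = sh y' (- a) -> 0 <= a ->
  der_on (fun s => D (sh y s)) f (- a) 0 ->
  der_on (fun s => D (sh y' s)) f' (- a) 0 ->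
  sder psi psi' (- a) 0 ->
  (forall s, - a <= s <= 0 -> `|f s - f' s| <= psi' s) ->
  forall s, - a <= s <= 0 -> `|sh y s - sh y' s| <= C * (psi s - psi (- a)).
Proof.
have [C C0 HC] := Dhat_lower_dist admD; exists C; first exact: C0.
move=> y y' f f' psi psi' a yy a0 df df' dpsi ff s /andP[as_ s0].
have Na0 : - a <= 0 by rewrite oppr_le0.
have sub p q : - a <= p -> p <= q -> q <= 0 -> sder psi psi' p q.
  move=> ap pq q0 r /andP[pr rq] e e0.
  have [|d d0 Hd] := dpsi r _ e e0; first by rewrite (le_trans ap pr) (le_trans rq q0).
  by exists d => // r' /andP[pr' r'q]; apply: Hd; rewrite (le_trans ap pr') (le_trans r'q q0).
have psi_mono p q : - a <= p -> p <= q -> q <= 0 -> psi p <= psi q.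
  move=> ap pq q0; apply: (sder_nondecreasing pq (sub p q ap pq q0)) => r /andP[pr rq].
  by apply: le_trans (ff r _); rewrite ?normr_ge0// (le_trans ap pr) (le_trans rq q0).
apply: HC => q q0; rewrite !(sh_sh _ s0 q0).
have sq0 : s + q <= 0 by rewrite -[leRHS]addr0 lerD.
have psi0 : 0 <= psi s - psi (- a) by rewrite subr_ge0; apply: psi_mono.
have [sqa|asq] := leP (s + q) (- a).
  have sqa0 : s + q + a <= 0 by rewrite -lerBrDr sub0r.
  have E : s + q = - a + (s + q + a) by rewrite addrCA addNr addr0.
  by rewrite E -!(sh_sh _ Na0 sqa0) yy subrr normr0.
have := mean_value_le (ltW asq) (der_on_sub (lexx _) sq0 (der_onB df df'))
  (sub _ _ (lexx _) (ltW asq) sq0) => /(_ _)/le_trans H.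
have E0 : D (sh y (- a)) - D (sh y' (- a)) = 0 by rewrite yy subrr.
rewrite -[X in `|X|]subr0 -E0.
apply: H => [r /andP[ar rs]|]; first by apply: ff; rewrite ar (le_trans rs sq0).
by rewrite lerD2r; apply: psi_mono; rewrite ?(ltW asq)// gerDl.
Qed.

(** Existence and closeness over nearby base points come together: the Picard iteration over [w']
    starts from the solution [v] over [w], whose defect is small, and converges without leaving the
    Lipschitz tube of [v]. *)
Lemma continuation w v a (e : R) : 0 <= a -> sol w v a -> 0 < e ->
  exists2 d : R, 0 < d & forall w', mdist w w' < d ->
    exists v', [/\ sh v' (- a) = sh v (- a), sol w' v' a & `|v' - v| <= e].
Proof.
move=> a0 sv e0.
have [r r0 [L L0 HL]] := lipschitz_tube flow F1 w v a.
have [C C0 HC] := picard_estimate.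
(* Integrating the weight [expR (l * s)] gains the factor [1 / l], so with this [l] each iteration
   halves the weighted increment; [E] bounds the weight on [[-a, 0]]. *)
pose l := 2 * (C * L); have l0 : 0 < l by rewrite !mulr_gt0.
pose E := expR (l * a); have E0 : 0 < E by exact: expR_gt0.
have E1 s : s <= 0 -> expR (l * (s - - a)) <= E.
  move=> s0; rewrite ler_expR ler_wpM2l ?(ltW l0)// opprK.
  by rewrite -[leRHS]add0r lerD2r.
have E2 s : - a <= s -> 1 <= expR (l * (s - - a)).
  move=> as_; rewrite -expR0 ler_expR; apply: mulr_ge0 (ltW l0) _.
  by rewrite subr_ge0.
have [eps [eps0 epsr epse]] : exists eps : R, [/\ 0 < eps, eps < r & eps <= e].
  exists (Num.min (r / 2) e); split.
  - by rewrite lt_min e0 andbT divr_gt0.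
  - by rewrite gt_min ltr_pdivrMr// ltr_pMr// ltr1n.
  - by rewrite ge_min lexx orbT.
(* The increments [A * E * 2 ^- k] sum to [2 * (A * E)], the total displacement allowed. Next, [th]
   bounds the defect of [v] over [w'] so that the first increment is at most [A]. *)
have [A [A0 AE]] : exists A : R, 0 < A /\ 2 * (A * E) = eps.
  exists (eps / 2 / E); split; first by rewrite !divr_gt0.
  by rewrite divfK ?gt_eqF// mulrC divfK.
have [th [th0 thA]] : exists th : R, 0 < th /\ C * (th * a) <= A.
  have Ca : 0 < C * a + 1 by rewrite ltr_wpDl// mulr_ge0// ltW.
  exists (A / (C * a + 1)); split; first by rewrite divr_gt0.
  rewrite mulrCA mulrAC ler_pdivrMr//; apply: (ler_wpM2l (ltW A0)).
  by rewrite lerDl.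
have [d d0 Hd] : exists2 d : R, 0 < d & forall w', mdist w w' < d ->
    forall s, - a <= s <= 0 -> mdist (sigma s w) (sigma s w') < r /\
      `|F (sigma s w') (sh v s) - F (sigma s w) (sh v s)| <= th.
  apply: contrapT => /forall2NP H.
  have H' k : exists p : Omega * R, [/\ mdist w p.1 < k.+1%:R^-1, - a <= p.2 <= 0 &
      ~ (mdist (sigma p.2 w) (sigma p.2 p.1) < r /\
      `|F (sigma p.2 p.1) (sh v p.2) - F (sigma p.2 w) (sh v p.2)| <= th)].
    have [/negP|] := H k.+1%:R^-1; first by rewrite invr_gt0 ltr0Sn.
    move=> /existsNP[w' /not_implyP[ww' /existsNP[s /not_implyP[sa ns]]]].
    by exists (w', s).
  have [p Hp] := choice H'.
  have [n|f hf [s /andP[as_ s0] fs]] := @segment_extract R (- a) 0 (fun k => (p k).2).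
    by case: (Hp n).
  have ww : cvd mdist (fun n => (p (f n)).1) w.
    have ww1 : cvd mdist (fun n => (p n).1) w by apply: cvd_inv => k; case: (Hp k).
    exact: (cvd_extract hf ww1).
  have cw := cvd_cst (mdistxx w).
  have s1 := sigma_seq flow fs ww; have s2 := sigma_seq flow fs cw.
  have fs0 n : (p (f n)).2 <= 0 by case: (Hp (f n)) => _ /andP[].
  have s3 := sh_seq fs0 s0 (@cvc_cst _ _ v) fs.
  have vM n : `|sh v (p (f n)).2| <= `|v| by exact: sh_norm.
  have th20 : 0 < th / 2 by rewrite divr_gt0.
  have r20 : 0 < r / 2 by rewrite divr_gt0.
  have [N1 H1] := F_seq F3 s1 s3 vM th20.
  have [N2 H2] := F_seq F3 s2 s3 vM th20.
  have [N3 H3] := s1 _ r20; have [N4 H4] := s2 _ r20.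
  pose n := maxn (maxn N1 N2) (maxn N3 N4).
  have n1 : (N1 <= n)%N by rewrite /n !leq_max leqnn.
  have n2 : (N2 <= n)%N by rewrite /n !leq_max leqnn !orbT.
  have n3 : (N3 <= n)%N by rewrite /n !leq_max leqnn !orbT.
  have n4 : (N4 <= n)%N by rewrite /n !leq_max leqnn !orbT.
  have [_ _ ns] := Hp (f n); apply: ns; split.
    rewrite (splitr r); apply: le_lt_trans (metric_triangle _ (sigma s w) _) _.
    by rewrite metric_sym; apply: ltrD; [exact: H4|exact: H3].
  rewrite (splitr th); apply: le_trans (ler_distD (F (sigma s w) (sh v s)) _ _) _.
  by rewrite distrC; apply: lerD; apply: ltW; [exact: H1|exact: H2].
exists d => // w' /Hd {}Hd.
have [stp Hstp] := choice (fun x => picard_step w' x a0).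
pose u k := iter k stp v.
have ush k : sh (u k) (- a) = sh v (- a).
  by elim: k => [//|k IH]; rewrite -IH; case: (Hstp (u k)).
have ud k : der_on (fun s => D (sh (u k.+1) s)) (fun s => F (sigma s w') (sh (u k) s)) (- a) 0.
  by case: (Hstp (u k)).
pose ex s := expR (l * (s - - a)).
have p2 k : 0 < 2 ^- k :> R by rewrite invr_gt0 exprn_gt0.
(* The two bounds are proved together: the second keeps both iterates in the tube, where the
   Lipschitz estimate behind the first is valid. *)
have main k : (forall s, - a <= s <= 0 -> `|sh (u k.+1) s - sh (u k) s| <= A * 2 ^- k * ex s) /\
    (forall s, - a <= s <= 0 -> `|sh (u k) s - sh v s| <= 2 * (A * E) * (1 - 2 ^- k)).
  elim: k => [|k [IH1 IH2]]; split => s sa; have /andP[as_ s0] := sa.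
  - have := HC (u 1%N) v _ _ (fun s => th * (s - 0)) (fun=> th) a (ush 1%N) a0 (ud 0%N) sv
      (@sder_linear _ th 0 _ _) (fun s sa => (Hd s sa).2) s sa.
    move=> /le_trans; apply; rewrite !subr0 -mulrBr opprK expr0 invr1 mulr1.
    apply: (@le_trans _ _ A); last by rewrite ler_peMr ?(ltW A0)// E2.
    apply: le_trans thA; apply: (ler_wpM2l (ltW C0)); apply: (ler_wpM2l (ltW th0)).
    by rewrite -[leRHS]add0r lerD2r.
  - by rewrite /= subrr normr0 expr0 invr1 subrr mulr0.
  - have Fdiff q : - a <= q <= 0 ->
        `|F (sigma q w') (sh (u k.+1) q) - F (sigma q w') (sh (u k) q)| <=
        L * (A * 2 ^- k) * ex q.
      move=> qa; have /andP[aq q0] := qa.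
      have b2 : `|sh (u k) q - sh v q| < r.
        apply: le_lt_trans (IH2 q qa) _; rewrite AE; apply: le_lt_trans epsr.
        by rewrite ler_piMr ?(ltW eps0)// gerBl ltW.
      have b1 : `|sh (u k.+1) q - sh v q| < r.
        apply: le_lt_trans (ler_distD (sh (u k) q) _ _) _.
        apply: le_lt_trans (lerD (IH1 q qa) (IH2 q qa)) _.
        apply: (@le_lt_trans _ _ (A * E * 2 ^- k + 2 * (A * E) * (1 - 2 ^- k))).
          by rewrite lerD2r mulrAC; apply: (ler_wpM2r (ltW (p2 k))); rewrite ler_wpM2l ?(ltW A0)// E1.
        apply: le_lt_trans epsr; rewrite -AE.
        have := mulr_ge0 (mulr_ge0 (ltW A0) (ltW E0)) (ltW (p2 k)); lra.
      have := HL q (sigma q w') _ _ qa (Hd q qa).1 b1 b2; move=> /le_trans; apply.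
      by rewrite -mulrA; apply: (ler_wpM2l (ltW L0)); exact: IH1.
    have := HC (u k.+2) (u k.+1) _ _ _ _ a (etrans (ush _) (esym (ush _))) a0 (ud k.+1) (ud k)
      (@sder_expR _ l (L * (A * 2 ^- k)) (- a) _ _ (lt0r_neq0 l0)) Fdiff s sa.
    move=> /le_trans; apply.
    have cl : C * (L * (A * 2 ^- k) / l) = A * 2 ^- k.+1.
      have -> : 2 ^- k.+1 = 2 ^- k / 2 :> R by rewrite exprS invfM mulrC.
      by rewrite /l; move: (2 ^- k) => q; field; rewrite !gt_eqF.
    rewrite -mulrBr [C * (_ * _)]mulrA cl; apply: ler_wpM2l.
      by rewrite mulr_ge0 ?(ltW A0)// ltW.
    by rewrite gerBl expR_ge0.
  - apply: le_trans (ler_distD (sh (u k) s) _ _) _.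
    apply: le_trans (lerD (IH1 s sa) (IH2 s sa)) _.
    apply: (@le_trans _ _ (A * E * 2 ^- k + 2 * (A * E) * (1 - 2 ^- k))).
      by rewrite lerD2r mulrAC; apply: (ler_wpM2r (ltW (p2 k))); rewrite ler_wpM2l ?(ltW A0)// E1.
    have -> : 2 ^- k.+1 = 2 ^- k / 2 :> R by rewrite exprS invfM mulrC.
    move: (2 ^- k) (A * E) => q B; lra.
have Z : - a <= 0 <= (0 : R) by apply/andP; split; [rewrite oppr_le0|exact: lexx].
have uu k : `|u k.+1 - u k| <= A * E * 2 ^- k.
  have := (main k).1 0 Z; rewrite !sh0 => /le_trans; apply.
  by rewrite [leRHS]mulrAC; apply: ler_wpM2l; [rewrite mulr_ge0 ?(ltW A0)// ltW|exact: E1].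
have [v' Hv'] := BU_geometric uu.
have uv k : `|v' - u k| <= eps * 2 ^- k by rewrite -AE; exact: Hv'.
have shuv k s : s <= 0 -> `|sh v' s - sh (u k) s| <= eps * 2 ^- k.
  by move=> s0; rewrite -(shB _ _ s0); apply: le_trans (sh_norm _ _) (uv k).
have Na0 : - a <= 0 by rewrite oppr_le0.
have vv : `|v' - v| <= eps.
  by have := uv 0%N; rewrite expr0 invr1 mulr1.
exists v'; split; last exact: le_trans vv epse.
- apply/eqP; rewrite -subr_eq0 -normr_le0; apply/ler_addgt0Pl => g g0.
  have [k /(_ k (leqnn k)) Hk] := geometric_lt eps g0.
  by rewrite addr0 -(ush k); apply: le_trans (shuv k _ Na0) (ltW Hk).
apply: (der_on_limit ud).
  move=> s /andP[_ s0] g g0; have [B B0 HB] := D_bounded admD.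
  have [N HN] := geometric_lt (B * eps) g0.
  exists N => n Nn; rewrite -(DB admD); apply: le_lt_trans (HB _) _.
  apply: le_lt_trans (HN n.+1 (leqW Nn)); rewrite -mulrA.
  by apply: (ler_wpM2l (ltW B0)); exact: shuv.
move=> s /andP[as_ s0] g g0; have g20 : 0 < g / 2 by rewrite divr_gt0.
have /cvgrPdist_lt/(_ _ g20)[q /= q0 Hq] := @F_path_continuous w' v' s.
have [N HN] := geometric_lt (L * eps) g20.
exists q => //; exists N => n t Nn ta ts; have /andP[_ t0] := ta.
have b1 : `|sh v' t - sh v t| < r.
  by rewrite -(shB _ _ t0); apply: le_lt_trans (sh_norm _ _) (le_lt_trans vv epsr).
have b2 : `|sh (u n) t - sh v t| < r.
  apply: le_lt_trans ((main n).2 t ta) _; rewrite AE; apply: le_lt_trans epsr.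
  by rewrite ler_piMr ?(ltW eps0)// gerBl ltW.
rewrite (splitr g); apply: le_trans (ler_distD (F (sigma t w') (sh v' t)) _ _) _.
apply: lerD.
  apply: le_trans (HL t (sigma t w') _ _ ta (Hd t ta).1 b2 b1) _.
  rewrite distrC; apply: ltW; apply: le_lt_trans (HN n Nn); rewrite -mulrA.
  by apply: (ler_wpM2l (ltW L0)); exact: shuv.
have ts' : `|s - t| < q by rewrite distrC.
have := Hq t ts'; rewrite (min_l s0) (min_l t0) distrC; exact: ltW.
Qed.

End continuation.

(** * Invariant families and limit sets *)

Section invariant_families.
Variables (R : realType) (m : nat) (Omega : metricType R).
Variables (sigma : R -> Omega -> Omega).
Notation V := 'rV[R]_m.
Notation BU := (BU R m).
Variables (D : BU -> V) (F : Omega -> BU -> V).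
Hypotheses (flow : continuous_flow sigma) (admD : admissible_D D).
Hypotheses (F1 : hypF1 F) (F2 : hypF2 F) (F3 : hypF3 F) (F4 : hypF4 D F).
Hypotheses (compactO : compact [set: Omega]) (minO : minimal_flow sigma).
Implicit Types (w : Omega) (x y v : BU) (s t a e d : R).
Implicit Types (K : Omega -> BU -> Prop).
Notation sol := (sol sigma D F).

Lemma mdist_seq_unique (w_ : nat -> Omega) w w' : cvd mdist w_ w -> cvd mdist w_ w' -> w = w'.
Proof.
move=> ww ww'; apply: mdist_positivity; apply/le_anti; rewrite mdist_ge0 andbT.
apply/ler_addgt0Pl => e e0; rewrite addr0.
have e20 : 0 < e / 2 by rewrite divr_gt0.
have [N1 H1] := ww _ e20; have [N2 H2] := ww' _ e20.
rewrite (splitr e); apply: le_trans (metric_triangle _ (w_ (maxn N1 N2)) _) _.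
rewrite (metric_sym _ w'); apply/ltW/ltrD; [apply: H1|apply: H2].
  exact: leq_maxl.
exact: leq_maxr.
Qed.

Lemma cvd_ext T (d : T -> T -> R) (u v : nat -> T) l : (forall n, v n = u n) ->
  cvd d u l -> cvd d v l.
Proof. by move=> uv ul e /ul[N HN]; exists N => n; rewrite uv; exact: HN. Qed.

Lemma closed_by_seq (A : set Omega) :
  (forall (w_ : nat -> Omega) w, (forall n, A (w_ n)) -> cvd mdist w_ w -> A w) ->
  compact A.
Proof.
move=> HA; apply: (subclosed_compact _ compactO) => //.
move=> p Ap; have H n : exists q, A q /\ mdist p q < n.+1%:R^-1.
  have nb : nbhs p (ball p (n.+1%:R^-1 : R)).
    by apply: nbhsx_ballx; rewrite invr_gt0 ltr0Sn.
  by have [q [Aq]] := Ap _ nb; rewrite ballEmdist; exists q.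
have [q Hq] := choice H; apply: (HA q) => [n|]; first by case: (Hq n).
by apply: cvd_inv => n; case: (Hq n).
Qed.

Lemma invariant_set_full (A : set Omega) : A !=set0 ->
  (forall (w_ : nat -> Omega) w, (forall n, A (w_ n)) -> cvd mdist w_ w -> A w) ->
  (forall w t, A w -> A (sigma t w)) -> forall w, A w.
Proof.
move=> A0 cA iA w; rewrite (minO A0 (closed_by_seq cA)) => // t.
apply/seteqP; split => [_ [p Ap <-]|p Ap]; first exact: iA.
by exists (sigma (- t) p); [exact: iA|rewrite (sigmaNK flow)].
Qed.

(** The set [A] is the alpha-limit set of [w]: nonempty by compactness, closed and invariant, hence
    everything by minimality. Demanding arbitrarily large [s] makes it invariant. *)
Lemma backward_recurrence w w' e : 0 < e ->
  exists2 s, 0 <= s & mdist w' (sigma (- s) w) < e.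
Proof.
move=> e0.
pose A : set Omega := [set p | forall g T : R, 0 < g -> exists s,
  [/\ 0 <= s, T <= s & mdist p (sigma (- s) w) < g]].
suff /(_ w' e 0 e0)[s [s0 _ ws]] : forall w', A w' by exists s.
apply: invariant_set_full.
- have [//|f hf [p _ Hp]] :=
    @compact_extract_metric R Omega _ (fun n => sigma (- n%:R) w) compactO.
  exists p => g T g0; have [N HN] := Hp g g0.
  pose n := maxn N (Num.truncn T).+1; exists (f n)%:R; split => //.
  - apply: le_trans (ltW (truncnS_gt T)) _; rewrite ler_nat.
    by apply: leq_trans (hf n); exact: leq_maxr.
  - by apply: HN; exact: leq_maxl.
- move=> p_ p Ap pp g T g0; have g20 : 0 < g / 2 by rewrite divr_gt0.
  have [N /(_ N (leqnn N)) HN] := pp _ g20.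
  have [s [s0 Ts ps]] := Ap N _ T g20; exists s; split=> //.
  by rewrite (splitr g); apply: le_lt_trans (metric_triangle _ (p_ N) _) (ltrD HN ps).
- move=> p t Ap g T g0.
  have H n : exists s, [/\ 0 <= s, `|T| + `|t| <= s & mdist p (sigma (- s) w) < n.+1%:R^-1].
    by apply: Ap; rewrite invr_gt0 ltr0Sn.
  have [s_ Hs] := choice H.
  have ss : cvd mdist (fun n => sigma (- s_ n) w) p.
    by apply: cvd_inv => n; case: (Hs n).
  have [N /(_ N (leqnn N)) HN] := sigma_seq_w flow t ss g0.
  have [h1 h2 _] := Hs N.
  exists (s_ N - t); rewrite opprB -(sigmaD flow); split=> //.
  - by have := ler_norm t; have := normr_ge0 T; lra.
  - by have := ler_norm t; have := ler_norm T; lra.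
Qed.

(** A compact invariant set of the skew-product semiflow, made of histories of entire solutions:
    compactness is sequential for [co_dist], the past of a member is read off the member itself, and
    each member continues forward inside the family. *)
Definition invariant_family K (M : R) :=
  [/\ forall w x, K w x -> `|x| <= M,
      forall (w_ : nat -> Omega) (x_ : nat -> BU), (forall n, K (w_ n) (x_ n)) ->
        exists2 f, extraction f & exists w x,
          [/\ cvd mdist (w_ \o f) w, cvc (x_ \o f) x & K w x],
      forall w x t, K w x -> t <= 0 -> K (sigma t w) (sh x t),
      forall w x t, K w x -> 0 <= t ->
        exists x', K (sigma t w) x' /\ sh x' (- t) = x &
      forall w x a, K w x -> 0 <= a -> sol w x a].

(* Uniform stability, the earlier states being read off the histories [x] and [y]. *)
Definition stable_family K := forall e, 0 < e -> exists2 d, 0 < d &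
  forall w x y t, K w x -> K w y -> 0 <= t ->
    co_dist (sh x (- t)) (sh y (- t)) <= d -> co_dist x y <= e.

(** Lower semicontinuity of the fibres. The upper half of continuity is already contained in
    compactness. *)
Definition lsc_family K := forall w x e, K w x -> 0 < e -> exists2 d, 0 < d &
  forall w', mdist w w' < d -> exists2 x', K w' x' & co_dist x x' < e.

Section one_family.
Variables (K : Omega -> BU -> Prop) (M : R).
Hypothesis (invK : invariant_family K M).

Lemma family_closed (w_ : nat -> Omega) (x_ : nat -> BU) w x :
  (forall n, K (w_ n) (x_ n)) -> cvd mdist w_ w -> cvc x_ x -> K w x.
Proof.
move=> Kn ww xx; have [_ cK _ _ _] := invK.
have [f hf [w' [x' [ww' xx' K']]]] := cK _ _ Kn.
have -> : w = w' by apply: mdist_seq_unique ww'; exact: (cvd_extract hf ww).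
by have -> : x = x' by apply: cvc_unique xx'; exact: (cvd_extract hf xx).
Qed.

Lemma family_fibres : (exists w x, K w x) -> forall w, exists x, K w x.
Proof.
have [_ cK pK fK _] := invK; move=> [w0 [x0 Kwx]].
apply: (@invariant_set_full [set w | exists x, K w x]).
- by exists w0, x0.
- move=> w_ w Hw ww; have [x_ Hx] := choice Hw.
  have [f hf [w' [x' [ww' _ K']]]] := cK _ _ Hx.
  have -> : w = w' by apply: mdist_seq_unique ww'; exact: (cvd_extract hf ww).
  by exists x'.
- move=> w t [x Kx]; have [t0|/ltW t0] := leP 0 t.
    by have [x' [Kx' _]] := fK _ _ _ Kx t0; exists x'.
  by exists (sh x t); apply: pK.
Qed.

Lemma family_totally_bounded e : 0 < e -> exists l : seq BU, forall w x, K w x ->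
  exists p, p \in l /\ co_dist p x <= e.
Proof.
move=> e0; have [_ cK _ _ _] := invK; apply: contrapT => /forallNP H.
have H' (l : seq BU) : exists q : Omega * BU, K q.1 q.2 /\
    forall p, p \in l -> e < co_dist p q.2.
  have /existsNP[w /existsNP[x /not_implyP[Kx /forallNP Hx]]] := H l.
  exists (w, x); split=> // p pl; rewrite ltNge; apply/negP => px.
  by apply: (Hx p).
have [g Hg] := choice H'.
pose L := fix L n := if n is n'.+1 then (g (L n')).2 :: L n' else [::].
have inL k n : (k < n)%N -> (g (L k)).2 \in L n.
  elim: n => [//|n IH]; rewrite ltnS leq_eqVlt => /orP[/eqP ->|/IH h].
    by rewrite /= inE eqxx.
  by rewrite /= inE h orbT.
have [|f hf [w [x [_ xx _]]]] := cK (fun n => (g (L n)).1) (fun n => (g (L n)).2).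
  by move=> n; case: (Hg (L n)).
have e20 : 0 < e / 2 by rewrite divr_gt0.
have [N HN] := xx _ e20.
have fN : (f N < f (f N).+1)%N by exact: hf.
have NN : (N <= (f N).+1)%N by exact: leqW (hf N).
have [_ /(_ _ (inL _ _ fN))] := Hg (L (f (f N).+1)).
apply/negP; rewrite -leNgt (splitr e); apply: ltW.
apply: (@co_dist_lt _ _ x); last exact: HN.
by rewrite co_distC; exact: HN.
Qed.

(** An upper semicontinuous family is nearly continuous somewhere. For each point of a finite net,
    either every fibre over the current ball comes near it, or some fibre stays away, and by
    compactness so do all fibres over a smaller ball. After finitely many shrinkings, all fibres
    over the ball are near the same points of the net. *)
Lemma family_fine_ball w0 e : 0 < e -> exists w, exists2 d, 0 < d &
  forall w' w'' x', mdist w w' < d -> mdist w w'' < d -> K w' x' ->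
    exists2 x'', K w'' x'' & co_dist x' x'' <= e.
Proof.
move=> e0; have [_ cK _ _ _] := invK; have e20 : 0 < e / 2 by rewrite divr_gt0.
have [l Hl] := family_totally_bounded e20.
have [w [d d0 Hd]] : exists w, exists2 d, 0 < d & forall p, p \in l ->
    (forall w', mdist w w' < d -> exists2 x, K w' x & co_dist p x <= e / 2) \/
    (forall w', mdist w w' < d -> forall x, K w' x -> ~ co_dist p x <= e / 2).
  elim: (l) => [|p l' [w [d d0 Hd]]]; first by exists w0, 1.
  have [all_near|] := pselect (forall w', mdist w w' < d ->
      exists2 x, K w' x & co_dist p x <= e / 2).
    exists w, d => // q; rewrite inE => /orP[/eqP ->|]; [by left|exact: Hd].
  move=> /existsNP[w1 /not_implyP[ww1 far]].
  have [d1 d10 Hd1] : exists2 d1, 0 < d1 & forall w', mdist w1 w' < d1 ->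
      forall x, K w' x -> ~ co_dist p x <= e / 2.
    apply: contrapT => /forall2NP H.
    have H' k : exists q : Omega * BU, [/\ mdist w1 q.1 < k.+1%:R^-1, K q.1 q.2 &
        co_dist p q.2 <= e / 2].
      have [/negP|] := H k.+1%:R^-1; first by rewrite invr_gt0 ltr0Sn.
      move=> /existsNP[w' /not_implyP[ww' /existsNP[x /not_implyP[Kx /contrapT px]]]].
      by exists (w', x).
    have [q Hq] := choice H'; apply: far.
    have [|f hf [w' [x [ww' xx Kx]]]] := cK (fun n => (q n).1) (fun n => (q n).2).
      by move=> n; case: (Hq n).
    have -> : w1 = w'.
      apply: mdist_seq_unique ww'; apply: (cvd_extract hf) => //.
      by apply: cvd_inv => n; case: (Hq n).
    exists x => //; apply: (cvc_le_dist (@cvc_cst _ _ p) xx) => k.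
    by exists k; split=> //; case: (Hq (f k)).
  exists w1, (Num.min d1 (d - mdist w w1)); first by rewrite lt_min d10 subr_gt0.
  move=> q; rewrite inE => /orP[/eqP ->|/Hd].
    by right=> w'; rewrite lt_min => /andP[/Hd1].
  have sub w' : mdist w1 w' < Num.min d1 (d - mdist w w1) -> mdist w w' < d.
    rewrite lt_min => /andP[_ h]; apply: le_lt_trans (metric_triangle _ w1 _) _.
    by rewrite -ltrBrDl.
  by move=> [h|h]; [left|right] => w' /sub; exact: h.
exists w, d => // w' w'' x' ww' ww'' Kx'.
have [p [pl px']] := Hl _ _ Kx'.
have [near_|far] := Hd p pl; last by case: (far _ ww' _ Kx').
have [x'' Kx'' px''] := near_ _ ww''; exists x'' => //.
have {}px' : co_dist x' p <= e / 2 by rewrite co_distC; exact: px'.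
rewrite (splitr e); exact: (co_dist_le px' px'').
Qed.

(** A backward translation brings [w] into a ball where fibres are close to each other; one fixed
    translation serves all base points near [w]. Stability carries the closeness found there forward
    to [w]. *)
Lemma stable_family_lsc : stable_family K -> lsc_family K.
Proof.
move=> stK w x e Kx e0; have [_ cK pK fK _] := invK.
have e20 : 0 < e / 2 by rewrite divr_gt0.
have [d d0 Hd] := stK _ e20.
have [w1 [r r0 Hr]] := family_fine_ball w d0.
have [s s0 ws] := backward_recurrence w w1 r0.
have Ns0 : - s <= 0 by rewrite oppr_le0.
apply: contrapT => /forall2NP H.
have H' k : exists w', mdist w w' < k.+1%:R^-1 /\
    forall x', K w' x' -> e <= co_dist x x'.
  have [/negP|] := H k.+1%:R^-1; first by rewrite invr_gt0 ltr0Sn.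
  move=> /existsNP[w' /not_implyP[ww' /forall2NP h]]; exists w'; split=> // x' Kx'.
  by have [|/negP] := h x' => //; rewrite -leNgt.
have [w_ Hw] := choice H'.
have ww : cvd mdist w_ w by apply: cvd_inv => n; case: (Hw n).
have g0 : 0 < r - mdist w1 (sigma (- s) w) by rewrite subr_gt0.
have [N HN] := sigma_seq_w flow (- s) ww g0.
have Y n : exists x', K (w_ (n + N)%N) x' /\
    co_dist (sh x (- s)) (sh x' (- s)) <= d.
  have wn : mdist w1 (sigma (- s) (w_ (n + N)%N)) < r.
    apply: le_lt_trans (metric_triangle _ (sigma (- s) w) _) _.
    by rewrite -ltrBrDl; apply: HN; exact: leq_addl.
  have [y Ky xy] := Hr _ _ _ ws wn (pK _ _ _ Kx Ns0).
  have [x' []] := fK _ _ _ Ky s0; rewrite (sigmaNK flow) => Kx' yx'.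
  by exists x'; rewrite yx'.
have [x_ Hx] := choice Y.
have [|f hf [w' [x' [ww' xx Kx']]]] := cK (fun n => w_ (n + N)%N) x_.
  by move=> n; case: (Hx n).
have ww2 : w = w'.
  apply: mdist_seq_unique ww'; move=> g /ww[N' HN']; exists N' => n N'n.
  by apply: HN'; apply: leq_trans (leq_addr _ _); exact: leq_trans N'n (hf n).
have xx' : co_dist x x' <= e / 2.
  apply: (Hd w x x' s) => //; first by rewrite ww2.
  apply: (cvc_le_dist (@cvc_cst _ _ (sh x (- s))) (cvc_sh Ns0 xx)) => k.
  by exists k; split=> //; case: (Hx (f k)).
have [k /(_ k (leqnn k)) Hk] := xx _ e20.
have [_ /(_ (x_ (f k)))] := Hw (f k + N)%N.
case: (Hx (f k)) => Kk _ /(_ Kk); apply/negP; rewrite -ltNge (splitr e).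
apply: le_lt_trans (co_dist_triangle x' _ _) _.
exact: (ler_ltD xx' Hk).
Qed.

End one_family.

(* [X t] is the history at time [t], and [far n] is [n, +oo[ or ]-oo, -n], so that
   omega- and alpha-limit sets are treated together. *)
Section limit_sets.
Variables (w0 : Omega) (far : nat -> R -> Prop) (X : R -> BU) (M : R).
Hypotheses
  (farW : forall n k t, (k <= n)%N -> far n t -> far k t)
  (farD : forall s, exists k, forall n t, far (n + k)%N t -> far n (t + s))
  (XM : forall t, far 0 t -> `|X t| <= M)
  (Xc : forall t_ : nat -> R, (forall n, far n (t_ n)) ->
    exists2 f, extraction f & exists w x,
      cvd mdist (fun n => sigma (t_ (f n)) w0) w /\ cvc (fun n => X (t_ (f n))) x)
  (Xsol : forall a, 0 <= a -> exists k, forall t, far k t -> sol (sigma t w0) (X t) a)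
  (Xsh : forall s, s <= 0 -> exists k, forall t, far k t -> sh (X t) s = X (t + s)).

Definition limit_set w x := forall e n, 0 < e -> exists2 t, far n t &
  mdist w (sigma t w0) < e /\ co_dist x (X t) < e.

Lemma limit_set_seqP w x : limit_set w x <-> exists2 t_ : nat -> R,
  (forall n, far n (t_ n)) &
  cvd mdist (fun n => sigma (t_ n) w0) w /\ cvc (fun n => X (t_ n)) x.
Proof.
split=> [H|[t_ tf [ww xx]] e n e0].
  have H' n : exists t, far n t /\
      (mdist w (sigma t w0) < n.+1%:R^-1 /\ co_dist x (X t) < n.+1%:R^-1).
    have [|t ft [h1 h2]] := H n.+1%:R^-1 n; first by rewrite invr_gt0 ltr0Sn.
    by exists t.
  have [t_ Ht] := choice H'; exists t_; first by move=> n; case: (Ht n).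
  by split; apply: cvd_inv => n; case: (Ht n) => _ [].
have [N1 H1] := ww e e0; have [N2 H2] := xx e e0.
exists (t_ (maxn n (maxn N1 N2))).
  by apply: farW (tf _); exact: leq_maxl.
split; [apply: H1|apply: H2]; apply: leq_trans (leq_maxr _ _).
  exact: leq_maxl.
exact: leq_maxr.
Qed.

Lemma limit_set_invariant : invariant_family limit_set M.
Proof.
split.
- move=> w x /limit_set_seqP[t_ tf [_ xx]]; apply: (cvc_norm_le xx) => n.
  by apply: XM; apply: farW (tf n).
- move=> w_ x_ Hn.
  have H n : exists t, far n t /\ (mdist (w_ n) (sigma t w0) < n.+1%:R^-1 /\
      co_dist (x_ n) (X t) < n.+1%:R^-1).
    have [|t ft [h1 h2]] := Hn n n.+1%:R^-1 n; first by rewrite invr_gt0 ltr0Sn.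
    by exists t.
  have [t_ Ht] := choice H.
  have [n|f hf [w [x [ww xx]]]] := Xc (t_ := t_); first by case: (Ht n).
  have tf n : far n (t_ (f n)) by apply: farW (hf n) _; case: (Ht (f n)).
  exists f => //; exists w, x; split; last by apply/limit_set_seqP; exists (t_ \o f).
    move=> e e0; have e20 : 0 < e / 2 by rewrite divr_gt0.
    have [N1 H1] := ww _ e20; have [N2 H2] := invS_lt e20.
    exists (maxn N1 N2) => n; rewrite geq_max => /andP[/H1 n1 n2].
    rewrite (splitr e); apply: le_lt_trans (metric_triangle _ (sigma (t_ (f n)) w0) _) _.
    apply: ltrD => //; rewrite metric_sym; case: (Ht (f n)) => _ [h _].
    exact: lt_trans h (H2 _ (leq_trans n2 (hf n))).
  move=> e e0; have e20 : 0 < e / 2 by rewrite divr_gt0.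
  have [N1 H1] := xx _ e20; have [N2 H2] := invS_lt e20.
  exists (maxn N1 N2) => n; rewrite geq_max => /andP[/H1 n1 n2].
  rewrite (splitr e); apply: (co_dist_lt n1); rewrite co_distC.
  case: (Ht (f n)) => _ [_ h]; exact: lt_trans h (H2 _ (leq_trans n2 (hf n))).
- move=> w x s /limit_set_seqP[t_ tf [ww xx]] s0; apply/limit_set_seqP.
  have [k1 Hk1] := farD s; have [k2 Hk2] := Xsh s0.
  exists (fun n => t_ (n + (k1 + k2))%N + s).
    by move=> n; apply: Hk1; apply: farW (tf _); rewrite leq_add2l leq_addr.
  have hf : extraction (fun n => n + (k1 + k2))%N by move=> n; exact: leq_addr.
  split.
    apply: cvd_ext (cvd_extract hf (sigma_seq_w flow s ww)) => n /=.
    by rewrite (sigmaD flow) addrC.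
  apply: cvd_ext (cvd_extract hf (cvc_sh s0 xx)) => n /=; rewrite Hk2//.
  by apply: farW (tf _); rewrite addnA leq_addl.
- move=> w x t /limit_set_seqP[t_ tf [ww xx]] t0.
  have Nt0 : - t <= 0 by rewrite oppr_le0.
  have [k1 Hk1] := farD t; have [k2 Hk2] := Xsh Nt0.
  pose g n := (n + k2 + k1)%N.
  have hg : extraction g by move=> n; rewrite /g -addnA leq_addr.
  have tf' n : far (n + k2) (t_ (g n) + t) by exact: Hk1 (tf _).
  have [n|f hf [w' [x' [ww' xx']]]] := Xc (t_ := fun n => t_ (g n) + t).
    by apply: farW (tf' n); exact: leq_addr.
  have wE : sigma t w = w'.
    apply: mdist_seq_unique ww'.
    apply: cvd_ext (cvd_extract (extraction_comp hg hf) (sigma_seq_w flow t ww)) => n /=.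
    by rewrite (sigmaD flow) addrC.
  exists x'; split.
    rewrite wE; apply/limit_set_seqP; exists (fun n => t_ (g (f n)) + t) => // n.
    by apply: farW (tf' _); apply: leq_trans (hf n) (leq_addr _ _).
  apply: (cvc_unique (cvc_sh Nt0 xx')).
  apply: cvd_ext (cvd_extract (extraction_comp hg hf) xx) => n /=.
  by rewrite Hk2 ?addrK//; apply: farW (tf' _); exact: leq_addl.
- move=> w x a /limit_set_seqP[t_ tf [ww xx]] a0; have [k Hk] := Xsol a0.
  have hf : extraction (fun n => n + k)%N by move=> n; exact: leq_addr.
  apply: (sol_limit flow admD F3 (cvd_extract hf ww) (cvd_extract hf xx) (M := M)) => n /=.
    by apply: XM; apply: farW (tf _).
  by apply: Hk; apply: farW (tf _); exact: leq_addl.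
Qed.

End limit_sets.

End invariant_families.

(** * Forward orbits and their omega-limit sets *)

Section orbits.
Variables (R : realType) (m : nat) (Omega : metricType R).
Variables (sigma : R -> Omega -> Omega).
Notation V := 'rV[R]_m.
Notation BU := (BU R m).
Variables (D : BU -> V) (F : Omega -> BU -> V) (r : R).
Hypotheses (flow : continuous_flow sigma) (admD : admissible_D D).
Hypotheses (F1 : hypF1 F) (F2 : hypF2 F) (F3 : hypF3 F) (F4 : hypF4 D F).
Hypotheses (compactO : compact [set: Omega]) (minO : minimal_flow sigma).
Hypothesis F6 : hypF6 sigma D F r.
Implicit Types (w : Omega) (x y v b : BU) (s t a e d : R).
Implicit Types (K : Omega -> BU -> Prop).
Notation sol := (sol sigma D F).
Notation U := (fun w b t => u sigma D F t w b).
Notation inv := (invariant_family sigma D F).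

Definition far_future (n : nat) (t : R) := n%:R <= t.

Definition omega_set w b := limit_set sigma w far_future (U w b).

Lemma far_futureW n k t : (k <= n)%N -> far_future n t -> far_future k t.
Proof. by move=> kn; apply: le_trans; rewrite ler_nat. Qed.

Lemma far_future_ge0 n t : far_future n t -> 0 <= t.
Proof. exact: far_futureW (leq0n n). Qed.

Lemma far_futureD s : exists k, forall n t, far_future (n + k)%N t -> far_future n (t + s).
Proof.
exists (Num.truncn `|s|).+1 => n t; rewrite /far_future natrD => h.
have := truncnS_gt `|s|; have := ler_norm (- s); rewrite normrN.
by move: (_.+1%:R) h => q; lra.
Qed.

Lemma far_future_ge a : exists k, forall t, far_future k t -> a <= t.
Proof.
exists (Num.truncn a).+1 => t; apply: le_trans; exact: ltW (truncnS_gt a).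
Qed.

Let ge_min_l (p q : R) : Num.min p q <= p. Proof. by rewrite ge_min lexx. Qed.

Let ge_min_r (p q : R) : Num.min p q <= q. Proof. by rewrite ge_min lexx orbT. Qed.

Section one_orbit.
Variables (w0 : Omega) (b : BU).
Hypothesis bB : cball r (Dhat D b).

Lemma orbit_sol t : 0 <= t -> sol (sigma t w0) (U w0 b t) t.
Proof.
move=> t0; have [_ /(_ w0 b bB)[ud _ _]] := F6.
by have [] := u_spec flow t0 (ud t t0).
Qed.

Lemma orbit_start t : 0 <= t -> sh (U w0 b t) (- t) = b.
Proof.
move=> t0; have [_ /(_ w0 b bB)[ud _ _]] := F6.
by have [] := u_spec flow t0 (ud t t0).
Qed.

Lemma orbit_sh s t : 0 <= s -> s <= t -> sh (U w0 b t) (s - t) = U w0 b s.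
Proof.
move=> s0 st; have t0 := le_trans s0 st.
have st0 : s - t <= 0 by rewrite subr_le0.
have stt : - t <= s - t <= 0 by rewrite st0 andbT -[leLHS]add0r lerD2r.
have h1 := sol_sh flow stt (orbit_sol t0).
rewrite (sigmaD flow) subrK [t + _]addrC subrK in h1.
apply: (sol_unique flow admD F1 F2 F4 s0 h1 (orbit_sol s0)).
rewrite (orbit_start s0) sh_sh ?oppr_le0// addrAC subrr add0r.
exact: orbit_start.
Qed.

Lemma orbit_compact (t_ : nat -> R) : (forall n, 0 <= t_ n) ->
  exists2 f, extraction f & exists w x,
    cvd mdist (fun n => sigma (t_ (f n)) w0) w /\ cvc (fun n => U w0 b (t_ (f n))) x.
Proof.
move=> t0; have [_ /(_ w0 b bB)[_ _ pc]] := F6.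
have [n|f hf [w [x [ww xx _]]]] := @precompact_extract R Omega (BUco R m)
  _ (fun n => sigma (t_ n) w0) (fun n => U w0 b (t_ n)) pc.
  by exists (t_ n) => //; exact: t0.
by exists f => //; exists w, x.
Qed.

(** Relative compactness for the compact-open topology bounds the values at 0; every other value of
    a state is the value at 0 of an earlier state or a value of [b]. *)
Lemma orbit_bounded : exists2 M : R, `|b| <= M & forall t, 0 <= t -> `|U w0 b t| <= M.
Proof.
have [M HM] : exists M, forall t, 0 <= t -> `|U w0 b t (clip 0)| <= M.
  apply: contrapT => /forallNP H.
  have H' n : exists t, 0 <= t /\ n%:R < `|U w0 b t (clip 0)|.
    have /existsNP[t /not_implyP[t0 /negP]] := H n%:R.
    by rewrite -ltNge => nt; exists t.
  have [t_ Ht] := choice H'.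
  have [n|f hf [w [x [_ xx]]]] := orbit_compact (t_ := t_); first by case: (Ht n).
  have [N HN] := cvc_ev (lexx 0) xx ltr01.
  pose n := maxn N (Num.truncn (`|x (clip 0)| + 1)).+1.
  have h1 := HN n (leq_maxl _ _); have [_] := Ht (f n); apply/negP; rewrite -leNgt.
  have nk : `|x (clip 0)| + 1 <= (f n)%:R.
    apply: le_trans (ltW (truncnS_gt _)) _; rewrite ler_nat.
    by apply: leq_trans (hf n); exact: leq_maxr.
  apply: le_trans nk; rewrite -lerBlDl.
  by apply: le_trans (lerB_dist _ _) _; rewrite distrC.
exists (Num.max `|b| M); first by rewrite le_max lexx.
move=> t t0; apply: BU_le => s s0; have [ts|st] := leP (- t) s.
  have st0 : 0 <= t + s by rewrite addrC -lerBlDr sub0r.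
  have sE : s = (t + s) - t by rewrite addrAC subrr add0r.
  rewrite -(sh_eval _ s0) sE orbit_sh//; last by rewrite gerDl.
  by rewrite le_max HM ?orbT.
have Nt0 : - t <= 0 by rewrite oppr_le0.
have st0 : s + t <= 0 by rewrite -lerBrDr sub0r ltW.
have -> : U w0 b t (clip s) = b (clip (s + t)).
  by rewrite -[in RHS](orbit_start t0) (shE _ Nt0 st0) addrC addrK.
by rewrite le_max BU_ub.
Qed.

Lemma omega_set_invariant : exists M : R, [/\ inv (omega_set w0 b) M,
  `|b| <= M & forall t, 0 <= t -> `|U w0 b t| <= M].
Proof.
have [M bM HM] := orbit_bounded; exists M; split; [|exact: bM|exact: HM].
apply: (limit_set_invariant flow admD F3).
- exact: far_futureW.
- exact: far_futureD.
- by move=> t t0; exact: HM.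
- by move=> t_ Ht; apply: orbit_compact => n; apply: far_future_ge0 (Ht n).
- move=> a a0; have [k Hk] := far_future_ge a; exists k => t kt.
  exact: sol_sub (Hk t kt) (orbit_sol (far_future_ge0 kt)).
- move=> s s0; have [k Hk] := far_future_ge (- s); exists k => t kt.
  have h : 0 <= t + s by rewrite -lerBlDr sub0r; exact: Hk.
  have ts : t + s <= t by rewrite gerDl.
  by have := orbit_sh h ts; rewrite addrAC subrr add0r.
Qed.

Lemma omega_set_seqP w x : omega_set w0 b w x <-> exists2 t_ : nat -> R,
  (forall n, far_future n (t_ n)) &
  cvd mdist (fun n => sigma (t_ n) w0) w /\ cvc (fun n => U w0 b (t_ n)) x.
Proof. apply: limit_set_seqP; exact: far_futureW. Qed.

Lemma omega_set_extract (t_ : nat -> R) : (forall n, far_future n (t_ n)) ->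
  exists2 f, extraction f & exists w x, [/\ omega_set w0 b w x,
    cvd mdist (fun n => sigma (t_ (f n)) w0) w & cvc (fun n => U w0 b (t_ (f n))) x].
Proof.
move=> tf; have t0 n := far_future_ge0 (tf n).
have [f hf [w [x [ww xx]]]] := orbit_compact t0.
exists f => //; exists w, x; split=> //; apply/omega_set_seqP; exists (t_ \o f) => // n.
exact: far_futureW (hf n) (tf _).
Qed.

Lemma omega_set_nonempty : exists w x, omega_set w0 b w x.
Proof.
have [n|f _ [w [x [Kx _ _]]]] := omega_set_extract (t_ := fun n => n%:R).
  exact: lexx.
by exists w, x.
Qed.

Lemma omega_limitP p : omega_limit sigma D F w0 b p <-> omega_set w0 b p.1 p.2.
Proof.
split.
  move=> [t_ [tmono toy ww xx]] e n e0.
  have H1 : \forall k \near \oo, mdist p.1 (sigma (t_ k) w0) < e.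
    have nb : nbhs p.1 (ball p.1 e) by exact: nbhsx_ballx.
    have h : \forall k \near \oo, ball p.1 e (sigma (t_ k) w0) := ww _ nb.
    by apply: (filterS _ h) => k /=; rewrite ballEmdist.
  have H2 : \forall k \near \oo, co_dist p.2 (U w0 b (t_ k)) < e.
    have /cvgrPdist_lt/(_ e e0) h := xx; apply: (filterS _ h) => k.
    by rewrite sub0r normrN co_distC ger0_norm ?co_dist_ge0.
  have H3 : \forall k \near \oo, n%:R <= t_ k.
    by have /cvgryPge/(_ n%:R) := toy.
  have [k [[h1 h2] h3]] := filter_ex (filterI (filterI H1 H2) H3).
  by exists (t_ k).
move=> Hp.
have step (q : nat * R) : exists t, [/\ far_future q.1 t, q.2 <= t,
    mdist p.1 (sigma t w0) < q.1.+1%:R^-1 & co_dist p.2 (U w0 b t) < q.1.+1%:R^-1].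
  have [k Hk] := far_future_ge q.2.
  have [|t ft [h1 h2]] := Hp q.1.+1%:R^-1 (maxn q.1 k); first by rewrite invr_gt0 ltr0Sn.
  exists t; split=> //; first by apply: far_futureW ft; exact: leq_maxl.
  by apply: Hk; apply: far_futureW ft; exact: leq_maxr.
have [g Hg] := choice step.
(* Feeding the previous time to [g] as a lower bound makes the sequence nondecreasing, as
   [omega_limit] demands. *)
pose t_ := fix t_ n := if n is n'.+1 then g (n, t_ n') else g (0%N, 0).
have Ht n : [/\ far_future n (t_ n), mdist p.1 (sigma (t_ n) w0) < n.+1%:R^-1 &
    co_dist p.2 (U w0 b (t_ n)) < n.+1%:R^-1].
  by case: n => [|n] /=; [have [? _ ? ?] := Hg (0%N, 0)|
    have [? _ ? ?] := Hg (n.+1, t_ n)].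
exists t_; split.
- by apply/nondecreasing_seqP => n /=; have [_ h _ _] := Hg (n.+1, t_ n).
- apply/cvgryPge => A; have [k Hk] := far_future_ge A; exists k => // n /= kn.
  by apply: Hk; case: (Ht n) => h _ _; exact: far_futureW h.
- move=> B /nbhs_ballP[e /= e0 eB].
  have [N HN] := invS_lt e0; exists N => // n /= Nn; apply: eB; rewrite ballEmdist /=.
  by case: (Ht n) => _ h _; exact: lt_trans h (HN _ Nn).
- apply/cvgrPdist_lt => e e0; have [N HN] := invS_lt e0; exists N => // n /= Nn.
  rewrite sub0r normrN co_distC ger0_norm ?co_dist_ge0//.
  by case: (Ht n) => _ _ h; exact: lt_trans h (HN _ Nn).
Qed.

(** The stability in (F6) restated for histories; the radius of the comparison set is taken above
    [r] and large enough to contain [Dhat y] for every [y] of norm at most [M]. *)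
Lemma orbit_stable (M : R) e : 0 < e -> exists2 d, 0 < d & forall s y t v, 0 <= s ->
  `|y| <= M -> co_dist (U w0 b s) y <= d -> 0 <= t -> sol (sigma (t + s) w0) v t ->
  sh v (- t) = y -> co_dist (U w0 b (t + s)) v <= e.
Proof.
move=> e0; have [_ /(_ w0 b bB)[_ us _]] := F6.
have [C C0 HC] := Dh_bounded admD.
have rr : r < Num.max (r + 1) (C * M) by rewrite lt_max ltrDl ltr01.
have [d d0 Hd] := us _ rr e e0; exists d => // s y t v s0 yM xy t0 sv vy.
have yB : (Dhat D @^-1` cball (Num.max (r + 1) (C * M))) y.
  rewrite /cball /= le_max; apply/orP; right; apply: le_trans (HC y) _.
  by apply: (ler_wpM2l (ltW C0)).
rewrite -(sigmaD flow) in sv.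
have [ud ue] := u_eq flow admD F1 F2 F4 t0 sv; rewrite vy in ud ue.
by have := Hd s y s0 yB xy t t0 ud; rewrite ue.
Qed.

(** The past of [x] is a limit of states [U w0 b (s_ n)], but the past of [y] sits over
    [sigma (- t) w] instead of [sigma (s_ n) w0]. [continuation] restarts it over the latter with an
    end state close to [y]; stability of the orbit then applies, and the limit gives the estimate
    for [x] and [y]. *)
Lemma omega_set_stable : stable_family (omega_set w0 b).
Proof.
have [M [invO _ _]] := omega_set_invariant.
have [OM _ Op _ Osol] := invO.
move=> e e0; have [d d0 Hd] := orbit_stable M e0.
have d20 : 0 < d / 2 by rewrite divr_gt0.
exists (d / 2) => // w x y t Kx Ky t0 xy.
have Nt0 : - t <= 0 by rewrite oppr_le0.
have /omega_set_seqP[s_ sf [ws xs]] := Op _ _ _ Kx Nt0.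
have [N HN] := xs _ d20.
have Us n : (N <= n)%N -> co_dist (U w0 b (s_ n)) (sh y (- t)) <= d.
  move=> Nn; have h := ltW (HN n Nn); rewrite co_distC in h.
  by rewrite (splitr d); exact: (co_dist_le h xy).
have ww : cvd mdist (fun n => sigma (t + s_ n) w0) w.
  rewrite -(sigmaNK flow t w); apply: cvd_ext (sigma_seq_w flow t ws) => n.
  by rewrite (sigmaD flow).
have H k : exists q : nat * BU, [/\ (maxn N k <= q.1)%N, sh q.2 (- t) = sh y (- t),
    sol (sigma (t + s_ q.1) w0) q.2 t & `|q.2 - y| <= k.+1%:R^-1].
  have k0 : 0 < k.+1%:R^-1 :> R by rewrite invr_gt0 ltr0Sn.
  have [g g0 Hg] := continuation flow admD F1 F2 F3 t0 (Osol _ _ _ Ky t0) k0.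
  have [N' HN'] := ww g g0.
  have [v [vy sv vk]] := Hg _ (HN' (maxn (maxn N k) N') (leq_maxr _ _)).
  by exists (maxn (maxn N k) N', v); split=> //; exact: leq_maxl.
have [q Hq] := choice H.
pose f k := (q k).1; have hf : extraction f.
  by move=> k; have [h _ _ _] := Hq k; apply: leq_trans h; exact: leq_maxr.
have s0 n : 0 <= s_ n by apply: far_future_ge0 (sf n).
have ts n : far_future n (t + s_ n).
  by apply: le_trans (sf n) _; rewrite lerDr.
have tsf n : far_future n (t + s_ (f n)) := far_futureW (hf n) (ts _).
have [g hg [w' [x' [Kx' ww' xx']]]] := omega_set_extract tsf.
have wE : w = w' by apply: mdist_seq_unique ww'; exact: (cvd_extract (extraction_comp hf hg) ww).
(* The limit of the states at times [t + s_ n] and [x] have the same past at [- t], so uniqueness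
   identifies them. *)
have xE : x = x'.
  rewrite -wE in Kx'.
  apply: (sol_unique flow admD F1 F2 F4 t0 (Osol _ _ _ Kx t0) (Osol _ _ _ Kx' t0)).
  apply: (cvc_unique (cvd_extract (extraction_comp hf hg) xs)).
  apply: cvd_ext (cvc_sh Nt0 xx') => n /=.
  have -> : - t = s_ (f (g n)) - (t + s_ (f (g n))) by rewrite opprD addrCA subrr addr0.
  by rewrite orbit_sh// lerDr.
have vy : cvc (fun n => (q (g n)).2) y.
  apply: norm_cvc => a /invS_lt[N' HN']; exists N' => n N'n; rewrite distrC.
  have [_ _ _ h] := Hq (g n); apply: le_lt_trans h (HN' _ (leq_trans N'n (hg n))).
rewrite xE; apply: (cvc_le_dist xx' vy) => k; exists k; split=> //.
have [h1 h2 h3 _] := Hq (g k).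
apply: (Hd (s_ (f (g k))) (sh y (- t)) t _ (s0 _)) => //.
  by apply: le_trans (sh_norm _ _) (OM _ _ Ky).
by apply: Us; apply: leq_trans h1; exact: leq_maxl.
Qed.

Lemma omega_set_lsc : lsc_family (omega_set w0 b).
Proof.
have [M [invO _ _]] := omega_set_invariant.
exact: (stable_family_lsc flow compactO minO invO omega_set_stable).
Qed.

(* By stability the orbit shadows [K] once it has come close to a point of [K]. *)
Lemma omega_set_absorbed K (M : R) w1 x1 : inv K M -> lsc_family K ->
  K w1 x1 -> omega_set w0 b w1 x1 -> forall w x, omega_set w0 b w x -> K w x.
Proof.
move=> invK lscK K1 O1 w x Ox; have [KM cK _ fK Ksol] := invK.
have [invOM [invO _ _]] := omega_set_invariant.
have shadow k : exists y, K w y /\ co_dist x y <= k.+1%:R^-1.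
  have e0 : 0 < k.+1%:R^-1 :> R by rewrite invr_gt0 ltr0Sn.
  have [d d0 Hd] := orbit_stable M e0; have d20 : 0 < d / 2 by rewrite divr_gt0.
  have [g g0 Hg] := lscK _ _ _ K1 d20.
  have gd0 : 0 < Num.min g (d / 2) by rewrite lt_min g0.
  have [s s0 [ws xs]] := O1 _ 0%N gd0.
  have [y Ky x1y] := Hg _ (lt_le_trans ws (ge_min_l g (d / 2))).
  have Usy : co_dist (U w0 b s) y <= d.
    have h := ltW (lt_le_trans xs (ge_min_r g (d / 2))); rewrite co_distC in h.
    by rewrite (splitr d); exact: (co_dist_le h (ltW x1y)).
  have /omega_set_seqP[t_ tf [wt xt]] := Ox.
  have [k1 Hk1] := far_future_ge s.
  have Y n : exists y', K (sigma (t_ (n + k1)%N) w0) y' /\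
      co_dist (U w0 b (t_ (n + k1)%N)) y' <= k.+1%:R^-1.
    have st : 0 <= t_ (n + k1)%N - s.
      by rewrite subr_ge0; apply: Hk1; apply: far_futureW (tf _); exact: leq_addl.
    have [y' [Ky' y'y]] := fK _ _ _ Ky st.
    rewrite (sigmaD flow) subrK in Ky'; exists y'; split=> //.
    have := Hd s y _ y' s0 (KM _ _ Ky) Usy st _ y'y.
    by rewrite subrK; apply; exact: Ksol.
  have [y_ Hy] := choice Y.
  have [|f hf [w' [y' [ww' yy' Ky']]]] := cK (fun n => sigma (t_ (n + k1)%N) w0) y_.
    by move=> n; case: (Hy n).
  have hk : extraction (fun n => n + k1)%N by move=> n; exact: leq_addr.
  have wE : w = w'.
    by apply: mdist_seq_unique ww'; exact: (cvd_extract (extraction_comp hk hf) wt).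
  exists y'; split; first by rewrite wE.
  apply: (cvc_le_dist (cvd_extract (extraction_comp hk hf) xt) yy') => n.
  by exists n; split=> //; case: (Hy (f n)).
have [y_ Hy] := choice shadow.
apply: (family_closed invK (w_ := fun=> w) (x_ := y_)).
- by move=> n; case: (Hy n).
- exact: cvd_cst (mdistxx w).
- move=> e /invS_lt[N HN]; exists N => n /HN h.
  by case: (Hy n) => _ h'; exact: le_lt_trans h' h.
Qed.

End one_orbit.

Lemma orbit_mono w b b' t : cball r (Dhat D b) -> cball r (Dhat D b') ->
  leD D b b' -> 0 <= t -> leD D (U w b t) (U w b' t).
Proof.
move=> bB b'B bb' t0.
apply: (comparison flow admD F1 F2 F4 t0 (orbit_sol w bB t0) (orbit_sol w b'B t0)).
by rewrite (orbit_start w bB t0) (orbit_start w b'B t0).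
Qed.

End orbits.

(** * The copy of the base below the omega-limit set *)

Section copy_of_the_base.
Variables (R : realType) (m : nat) (Omega : metricType R).
Variables (sigma : R -> Omega -> Omega).
Notation V := 'rV[R]_m.
Notation BU := (BU R m).
Variables (D : BU -> V) (F : Omega -> BU -> V) (r : R).
Hypotheses (flow : continuous_flow sigma) (admD : admissible_D D).
Hypotheses (F1 : hypF1 F) (F2 : hypF2 F) (F3 : hypF3 F) (F4 : hypF4 D F).
Hypothesis F5 : hypF5 sigma D F.
Hypotheses (compactO : compact [set: Omega]) (minO : minimal_flow sigma).
Hypothesis F6 : hypF6 sigma D F r.
Implicit Types (w : Omega) (x y v b p q : BU) (s t a e d : R) (i : 'I_m).
Implicit Types (K Q : Omega -> BU -> Prop).
Notation sol := (sol sigma D F).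
Notation U := (fun w b t => u sigma D F t w b).
Notation inv := (invariant_family sigma D F).
Notation Om := (omega_set sigma D F).

Let leD_sh x y t : t <= 0 -> leD D x y -> leD D (sh x t) (sh y t).
Proof.
move=> t0 /leDP xy; apply/leDP => s i s0; rewrite !(sh_sh _ t0 s0).
by apply: xy; rewrite -[leRHS]addr0 lerD.
Qed.

Let leD_D x y i : leD D x y -> D x 0 i <= D y 0 i.
Proof. by move=> /leDP/(_ 0 i (lexx 0)); rewrite !sh0. Qed.

(* The infimum is taken after applying [Dhat], componentwise; it stays in BU because the
   histories in [K] are solutions, hence uniformly Lipschitz after [Dhat]. *)
Lemma family_lower_bound K (M : R) w : inv K M -> (exists x, K w x) ->
  (forall x, K w x -> cball r (Dhat D x)) ->
  exists b, [/\ cball r (Dhat D b), forall x, K w x -> leD D b x &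
    forall q, (forall x, K w x -> leD D q x) -> leD D q b].
Proof.
move=> [KM _ _ _ Ksol] [x1 Kx1] KB.
have M0 : 0 <= M by apply: le_trans (KM _ _ Kx1).
have [L L0 HL] := @sol_lipschitz _ _ _ sigma D F F2 M M0.
have [f [fA fG fr]] : exists f : R -> V, [/\
    forall t j x, K w x -> f t 0 j <= D (sh x t) 0 j,
    forall t j z, (forall x, K w x -> z <= D (sh x t) 0 j) -> z <= f t 0 j &
    forall t, `|f t| <= r].
  pose A j t : set R := [set D (sh x t) 0 j | x in [set x | K w x]].
  have A0 j t : A j t !=set0 by exists (D (sh x1 t) 0 j), x1.
  have Ar j t z : A j t z -> - r <= z <= r.
    move=> [x Kx <-]; rewrite -ler_norml; apply: le_trans (row_norm_ub _ j) _.
    by rewrite -DhE//; apply: le_trans (BU_ub _ _) (KB x Kx).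
  have Alb j t : has_lbound (A j t) by exists (- r) => z /Ar/andP[].
  pose f t : V := \row_j inf (A j t).
  have fA t j x : K w x -> f t 0 j <= D (sh x t) 0 j.
    by move=> Kx; rewrite mxE; apply: ge_inf => //; exists x.
  have fG t j z : (forall x, K w x -> z <= D (sh x t) 0 j) -> z <= f t 0 j.
    by move=> zK; rewrite mxE; apply: lb_le_inf => // _ [x Kx <-]; exact: zK.
  have r0 : 0 <= r by case: F6 => /ltW.
  exists f; split=> // t.
  apply: row_norm_le => // j; rewrite ler_norml; apply/andP; split.
    by apply: fG => x Kx; have /andP[] := Ar j t _ (ex_intro2 _ _ x Kx erefl).
  apply: le_trans (fA t j x1 Kx1) _.
  by have /andP[] := Ar j t _ (ex_intro2 _ _ x1 Kx1 erefl).
have lip x s t j : K w x -> s <= t -> t <= 0 ->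
    - (L * (t - s)) <= D (sh x t) 0 j - D (sh x s) 0 j <= L * (t - s).
  move=> Kx st t0; have s0 := le_trans st t0.
  have Ns0 : 0 <= - s by rewrite oppr_ge0.
  have ss : - - s <= s <= t by rewrite opprK lexx.
  have := le_trans (row_norm_ub _ j) (HL w x (- s) (KM _ _ Kx) (Ksol _ _ _ Kx Ns0) s t ss t0).
  by rewrite !mxE ler_norml.
have flip s t : s <= t -> t <= 0 -> `|f t - f s| <= L * (t - s).
  move=> st t0; have s0 := le_trans st t0.
  apply: row_norm_le => [|j]; first by rewrite mulr_ge0 ?(ltW L0)// subr_ge0.
  rewrite !mxE ler_norml; apply/andP; split.
    rewrite lerBrDr addrC; apply: fG => x Kx.
    have /andP[h _] := lip x s t j Kx st t0; rewrite lerBrDr in h.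
    by apply: le_trans h; rewrite addrC lerD2l; exact: fA.
  rewrite lerBlDr -lerBlDl; apply: fG => x Kx.
  have /andP[_ h] := lip x s t j Kx st t0; rewrite lerBlDl -lerBlDr in h.
  by apply: le_trans h; rewrite lerD2r; exact: fA.
have hE t : t <= 0 -> ofR f (clip t) = f t.
  apply: ofRE; first by exists r.
  move=> e e0; exists (e / L); first by rewrite divr_gt0.
  move=> s t' s0 t'0; rewrite ltr_pdivlMr// mulrC => h.
  have [st|/ltW ts] := leP s t'.
    rewrite distrC; apply: le_lt_trans (flip s t' st t'0) _.
    by move: h; rewrite distrC ger0_norm ?subr_ge0.
  apply: le_lt_trans (flip t' s ts s0) _.
  by move: h; rewrite ger0_norm ?subr_ge0.
have [b Db] := Dhat_onto admD (ofR f).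
have DbE t : t <= 0 -> D (sh b t) = f t by move=> t0; rewrite -DhE// Db hE.
exists b; split.
- by rewrite /cball /= Db; apply: BU_le => t t0; rewrite hE.
- by move=> x Kx; apply/leDP => t j t0; rewrite DbE//; exact: fA.
- move=> q qK; apply/leDP => t j t0; rewrite DbE//; apply: fG => x Kx.
  by have /leDP := qK x Kx; apply.
Qed.

Lemma lsc_lift Q (w_ : nat -> Omega) w x : lsc_family Q -> Q w x ->
  cvd mdist w_ w -> exists2 f, extraction f & exists2 y_ : nat -> BU,
    forall k, Q (w_ (f k)) (y_ k) & cvc y_ x.
Proof.
move=> lscQ Qx ww.
have H k : exists q : nat * BU, [/\ (k <= q.1)%N, Q (w_ q.1) q.2 &
    co_dist x q.2 < k.+1%:R^-1].
  have k0 : 0 < k.+1%:R^-1 :> R by rewrite invr_gt0 ltr0Sn.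
  have [d d0 Hd] := lscQ _ _ _ Qx k0; have [N HN] := ww d d0.
  have [y Qy xy] := Hd _ (HN (maxn N k) (leq_maxl _ _)).
  by exists (maxn N k, y); split; [exact: leq_maxr|exact: Qy|exact: xy].
have [q Hq] := choice H; exists (fun k => (q k).1).
  by move=> k; case: (Hq k).
exists (fun k => (q k).2); first by move=> k; case: (Hq k).
by apply: cvd_inv => k; case: (Hq k).
Qed.

Section comparison_with_a_family.
Variables (w0 : Omega) (b : BU) (Q : Omega -> BU -> Prop) (M : R).
Hypotheses (bB : cball r (Dhat D b)) (invQ : inv Q M) (lscQ : lsc_family Q).

(** Solutions can be compared only over a common base point. Lower semicontinuity of [Q] replaces
    [x] by members of [Q] over the points [sigma (t_ k) w0] at which the orbit approaches [q]. *)
Let lifted w q x : Om w0 b w q -> Q w x -> exists M' : R,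
  exists t_ : nat -> R, exists y_ : nat -> BU,
  [/\ forall k, 0 <= t_ k /\ Q (sigma (t_ k) w0) (y_ k), cvc (fun k => U w0 b (t_ k)) q,
      cvc y_ x, forall k, `|U w0 b (t_ k)| <= M' & forall k, `|y_ k| <= M'].
Proof.
move=> Oq Qx; have [M1 [_ _ UM]] := omega_set_invariant flow admD F1 F2 F3 F4 F6 w0 bB.
have /omega_set_seqP[t_ tf [wt qt]] := Oq.
have [f hf [y_ Qy yx]] := lsc_lift lscQ Qx wt.
have t0 k : 0 <= t_ (f k) := far_future_ge0 (tf _).
exists (Num.max M1 M), (t_ \o f), y_; split.
- by move=> k; split; [exact: t0|exact: Qy].
- exact: (cvd_extract hf qt).
- exact: yx.
- by move=> k; rewrite le_max (UM _ (t0 k)).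
- by move=> k; have [QM _ _ _ _] := invQ; rewrite le_max (QM _ _ (Qy k)) orbT.
Qed.

Let past_in t y : 0 <= t -> Q (sigma t w0) y -> Q w0 (sh y (- t)) /\ sol (sigma t w0) y t.
Proof.
move=> t0 Qy; have [_ _ pQ _ sQ] := invQ.
have Nt0 : - t <= 0 by rewrite oppr_le0.
by split; [rewrite -(sigmaKN flow t w0); exact: pQ|exact: sQ].
Qed.

Lemma omega_set_below : (forall x, Q w0 x -> leD D b x) ->
  forall w q x, Om w0 b w q -> Q w x -> leD D q x.
Proof.
move=> bQ w q x Oq Qx; have [M' [t_ [y_ [ty Uq yx UM yM]]]] := lifted Oq Qx.
apply: (leD_limit admD Uq yx UM yM) => k; have [t0 Qy] := ty k.
have [Q0 sy] := past_in t0 Qy.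
apply: (comparison flow admD F1 F2 F4 t0 (orbit_sol flow F6 w0 bB t0) sy).
by rewrite (orbit_start flow F6 w0 bB t0); exact: bQ.
Qed.

Lemma omega_set_above : (forall x, Q w0 x -> leD D x b) ->
  forall w q x, Om w0 b w q -> Q w x -> leD D x q.
Proof.
move=> bQ w q x Oq Qx; have [M' [t_ [y_ [ty Uq yx UM yM]]]] := lifted Oq Qx.
apply: (leD_limit admD yx Uq yM UM) => k; have [t0 Qy] := ty k.
have [Q0 sy] := past_in t0 Qy.
apply: (comparison flow admD F1 F2 F4 t0 sy (orbit_sol flow F6 w0 bB t0)).
by rewrite (orbit_start flow F6 w0 bB t0); exact: bQ.
Qed.

End comparison_with_a_family.

(** The limit set itself serves as the family in [omega_set_above]: each of its points dominates
    every point of the same fibre, so antisymmetry leaves only one. *)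
Lemma omega_set_singleton w0 b : cball r (Dhat D b) ->
  (forall x, Om w0 b w0 x -> leD D x b) ->
  forall w q q', Om w0 b w q -> Om w0 b w q' -> q = q'.
Proof.
move=> bB Ob w q q' Oq Oq'.
have [M [invO _ _]] := omega_set_invariant flow admD F1 F2 F3 F4 F6 w0 bB.
have lscO : lsc_family (Om w0 b).
  exact: (omega_set_lsc flow admD F1 F2 F3 F4 compactO minO F6 bB).
apply: (leD_anti admD).
  exact: (omega_set_above bB invO lscO Ob Oq' Oq).
exact: (omega_set_above bB invO lscO Ob Oq Oq').
Qed.

(* A strict inequality in the past would persist by (F5). *)
Lemma agreement_past w x y i : (forall a, 0 <= a -> sol w x a) ->
  (forall a, 0 <= a -> sol w y a) -> leD D x y -> D x 0 i = D y 0 i ->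
  forall t, t <= 0 -> D (sh x t) 0 i = D (sh y t) 0 i.
Proof.
move=> sx sy xy xyi t t0; have Nt0 : 0 <= - t by rewrite oppr_ge0.
have := leD_D i (leD_sh t0 xy); rewrite le_eqVlt => /orP[/eqP//|lt_i]; exfalso.
have wE : sigma (- t) (sigma t w) = w by exact: (sigmaKN flow).
have sx' : sol (sigma (- t) (sigma t w)) x (- t) by rewrite wE; exact: sx.
have sy' : sol (sigma (- t) (sigma t w)) y (- t) by rewrite wE; exact: sy.
have [ux uxE] := u_eq flow admD F1 F2 F4 Nt0 sx'.
have [uy uyE] := u_eq flow admD F1 F2 F4 Nt0 sy'.
rewrite opprK in ux uxE uy uyE.
have := F5 (leD_sh t0 xy) lt_i Nt0 ux uy; rewrite uxE uyE xyi.
by rewrite ltxx.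
Qed.

Definition far_past (n : nat) (t : R) := t <= - n%:R.

Lemma alpha_limit_invariant K (M : R) w x : inv K M -> K w x ->
  inv (limit_set sigma w far_past (sh x)) M.
Proof.
move=> [KM cK pK fK sK] Kx.
have le0 n t : far_past n t -> t <= 0 by move=> h; apply: le_trans h _; rewrite oppr_le0.
apply: (limit_set_invariant flow admD F3).
- by move=> n k t kn h; apply: le_trans h _; rewrite lerN2 ler_nat.
- move=> s; exists (Num.truncn `|s|).+1 => n t; rewrite /far_past natrD => h.
  have := truncnS_gt `|s|; have := ler_norm s.
  by move: (_.+1%:R) h => q; lra.
- by move=> t _; apply: le_trans (sh_norm _ _) (KM _ _ Kx).
- move=> t_ tf.
  have [n|f hf [w' [x' [ww xx _]]]] := cK (fun n => sigma (t_ n) w) (fun n => sh x (t_ n)).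
    by apply: pK => //; exact: le0 (tf n).
  by exists f => //; exists w', x'.
- move=> a a0; exists 0%N => t /le0 t0; apply: sK => //; exact: pK.
- by move=> s s0; exists 0%N => t /le0 t0; rewrite sh_sh.
Qed.

Lemma alpha_limit_seqP w x w' x' : limit_set sigma w far_past (sh x) w' x' <->
  exists2 t_ : nat -> R, (forall n, far_past n (t_ n)) &
    cvd mdist (fun n => sigma (t_ n) w) w' /\ cvc (fun n => sh x (t_ n)) x'.
Proof.
apply: limit_set_seqP => n k t kn h.
by apply: le_trans h _; rewrite lerN2 ler_nat.
Qed.

Lemma D_coord_limit (u v : nat -> BU) x y (M : R) i : cvc u x -> cvc v y ->
  (forall n, `|u n| <= M) -> (forall n, `|v n| <= M) -> (forall e, 0 < e -> forall N,
    exists2 n, (N <= n)%N & D (u n) 0 i <= D (v n) 0 i + e) -> D x 0 i <= D y 0 i.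
Proof.
move=> ux vy uM vM H; apply/ler_addgt0Pl => e e0; have e40 : 0 < e / 4 by rewrite divr_gt0.
have [N1 H1] := D_co_continuous admD ux uM e40.
have [N2 H2] := D_co_continuous admD vy vM e40.
have [n Nn uv] := H _ e40 (maxn N1 N2).
have h1 := le_lt_trans (row_norm_ub _ i) (H1 n (leq_trans (leq_maxl _ _) Nn)).
have h2 := le_lt_trans (row_norm_ub _ i) (H2 n (leq_trans (leq_maxr _ _) Nn)).
move: h1 h2 uv; rewrite !mxE /= !ltr_norml.
move: (D x 0 i) (D y 0 i) (D (u n) 0 i) (D (v n) 0 i) => p1 p2 p3 p4.
by move=> /andP[a1 a2] /andP[a3 a4] a5; lra.
Qed.

End copy_of_the_base.

Section lower_copy.
Variables (R : realType) (m : nat) (Omega : metricType R).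
Variables (sigma : R -> Omega -> Omega).
Notation V := 'rV[R]_m.
Notation BU := (BU R m).
Variables (D : BU -> V) (F : Omega -> BU -> V) (r : R).
Hypotheses (flow : continuous_flow sigma) (admD : admissible_D D).
Hypotheses (F1 : hypF1 F) (F2 : hypF2 F) (F3 : hypF3 F) (F4 : hypF4 D F).
Hypothesis F5 : hypF5 sigma D F.
Hypotheses (compactO : compact [set: Omega]) (minO : minimal_flow sigma).
Hypothesis F6 : hypF6 sigma D F r.
Variables (w0 : Omega) (x0 : BU).
Hypothesis x0B : cball r (Dhat D x0).
Implicit Types (w : Omega) (x y v p q : BU) (s t a e d : R) (i : 'I_m).
Notation sol := (sol sigma D F).
Notation U := (fun w b t => u sigma D F t w b).
Notation inv := (invariant_family sigma D F).
Notation Om := (omega_set sigma D F).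
Notation K := (Om w0 x0).
Hypothesis KB : forall w x, K w x -> cball r (Dhat D x).

Lemma family_of_omega_set b : cball r (Dhat D b) -> [/\
  exists2 M : R, inv (Om w0 b) M & forall t, 0 <= t -> `|U w0 b t| <= M,
  stable_family (Om w0 b), lsc_family (Om w0 b) & forall w, exists x, Om w0 b w x].
Proof.
move=> bB; have [M [invO _ UM]] := omega_set_invariant flow admD F1 F2 F3 F4 F6 w0 bB.
split.
- by exists M; [exact: invO|exact: UM].
- exact: (omega_set_stable flow admD F1 F2 F3 F4 F6 w0 bB).
- exact: (omega_set_lsc flow admD F1 F2 F3 F4 compactO minO F6 bB).
- apply: (family_fibres flow compactO minO invO).
  exact: (omega_set_nonempty F6 w0 bB).
Qed.

Lemma lower_copy_ex : exists (b : BU) (c : Omega -> BU), [/\ cball r (Dhat D b),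
  forall x, K w0 x -> leD D b x,
  forall q, (forall x, K w0 x -> leD D q x) -> leD D q b,
  forall w q, Om w0 b w q <-> q = c w &
  forall w x, K w x -> leD D (c w) x].
Proof.
have [[MK invK _] _ lscK fibK] := family_of_omega_set x0B.
have [b [bB bK bmax]] := family_lower_bound admD F2 F6 invK (fibK w0) (@KB w0).
have [[MN invN _] _ lscN fibN] := family_of_omega_set bB.
have NK := omega_set_below flow admD F1 F2 F3 F4 F6 bB invK lscK bK.
have Nb x : Om w0 b w0 x -> leD D x b.
  by move=> Nx; apply: bmax => y Ky; exact: NK Nx Ky.
have single := omega_set_singleton flow admD F1 F2 F3 F4 compactO minO F6 bB Nb.
have [c Hc] := choice fibN; exists b, c.
split; [exact: bB|exact: bK|exact: bmax| |].
  by move=> w q; split=> [Nq|->]; [exact: single Nq (Hc w)|exact: Hc].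
by move=> w x Kx; exact: NK (Hc w) Kx.
Qed.

Variables (b : BU) (c : Omega -> BU).
Hypotheses (bB : cball r (Dhat D b)) (bK : forall x, K w0 x -> leD D b x).
Hypothesis bmax : forall q, (forall x, K w0 x -> leD D q x) -> leD D q b.
Hypothesis cN : forall w q, Om w0 b w q <-> q = c w.
Hypothesis cK : forall w x, K w x -> leD D (c w) x.

Let Nc w : Om w0 b w (c w). Proof. exact/cN. Qed.

Lemma copy_bounded : exists2 M : R, forall w, `|c w| <= M & inv (Om w0 b) M.
Proof.
have [[M invN _] _ _ _] := family_of_omega_set bB.
by exists M => // w; have [h _ _ _ _] := invN; exact: h (Nc w).
Qed.

Lemma copy_sh w t : t <= 0 -> sh (c w) t = c (sigma t w).
Proof.
have [M _ [_ _ pN _ _]] := copy_bounded.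
by move=> t0; apply/cN; exact: pN (Nc w) t0.
Qed.

(** With one-point fibres, lower semicontinuity is continuity. *)
Lemma copy_continuous (w_ : nat -> Omega) w : cvd mdist w_ w -> cvc (c \o w_) (c w).
Proof.
move=> ww e e0; have [_ _ lscN _] := family_of_omega_set bB.
have [d d0 Hd] := lscN _ _ _ (Nc w) e0; have [N HN] := ww d d0.
exists N => n /HN /Hd[x Nx]; have -> : x = c (w_ n) by apply/cN.
by [].
Qed.

(* One equality propagates to the past by (F5), hence to the alpha-limit set of the
   history, which by stability contains [K]; otherwise compactness gives a gap. *)
Lemma component_dichotomy i :
  (forall w x, K w x -> D x 0 i = D (c w) 0 i) \/
  (exists2 g : R, 0 < g & forall w x, K w x -> D (c w) 0 i + g <= D x 0 i).
Proof.
have [[MK invK _] stK lscK _] := family_of_omega_set x0B.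
have [KM KC Kp Kf Ks] := invK.
have [MN cM [_ _ _ _ Ns]] := copy_bounded.
have [[w' [x' [Kx' eq_i]]]|ne_i] :=
    pselect (exists w x, K w x /\ D x 0 i = D (c w) 0 i); [left|right].
  have past t : t <= 0 -> D (sh (c w') t) 0 i = D (sh x' t) 0 i.
    apply: (agreement_past flow admD F1 F2 F4 F5) => //.
    - by move=> a a0; exact: Ns (Nc w') a0.
    - by move=> a a0; exact: Ks Kx' a0.
    - exact: cK.
  pose Q := limit_set sigma w' (fun n t => far_past n t) (sh x').
  have invQ : inv Q MK by exact: (alpha_limit_invariant flow admD F3 invK Kx').
  have le0 n t : far_past n t -> t <= 0 by move=> h; apply: le_trans h _; rewrite oppr_le0.
  have QK w x : Q w x -> K w x.
    move=> /alpha_limit_seqP[t_ tf [ww xx]]; apply: (family_closed invK _ ww xx) => n.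
    by apply: Kp => //; exact: le0 (tf n).
  have lscQ : lsc_family Q.
    apply: (stable_family_lsc flow compactO minO invQ) => e /stK[d d0 Hd].
    exists d; first exact: d0.
    by move=> w x y t /QK Kx /QK Ky; exact: Hd Kx Ky.
  have [wq [xq Qq]] : exists w x, Q w x.
    have [n|f hf [w [x [ww xx _]]]] := KC (fun n => sigma (- n%:R) w') (fun n => sh x' (- n%:R)).
      by apply: Kp => //; rewrite oppr_le0.
    exists w, x; apply/alpha_limit_seqP; exists (fun n => - (f n)%:R).
      by move=> n; rewrite /far_past lerN2 ler_nat; exact: hf.
    by split; [exact: ww|exact: xx].
  have KQ := omega_set_absorbed flow admD F1 F2 F3 F4 F6 x0B invQ lscQ Qq (QK _ _ Qq).
  move=> w x /KQ/alpha_limit_seqP[t_ tf [ww xx]].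
  have tt0 n : t_ n <= 0 := le0 _ _ (tf n).
  have cc := copy_continuous ww.
  have xM n : `|sh x' (t_ n)| <= Num.max MK MN.
    by rewrite le_max; apply/orP; left; apply: le_trans (sh_norm _ _) (KM _ _ Kx').
  have cM' n : `|(c \o (fun n => sigma (t_ n) w')) n| <= Num.max MK MN.
    by rewrite le_max; apply/orP; right; exact: cM.
  have ee n : D ((c \o (fun n => sigma (t_ n) w')) n) 0 i = D (sh x' (t_ n)) 0 i.
    by rewrite /= -(copy_sh _ (tt0 n)) past.
  apply/eqP; rewrite eq_le; apply/andP; split.
    apply: (D_coord_limit admD xx cc xM cM') => e e0 N; exists N => //.
    by rewrite ee lerDl ltW.
  apply: (D_coord_limit admD cc xx cM' xM) => e e0 N; exists N => //.
  by rewrite ee lerDl ltW.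
apply: contrapT => /forall2NP H.
have H' k : exists q : Omega * BU, K q.1 q.2 /\ D q.2 0 i < D (c q.1) 0 i + k.+1%:R^-1.
  have [/negP|] := H k.+1%:R^-1; first by rewrite invr_gt0 ltr0Sn.
  move=> /existsNP[w /existsNP[x /not_implyP[Kx /negP]]].
  by rewrite -ltNge => h; exists (w, x).
have [q Hq] := choice H'.
have [n|f hf [w [x [ww xx Kx]]]] := KC (fun n => (q n).1) (fun n => (q n).2).
  by case: (Hq n).
apply: ne_i; exists w, x; split=> //; apply/le_anti; apply/andP; split; last first.
  by have /leDP/(_ 0 i (lexx 0)) := cK Kx; rewrite !sh0.
apply: (D_coord_limit admD xx (copy_continuous ww) (M := Num.max MK MN)) => [n|n|e e0 N].
- rewrite le_max; apply/orP; left; have [h _] := Hq (f n); exact: KM h.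
- by rewrite le_max; apply/orP; right; exact: cM.
have [N' HN'] := invS_lt e0; exists (maxn N N'); first exact: leq_maxl.
have [_ h] := Hq (f (maxn N N')); apply: le_trans (ltW h) _; rewrite lerD2l; apply: ltW.
by apply: HN'; apply: leq_trans (hf _); exact: leq_maxr.
Qed.

Lemma uniform_gap : exists2 g : R, 0 < g & forall i,
  (forall w x, K w x -> D x 0 i = D (c w) 0 i) \/
  (forall w x, K w x -> D (c w) 0 i + g <= D x 0 i).
Proof.
have [i|g g0 Hg] := @fin_pos R 'I_m (fun i g =>
    (forall w x, K w x -> D x 0 i = D (c w) 0 i) \/
    (forall w x, K w x -> D (c w) 0 i + g <= D x 0 i)).
  have [h|[g g0 Hg]] := component_dichotomy i; first by exists 1 => // g _; left.
  exists g => // g' /andP[_ g'g]; right=> w x Kx.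
  by apply: le_trans (Hg _ _ Kx); rewrite lerD2l.
by exists g => //; apply: Hg; rewrite g0 lexx.
Qed.

(* In the components where [K] and the copy agree, [p] is below some point of [K]; in
   the others the gap leaves room for [e]. *)
Lemma near_copy_below : exists2 e, 0 < e & forall P : Omega -> BU -> Prop,
  (forall w p t, P w p -> t <= 0 -> P (sigma t w) (sh p t)) ->
  (forall w p, P w p -> co_dist (c w) p <= e) ->
  (forall w p, P w p -> exists2 x, K w x & leD D p x) ->
  forall w p x, P w p -> K w x -> leD D p x.
Proof.
have [[MK invK _] _ _ _] := family_of_omega_set x0B.
have [KM KC Kp Kf Ks] := invK.
have [g g0 Hg] := uniform_gap.
have [MN cM [_ NC _ _ _]] := copy_bounded.
have [d1 d10 Hd1] := @co_dist_near R m 1 1 ltr01.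
have [e e0 He] : exists2 e, 0 < e & forall w p, `|p| <= MN + 1 -> co_dist (c w) p <= e ->
    forall i, D p 0 i <= D (c w) 0 i + g.
  apply: contrapT => /forall2NP H.
  have H' k : exists q : (Omega * BU) * 'I_m, [/\ `|q.1.2| <= MN + 1,
      co_dist (c q.1.1) q.1.2 <= k.+1%:R^-1 & D (c q.1.1) 0 q.2 + g < D q.1.2 0 q.2].
    have [/negP|] := H k.+1%:R^-1; first by rewrite invr_gt0 ltr0Sn.
    move=> /existsNP[w /existsNP[p /not_implyP[pM /not_implyP[cp /existsNP[i /negP]]]]].
    by rewrite -ltNge => h; exists ((w, p), i).
  have [q Hq] := choice H'.
  have [n|f hf [w [x [ww cx Nx]]]] := NC (fun n => (q n).1.1) (fun n => c (q n).1.1).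
    exact: Nc.
  have px : cvc (fun n => (q (f n)).1.2) x.
    move=> a a0; have a20 : 0 < a / 2 by rewrite divr_gt0.
    have [N1 H1] := cx _ a20; have [N2 H2] := invS_lt a20.
    exists (maxn N1 N2) => n; rewrite geq_max => /andP[/H1 h1 n2].
    have [_ h2 _] := Hq (f n).
    have {}h2 := le_lt_trans h2 (H2 _ (leq_trans n2 (hf n))).
    by rewrite (splitr a); exact: co_dist_lt h1 h2.
  have pM n : `|(q (f n)).1.2| <= MN + 1 by case: (Hq (f n)).
  have cM1 n : `|c (q (f n)).1.1| <= MN by exact: cM.
  have g20 : 0 < g / 2 by rewrite divr_gt0.
  have [N1 H1] := D_co_continuous admD cx cM1 g20.
  have [N2 H2] := D_co_continuous admD px pM g20.
  pose n := maxn N1 N2; have h1 := H1 n (leq_maxl _ _); have h2 := H2 n (leq_maxr _ _).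
  have {}h1 := le_lt_trans (row_norm_ub _ (q (f n)).2) h1.
  have {}h2 := le_lt_trans (row_norm_ub _ (q (f n)).2) h2.
  have [_ _ h3] := Hq (f n).
  move: h1 h2 h3; rewrite !mxE /= !ltr_norml.
  move: (D x 0 _) (D (c _) 0 _) (D (q (f n)).1.2 0 _) => p1 p2 p3.
  by move=> /andP[a1 a2] /andP[a3 a4] a5; lra.
exists (Num.min e d1); first by rewrite lt_min e0.
move=> P Pp Pc PK w p x Pwp Kwx; apply/leDP => t i t0.
have Pt := Pp _ _ _ Pwp t0; have Kt := Kp _ _ _ Kwx t0.
have [eqi|gapi] := Hg i.
  have [x' Kx' px'] := PK _ _ Pt; rewrite (eqi _ _ Kt) -(eqi _ _ Kx').
  by have /leDP/(_ 0 i (lexx 0)) := px'; rewrite !sh0.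
(* [He] asks for a bound on the sup norm, which [co_dist] does not control at one time. Each value
   of [sh p t] is the value at 0 of an earlier state in [P], which is within 1 of the copy. *)
apply: le_trans (gapi _ _ Kt); apply: He.
  apply: BU_le => s s0; rewrite -(sh_eval _ s0).
  have Ps := Pp _ _ _ Pt s0.
  have h := le_trans (Pc _ _ Ps) (_ : Num.min e d1 <= d1).
  have {h}h : co_dist (c (sigma s (sigma t w))) (sh (sh p t) s) <= d1.
    by apply: h; rewrite ge_min lexx orbT.
  have z0 : - 1 <= (0 : R) <= 0.
    by apply/andP; split; [exact: lerN10|exact: lexx].
  have h2 := Hd1 _ _ h 0 z0; rewrite distrC in h2.
  rewrite -(subrK (c (sigma s (sigma t w)) (clip 0)) (sh (sh p t) s (clip 0))) [leRHS]addrC.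
  apply: le_trans (ler_normD _ _) _; apply: lerD h2 _.
  exact: le_trans (BU_ub _ _) (cM _).
by apply: le_trans (Pc _ _ Pt) _; rewrite ge_min lexx.
Qed.

End lower_copy.

(** * Attraction by the copy of the base *)

(** Connectedness of the unit interval, for a property that is locally constant, through the
    supremum of the parameters where it holds. *)
Lemma interval_induction (R : realType) (L : R -> Prop) : L 0 ->
  (forall a, 0 <= a <= 1 -> exists2 h, 0 < h &
    forall a', 0 <= a' <= 1 -> `|a' - a| < h -> L a <-> L a') -> L 1.
Proof.
move=> L0 HL; pose A : set R := [set a | 0 <= a <= 1 /\ L a].
have A0 : A 0 by split; [rewrite lexx ler01|].
have A1 : ubound A 1 by move=> a [/andP[]].
have sA : has_sup A by split; [exists 0|exists 1].
have s01 : 0 <= sup A <= 1.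
  by rewrite (ub_le_sup sA.2 A0) ge_sup//; exists 0.
have [h h0 Hh] := HL _ s01.
have Ls : L (sup A).
  have [a [a01 La] ha] := sup_adherent h0 sA.
  apply/(Hh _ a01) => //; have aS : a <= sup A by apply: ub_le_sup; [exists 1|].
  by rewrite ler0_norm ?subr_le0//; move: ha; lra.
have [s1|s1] := leP 1 (sup A).
  by have -> : 1 = sup A by apply/le_anti; rewrite s1; case/andP: s01.
exfalso; pose a := Num.min 1 (sup A + h / 2).
have sa : sup A < a by rewrite lt_min s1 ltrDl divr_gt0.
have a01 : 0 <= a <= 1.
  by rewrite ge_min lexx andbT; case/andP: s01 => s0 _; apply: le_trans s0 (ltW sa).
have La : L a.
  apply/(Hh _ a01) => //; have ah : a <= sup A + h / 2 by rewrite ge_min lexx orbT.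
  by rewrite ger0_norm ?subr_ge0 ?(ltW sa)//; move: ah h0; lra.
have : a <= sup A by apply: ub_le_sup; [exists 1|split].
by rewrite leNgt sa.
Qed.

Section segments.
Variables (R : realType) (m : nat).
Notation BU := (BU R m).
Variables (D : BU -> 'rV[R]_m).
Hypothesis admD : admissible_D D.

Definition segment (x y : BU) (a : R) : BU := x + a *: (y - x).

Lemma segment0 x y : segment x y 0 = x.
Proof. by rewrite /segment scale0r addr0. Qed.

Lemma segment1 x y : segment x y 1 = y.
Proof. by rewrite /segment scale1r addrC subrK. Qed.

Lemma Dh_segment x y a : Dhat D (segment x y a) = Dhat D x + a *: (Dhat D y - Dhat D x).
Proof. by rewrite /segment (DhD admD x) (DhZ admD a) (DhB admD y). Qed.

Lemma segment_cball x y a (r : R) : 0 <= a <= 1 -> cball r (Dhat D x) ->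
  cball r (Dhat D y) -> cball r (Dhat D (segment x y a)).
Proof.
rewrite /cball /= Dh_segment; move: (Dhat D x) (Dhat D y) => p q /andP[a0 a1] pr qr.
have -> : p + a *: (q - p) = (1 - a) *: p + a *: q.
  by rewrite scalerBr scalerBl scale1r addrA addrAC.
have a1' : 0 <= 1 - a by rewrite subr_ge0.
apply: le_trans (ler_normD _ _) _; rewrite !normrZ (ger0_norm a0) (ger0_norm a1').
have -> : r = (1 - a) * r + a * r by ring.
by apply: lerD; [exact: ler_wpM2l a1' _ _ pr|exact: ler_wpM2l a0 _ _ qr].
Qed.

Lemma segment_le x y a : 0 <= a <= 1 -> leD D x y ->
  leD D x (segment x y a) /\ leD D (segment x y a) y.
Proof.
move=> /andP[a0 a1] /leDP xy.
have E t i : D (sh (segment x y a) t) 0 i =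
    D (sh x t) 0 i + a * (D (sh y t) 0 i - D (sh x t) 0 i).
  rewrite -(DhE admD (segment x y a)) Dh_segment -(DhE admD x) -(DhE admD y).
  by move: (Dhat D x) (Dhat D y) => p q; rewrite !mxE.
split; apply/leDP => t i t0; have := xy t i t0; rewrite E;
  move: (D (sh x t) 0 i) (D (sh y t) 0 i) => p q pq.
  by rewrite lerDl mulr_ge0// subr_ge0.
rewrite -lerBrDl ler_piMl// subr_ge0.
exact: pq.
Qed.

Lemma segment_near x y e : 0 < e -> exists2 h : R, 0 < h &
  forall a a', `|a' - a| < h -> co_dist (segment x y a) (segment x y a') < e.
Proof.
move=> /(@near_co_dist R m)[T [d d0 Hd]].
have p0 : 0 < `|y - x| + 1 by rewrite ltr_wpDl.
exists (d / (`|y - x| + 1)); first by rewrite divr_gt0.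
move=> a a' aa'; apply: Hd => t _; rewrite ltr_pdivlMr// in aa'.
have -> : segment x y a (clip t) - segment x y a' (clip t) = (a - a') *: (y - x) (clip t).
  have E b : segment x y b (clip t) = x (clip t) + b *: (y - x) (clip t) by exact: erefl.
  by rewrite (E a) (E a') scalerBl opprD addrACA subrr add0r.
rewrite normrZ distrC; apply: le_trans (ltW aa').
have h : `|(y - x) (clip t)| <= `|y - x| + 1.
  by apply: le_trans (BU_ub _ _) _; rewrite lerDl ler01.
exact: ler_wpM2l (normr_ge0 _) _ _ h.
Qed.

Lemma segment_norm x y a : 0 <= a <= 1 -> `|segment x y a| <= `|x| + `|y - x|.
Proof.
move=> /andP[a0 a1]; apply: le_trans (ler_normD _ _) _; rewrite lerD2l normrZ (ger0_norm a0).
by rewrite ler_piMl.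
Qed.

End segments.

(** * Absorption by the copy along a segment *)

Section absorption.
Variables (R : realType) (m : nat) (Omega : metricType R).
Variables (sigma : R -> Omega -> Omega).
Notation V := 'rV[R]_m.
Notation BU := (BU R m).
Variables (D : BU -> V) (F : Omega -> BU -> V) (r : R).
Hypotheses (flow : continuous_flow sigma) (admD : admissible_D D).
Hypotheses (F1 : hypF1 F) (F2 : hypF2 F) (F3 : hypF3 F) (F4 : hypF4 D F).
Hypothesis F5 : hypF5 sigma D F.
Hypotheses (compactO : compact [set: Omega]) (minO : minimal_flow sigma).
Hypothesis F6 : hypF6 sigma D F r.
Implicit Types (w : Omega) (x y v p q z : BU) (s t a e d : R) (i : 'I_m).
Notation sol := (sol sigma D F).
Notation U := (fun w b t => u sigma D F t w b).
Notation inv := (invariant_family sigma D F).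
Notation Om := (omega_set sigma D F).

Lemma orbit_in_family (Q : Omega -> BU -> Prop) (M : R) w x t : inv Q M -> Q w x ->
  cball r (Dhat D x) -> 0 <= t -> Q (sigma t w) (U w x t).
Proof.
move=> [_ _ _ Qf Qs] Qx xB t0; have [x' [Qx' x'x]] := Qf _ _ _ Qx t0.
have -> : U w x t = x'.
  apply: (sol_unique flow admD F1 F2 F4 t0 (orbit_sol flow F6 w xB t0) (Qs _ _ _ Qx' t0)).
  by rewrite (orbit_start flow F6 w xB t0) x'x.
exact: Qx'.
Qed.

Lemma omega_set_in_family (Q : Omega -> BU -> Prop) (M : R) w x w' p : inv Q M -> Q w x ->
  cball r (Dhat D x) -> Om w x w' p -> Q w' p.
Proof.
move=> invQ Qx xB /omega_set_seqP[t_ tf [ww pp]].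
apply: (family_closed invQ _ ww pp) => n.
exact: (orbit_in_family invQ Qx xB (far_future_ge0 (tf n))).
Qed.

Variables (w0 : Omega) (x0 : BU).
Hypothesis x0B : cball r (Dhat D x0).
Notation K := (Om w0 x0).
Hypothesis KB : forall w x, K w x -> cball r (Dhat D x).
Variables (b : BU) (c : Omega -> BU).
Hypotheses (bB : cball r (Dhat D b)) (bK : forall x, K w0 x -> leD D b x).
Hypothesis bmax : forall q, (forall x, K w0 x -> leD D q x) -> leD D q b.
Hypothesis cN : forall w q, Om w0 b w q <-> q = c w.
Hypothesis cK : forall w x, K w x -> leD D (c w) x.

Let Nc w : Om w0 b w (c w). Proof. exact/cN. Qed.

Let along x y w p : cball r (Dhat D x) -> cball r (Dhat D y) -> Om w0 x w p ->
  exists2 t_ : nat -> R, (forall n, 0 <= t_ n) & exists q,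
    [/\ cvd mdist (fun n => sigma (t_ n) w0) w, cvc (fun n => U w0 x (t_ n)) p,
        cvc (fun n => U w0 y (t_ n)) q & Om w0 y w q].
Proof.
move=> xB yB /omega_set_seqP[t_ tf [ww xp]].
have [f hf [w' [q [Oq ww' yq]]]] := omega_set_extract F6 w0 yB tf.
have wE : w = w' by exact: mdist_seq_unique (cvd_extract hf ww) ww'.
exists (t_ \o f); first by move=> n; exact: far_future_ge0 (tf (f n)).
exists q; split; [exact: (cvd_extract hf ww)|exact: (cvd_extract hf xp)|exact: yq|].
by rewrite wE.
Qed.

Let limit_le x y : cball r (Dhat D x) -> cball r (Dhat D y) -> leD D x y ->
  forall (t_ : nat -> R) p q, (forall n, 0 <= t_ n) -> cvc (fun n => U w0 x (t_ n)) p ->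
  cvc (fun n => U w0 y (t_ n)) q -> leD D p q.
Proof.
move=> xB yB xy t_ p q t0 xp yq.
have [M1 _ H1] := orbit_bounded flow admD F1 F2 F4 F6 w0 xB.
have [M2 _ H2] := orbit_bounded flow admD F1 F2 F4 F6 w0 yB.
apply: (leD_limit admD xp yq (M := Num.max M1 M2)) => n.
- by rewrite le_max; apply/orP; left; exact: H1.
- by rewrite le_max; apply/orP; right; exact: H2.
- exact: (orbit_mono flow admD F1 F2 F4 F6 w0 xB yB xy (t0 n)).
Qed.

Lemma omega_set_ge_copy x w p : cball r (Dhat D x) -> leD D b x -> Om w0 x w p ->
  leD D (c w) p.
Proof.
move=> xB bx Op; have [t_ t0 [q [_ xp bq /cN qc]]] := along xB bB Op.
rewrite -qc; exact: (limit_le bB xB bx t0 bq xp).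
Qed.

Lemma omega_set_le_family x y w p : cball r (Dhat D x) -> K w0 y -> leD D x y ->
  Om w0 x w p -> exists2 q, K w q & leD D p q.
Proof.
move=> xB Ky xy Op; have [[MK invK _] _ _ _] := family_of_omega_set flow admD F1 F2 F3 F4
  compactO minO F6 w0 x0B.
have yB := KB Ky; have [t_ t0 [q [_ xp yq Oq]]] := along xB yB Op.
exists q; first exact: (omega_set_in_family invK Ky yB Oq).
exact: (limit_le xB yB xy t0 xp yq).
Qed.

(** Closeness puts the limit set of [x] below [K], and over [w0] maximality of [b] puts it below
    [b]. Continuing one of its points over [w0] forward and comparing with the orbit of [b] yields a
    limit point below the copy; since [x] dominates [b], it is also above it. The two limit sets
    thus share a point, and [omega_set_absorbed] concludes. *)
Lemma near_copy_absorbed : exists2 e, 0 < e & forall x y,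
  cball r (Dhat D x) -> K w0 y -> leD D b x -> leD D x y ->
  (forall w p, Om w0 x w p -> co_dist (c w) p <= e) -> forall w p, Om w0 x w p -> p = c w.
Proof.
have [e e0 He] := near_copy_below flow admD F1 F2 F3 F4 F5 compactO minO F6 x0B bB cN cK.
exists e; first exact: e0.
move=> x y xB Ky bx xy near w p Op.
have [[MP invP _] _ _ fibP] := family_of_omega_set flow admD F1 F2 F3 F4
  compactO minO F6 w0 xB.
have [[MN invN _] _ lscN _] := family_of_omega_set flow admD F1 F2 F3 F4
  compactO minO F6 w0 bB.
have [PM PC Pp Pf Ps] := invP.
have PK w1 p1 x1 : Om w0 x w1 p1 -> K w1 x1 -> leD D p1 x1.
  apply: (He _ Pp near) => w2 p2 O2.
  exact: (omega_set_le_family xB Ky xy O2).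
have [z Oz] := fibP w0.
have zb : leD D z b by apply: bmax => x1 K1; exact: PK Oz K1.
have n0 n : 0 <= n%:R :> R by exact: ler0n.
(* The continuation stays inside the limit set of [x] because that family is invariant; [z] itself
   need not satisfy the ball condition of (F6). *)
have Z n : exists z', Om w0 x (sigma n%:R w0) z' /\ sh z' (- n%:R) = z.
  exact: Pf _ _ _ Oz (n0 n).
have [z_ Hz] := choice Z.
have [n|f hf [w1 [q1 [/cN q1c ww bq]]]] := omega_set_extract F6 w0 bB (t_ := fun n => n%:R).
  exact: lexx.
have [n|g hg [w2 [q2 [ww2 zq Oq2]]]] := PC (fun n => sigma (f n)%:R w0) (fun n => z_ (f n)).
  by have [] := Hz (f n).
have wE : w1 = w2 by exact: mdist_seq_unique (cvd_extract hg ww) ww2.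
have [MU _ HU] := orbit_bounded flow admD F1 F2 F4 F6 w0 bB.
have qc : leD D q2 (c w2).
  rewrite -wE -q1c.
  apply: (leD_limit admD zq (cvd_extract hg bq) (M := Num.max MP MU)) => n.
  - by rewrite le_max; apply/orP; left; have [h _] := Hz (f (g n)); exact: PM h.
  - by rewrite le_max; apply/orP; right; exact: HU.
  - have [Oz' zz'] := Hz (f (g n)).
    apply: (comparison flow admD F1 F2 F4 (n0 _) (Ps _ _ _ Oz' (n0 _))
      (orbit_sol flow F6 w0 bB (n0 _))).
    by rewrite zz' (orbit_start flow F6 w0 bB (n0 _)).
have q2c : q2 = c w2 := leD_anti admD qc (omega_set_ge_copy xB bx Oq2).
have N2 : Om w0 b w2 q2 by exact/cN.
apply/cN.
exact: (omega_set_absorbed flow admD F1 F2 F3 F4 F6 xB invN lscN N2 Oq2 Op).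
Qed.

(* The parameters along the segment from [b] to [y] whose orbit is attracted by the copy
   form an open and closed set. *)
Lemma copy_attracts y w p : K w0 y -> Om w0 y w p -> p = c w.
Proof.
move=> Ky; have yB := KB Ky; have by_ := bK Ky.
pose S a := segment b y a.
suff L1 : forall w p, Om w0 (S 1) w p -> p = c w by rewrite -(segment1 b y); exact: L1.
have SB a : 0 <= a <= 1 -> cball r (Dhat D (S a)).
  by move=> a01; exact: (segment_cball admD a01 bB yB).
have [e e0 He] := near_copy_absorbed.
have step a a' : 0 <= a <= 1 -> 0 <= a' <= 1 ->
    (forall t, 0 <= t -> co_dist (U w0 (S a) t) (U w0 (S a') t) <= e) ->
    (forall w p, Om w0 (S a) w p -> p = c w) -> forall w p, Om w0 (S a') w p -> p = c w.
  move=> a01 a'01 ne La.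
  have [bS Sy] := segment_le admD a'01 by_.
  apply: (He _ _ (SB _ a'01) Ky bS Sy) => w1 p1 Op1.
  have [t_ t0 [q [_ xp yq /La qc]]] := along (SB _ a'01) (SB _ a01) Op1.
  rewrite -qc; apply: (cvc_le_dist yq xp) => k; exists k; split; first exact: leqnn.
  exact: ne.
apply: (interval_induction (L := fun a => forall w p, Om w0 (S a) w p -> p = c w)).
  by move=> w1 p1; rewrite /S segment0 => /cN.
move=> a a01.
(* The radius bounds the norm of every point of the segment from [b] to [y]. *)
have [d d0 Hd] := orbit_stable flow admD F1 F2 F4 F6 w0 (SB _ a01) (`|b| + `|y - b|) e0.
have [h h0 Hh] := segment_near b y d0; exists h; first exact: h0.
move=> a' a'01 aa'.
have U0 : U w0 (S a) 0 = S a.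
  by rewrite -[RHS](orbit_start flow F6 w0 (SB _ a01) (lexx 0)) oppr0 sh0.
have ne t : 0 <= t -> co_dist (U w0 (S a) t) (U w0 (S a') t) <= e.
  move=> t0; have := Hd 0 (S a') t (U w0 (S a') t) (lexx 0) (segment_norm b y a'01).
  rewrite addr0 U0; apply.
  - exact: ltW (Hh _ _ aa').
  - exact: t0.
  - exact: (orbit_sol flow F6 w0 (SB _ a'01) t0).
  - exact: (orbit_start flow F6 w0 (SB _ a'01) t0).
(* Closeness of the two orbits is symmetric in [a] and [a'], so the same argument shows that the
   property passes from either parameter to the other. *)
split; first exact: step a01 a'01 ne.
by apply: step a'01 a01 _ => t t0; rewrite co_distC; exact: ne.
Qed.

(** The orbit of a point of [K] over [w0] stays in [K] and is attracted by the copy, so [K] and the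
    copy share a point; near it the orbit of [x0] is captured by the copy, and nonempty fibres give
    the converse. *)
Lemma omega_set_copy w x : K w x <-> x = c w.
Proof.
have [[MK invK _] _ _ fibK] := family_of_omega_set flow admD F1 F2 F3 F4
  compactO minO F6 w0 x0B.
have [[MN invN _] _ lscN _] := family_of_omega_set flow admD F1 F2 F3 F4
  compactO minO F6 w0 bB.
have KN w1 x1 : K w1 x1 -> x1 = c w1.
  have [y Ky] := fibK w0; have yB := KB Ky.
  have [w2 [p2 O2]] := omega_set_nonempty F6 w0 yB.
  have K2 := omega_set_in_family invK Ky yB O2.
  have N2 : Om w0 b w2 p2 by apply/cN; exact: (copy_attracts Ky O2).
  move=> K1; apply/cN.
  exact: (omega_set_absorbed flow admD F1 F2 F3 F4 F6 x0B invN lscN N2 K2 K1).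
split; first exact: KN.
by move=> ->; have [x1 K1] := fibK w; rewrite -(KN _ _ K1).
Qed.

End absorption.

Lemma far_future_cvg0 (R : realType) (f : R -> R) : (forall t, 0 <= f t) ->
  (forall e, 0 < e -> exists k : nat, forall t, far_future k t -> f t < e) ->
  f t @[t --> +oo] --> 0.
Proof.
move=> f0 H; apply/cvgrPdist_lt => e e0; have [k Hk] := H e e0.
exists k%:R; split; first exact: num_real.
by move=> t kt; rewrite sub0r normrN ger0_norm//; apply: Hk; exact: ltW.
Qed.

Theorem theorem4p6 (R : realType) (m : nat) (Omega : metricType R)
    (sigma : R -> Omega -> Omega)
    (D : BU R m -> 'rV[R]_m) (F : Omega -> BU R m -> 'rV[R]_m)
    (r : R) (w0 : Omega) (x0 : BU R m) :
  compact [set: Omega] ->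
  continuous_flow sigma ->
  minimal_flow sigma ->
  admissible_D D ->
  hypF1 F ->
  hypF2 F ->
  hypF3 F ->
  hypF4 D F ->
  hypF5 sigma D F ->
  hypF6 sigma D F r ->
  cball r (Dhat D x0) ->
  let K := omega_limit sigma D F w0 x0 in
  (forall p, K p -> cball r (Dhat D p.2)) ->
  exists c : Omega -> BU R m,
    [/\ continuous (c : Omega -> BUco R m),
        (forall w t, 0 <= t ->
           u_defined sigma D F t w (c w) /\
           c (sigma t w) = u sigma D F t w (c w)),
        K = [set (w, c w : BUco R m) | w in [set: Omega]] &
        co_dist (u sigma D F t w0 x0) (c (sigma t w0)) @[t --> +oo] --> 0].
Proof.
move=> compactO flow minO admD F1 F2 F3 F4 F5 F6 x0B K KB.
have KB' w x : omega_set sigma D F w0 x0 w x -> cball r (Dhat D x).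
  by move=> Kx; apply: (KB (w, x)); apply/omega_limitP.
have [b [c [bB bK bmax cN cK]]] :=
  lower_copy_ex flow admD F1 F2 F3 F4 compactO minO F6 x0B KB'.
have Kc := omega_set_copy flow admD F1 F2 F3 F4 F5 compactO minO F6 x0B KB' bB bK bmax cN cK.
have [M cM [_ _ _ Nf Ns]] := copy_bounded flow admD F1 F2 F3 F4 compactO minO F6 bB cN.
have cc := copy_continuous flow admD F1 F2 F3 F4 compactO minO F6 bB cN.
have Nc w : omega_set sigma D F w0 b w (c w) by exact/cN.
have lscN := omega_set_lsc flow admD F1 F2 F3 F4 compactO minO F6 bB.
exists c; split.
- move=> w; apply/cvg_ballP => e e0; have [d d0 Hd] := lscN w0 _ _ _ (Nc w) e0.
  apply/nbhs_ballP; exists d; first exact: d0.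
  move=> w'; rewrite ballEmdist => /Hd[x /cN xc]; rewrite xc => h.
  by rewrite ballEmdist.
- move=> w t t0; have [x [Nx xw]] := Nf _ _ _ (Nc w) t0.
  have [ud ue] := u_eq flow admD F1 F2 F4 t0 (Ns _ _ _ Nx t0).
  rewrite xw in ud ue; split; first exact: ud.
  by rewrite ue; move/cN: Nx => ->.
- apply/seteqP; split=> [[w x]|_ [w _ <-]].
    by move=> /omega_limitP/Kc /= ->; exists w.
  by apply/omega_limitP/Kc.
- apply: far_future_cvg0 => [t|e e0]; first exact: co_dist_ge0.
  (* Times at which the orbit stays away from the copy would have a limit point in [K], which lies
     on the copy, and continuity of [c] then contradicts the distance. *)
  apply: contrapT => /forallNP H.
  have H' k : exists t, far_future k t /\
      e <= co_dist (u sigma D F t w0 x0) (c (sigma t w0)).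
    have /existsNP[t /not_implyP[kt /negP]] := H k.
    by rewrite -leNgt => h; exists t.
  have [t_ Ht] := choice H'.
  have [n|f hf [w [x [/Kc xc ww xx]]]] := omega_set_extract F6 w0 x0B (t_ := t_).
    by have [] := Ht n.
  have e20 : 0 < e / 2 by rewrite divr_gt0.
  have [N1 H1] := xx _ e20; have [N2 H2] := cc _ _ ww _ e20.
  have h1 := H1 _ (leq_maxl N1 N2); have h2 := H2 _ (leq_maxr N1 N2).
  have [_] := Ht (f (maxn N1 N2)); apply/negP; rewrite -ltNge.
  rewrite xc co_distC in h1; rewrite (splitr e).
  exact: co_dist_lt h1 h2.
Qed.
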